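(* Let $X$ be a semigroup and let $\mathsf{i}\in\{1,2,\mathsf{z}\}$. Then: (1) If $X$ is $\mathsf{T_{\!z}S}$-discrete, then $Z(X)$ is group-finite. (2) If $X$ is injectively $\mathsf{T_{\!z}S}$-closed, then $Z(X)$ is group-finite. (3) If $X$ is ideally $\mathsf{T_{\!z}S}$-closed, then $Z(X)$ is group-bounded. (4) If $X$ is $\mathsf{T_{\!z}S}$-closed, then $I\!Z(X)$ is group-bounded. (5) If $X$ is ideally $\mathsf{T_{\!i}S}$-closed, then for every viable idempotent $e\in V\!E(X)$ the maximal subgroup $H_e$ of $X$ is projectively $\mathsf{T_{\!i}S}$-closed and has bounded center $Z(H_e)$. (6) If $X$ is absolutely $\mathsf{T_{\!i}S}$-closed, then for every viable idempotent $e\in V\!E(X)$ the maximal subgroup $H_e$ of $X$ is absolutely $\mathsf{T_{\!i}S}$-closed and has finite center $Z(H_e)$. (7) If $X$ is ideally $\mathsf{T_{\!z}S}$-closed, then the set $\big(Z(X)\cap\sqrt[\mathbb{N}]{V\!E(X)}\big)\setminus H(X)$ is finite.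
   Context: A topological semigroup is a topological space with a continuous associative binary operation. $\mathsf{T_{\!1}S}$ is the class of topological semigroups satisfying $T_1$; $\mathsf{T_{\!2}S}$ the class of Hausdorff topological semigroups; $\mathsf{T_{\!z}S}$ the class of Tychonoff zero-dimensional topological semigroups. For a class $\mathcal C$ of topological semigroups, a semigroup $X$ (considered with the discrete topology) is: $\mathcal C$-closed if for every isomorphic topological embedding $h:X\to Y$ into $Y\in\mathcal C$ the image $h[X]$ is closed in $Y$; injectively $\mathcal C$-closed if for every injective homomorphism $h:X\to Y$ into $Y\in\mathcal C$ the image $h[X]$ is closed in $Y$; absolutely $\mathcal C$-closed if for every homomorphism $h:X\to Y$ into $Y\in\mathcal C$ the image $h[X]$ is closed in $Y$; $\mathcal C$-discrete if for every injective homomorphism $h:X\to Y$ into $Y\in\mathcal C$ the image $h[X]$ is a discrete subspace of $Y$; projectively $\mathcal C$-closed if for every congruence $\approx$ on $X$ the quotient semigroup $X/_\approx$ is $\mathcal C$-closed; ideally $\mathcal C$-closed if for every ideal $I\subseteq X$ (a set with $IX\cup XI\subseteq I$, possibly empty) the Rees quotient semigroup $X/I$ (obtained by collapsing $I$ to a point; $X/\emptyset=X$) is $\mathcal C$-closed. $Z(X)=\{z\in X:\forall x\in X\ (xz=zx)\}$ is the center and $I\!Z(X)=\{z\in Z(X): zX\subseteq Z(X)\}$ the ideal center. A semigroup is group-finite (resp. group-bounded) if every subgroup of it is finite (resp. bounded, i.e. there is $n\in\mathbb N$ with $x^n$ idempotent for all $x$ in it). $E(X)$ is the set of idempotents; for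 $e\in E(X)$, $H_e$ is the maximal subgroup of $X$ containing $e$; $H(X)=\bigcup_{e\in E(X)}H_e$. An idempotent $e$ is viable if the set $\frac{H_e}{e}=\{x\in X: xe=ex\in H_e\}$ has the property that $X\setminus\frac{H_e}{e}$ is an ideal in $X$; $V\!E(X)$ is the set of viable idempotents. For $A\subseteq X$, $\sqrt[\mathbb N]{A}=\{x\in X:\exists n\in\mathbb N\ (x^n\in A)\}$. *)

(* Defs.v *)
From HB Require Import structures.
From mathcomp Require Import all_boot all_order all_algebra.
From mathcomp Require Import all_classical all_reals all_analysis.
From mathcomp Require Import Rstruct Rstruct_topology.

Set Implicit Arguments.
Unset Strict Implicit.
Unset Printing Implicit Defensive.

Local Open Scope classical_set_scope.

Record semigroup := Semigroup {
  sg_carrier :> Type;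
  sg_op : sg_carrier -> sg_carrier -> sg_carrier;
  sg_opA : forall x y z, sg_op x (sg_op y z) = sg_op (sg_op x y) z }.

Arguments sg_op {s}.

Section SemigroupNotions.
Variable X : semigroup.
Local Notation "x * y" := (sg_op x y).

(* x^n for n >= 1 : pow x n = x^(n+1) *)
Fixpoint spow (x : X) (n : nat) : X :=
  match n with 0 => x | n'.+1 => spow x n' * x end.
(* x^n, n >= 1 *)
Definition xpow (x : X) (n : nat) : X := spow x n.-1.

Definition idempotent_el (e : X) := e * e = e.
Definition E_set : set X := [set e | idempotent_el e].

Definition is_subgroup (G : set X) :=
  (exists u, G u) /\ (forall x y, G x -> G y -> G (x * y)) /\
  exists u, [/\ G u, (forall x, G x -> u * x = x /\ x * u = x) &
    forall x, G x -> exists y, [/\ G y, x * y = u & y * x = u]].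

Definition group_finite (A : set X) :=
  forall G, is_subgroup G -> G `<=` A -> finite_set G.

Definition sg_bounded (G : set X) :=
  exists n, (0 < n)%N /\ forall x, G x -> idempotent_el (xpow x n).

Definition group_bounded (A : set X) :=
  forall G, is_subgroup G -> G `<=` A -> sg_bounded G.

Definition sg_center : set X := [set z | forall x, x * z = z * x].
Definition sg_ideal_center : set X :=
  [set z | sg_center z /\ forall x, sg_center (z * x)].

Definition Hmax (e : X) : set X :=
  [set x | exists G, [/\ is_subgroup G, G e & G x]].
Definition H_set : set X := [set x | exists e, E_set e /\ Hmax e x].

Definition is_ideal (I : set X) :=
  forall x y, I x -> I (x * y) /\ I (y * x).

Definition viable (e : X) :=
  E_set e /\
  is_ideal (~` [set x | x * e = e * x /\ Hmax e (x * e)]).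
Definition VE_set : set X := [set e | viable e].

Definition nroot (A : set X) : set X :=
  [set x | exists n, (0 < n)%N /\ A (xpow x n)].

Definition congruence (R : X -> X -> Prop) :=
  [/\ (forall x, R x x), (forall x y, R x y -> R y x),
      (forall x y z, R x y -> R y z -> R x z) &
      forall x y z, R x y -> R (z * x) (z * y) /\ R (x * z) (y * z)].

Definition rees_rel (I : set X) (x y : X) := x = y \/ (I x /\ I y).

End SemigroupNotions.

Arguments sg_center X : clear implicits.
Arguments sg_ideal_center X : clear implicits.
Arguments E_set X : clear implicits.
Arguments VE_set X : clear implicits.
Arguments H_set X : clear implicits.

Lemma sig_ext (T : Type) (P : T -> Prop) (a b : {x | P x}) :
  proj1_sig a = proj1_sig b -> a = b.
Proof.
case: a b => [x px] [y py] /= e; subst y; congr exist; exact: Prop_irrelevance.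
Qed.

Section Quotient.
Variables (X : semigroup) (R : X -> X -> Prop) (HR : congruence R).

Definition qcarrier := {A : set X | exists a, A = R a}.
Definition qcls (a : X) : qcarrier := exist _ (R a) (ex_intro _ a erefl).
Definition qrep (A : qcarrier) : X := projT1 (cid (proj2_sig A)).
Lemma qrepP A : proj1_sig A = R (qrep A).
Proof. by rewrite /qrep; case: cid. Qed.

Lemma qcls_eq a b : R a b -> qcls a = qcls b.
Proof.
case: HR => rf rs rt _ => rab; apply: sig_ext => /=.
apply/funext => c; apply/propext; split => ?; [apply: (rt _ a) => //; exact: rs| exact: rt rab _].
Qed.

Lemma qrepR a : R a (qrep (qcls a)).
Proof.
case: HR => rf rs rt _; have := qrepP (qcls a) => /= E.
by rewrite E; exact: rf.
Qed.

Definition qop (A B : qcarrier) : qcarrier := qcls (sg_op (qrep A) (qrep B)).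

Lemma qop_cls a b : qop (qcls a) (qcls b) = qcls (sg_op a b).
Proof.
case: HR => rf rs rt rc; apply: qcls_eq.
have h1 := qrepR a; have h2 := qrepR b.
apply: (rt _ (sg_op a (qrep (qcls b)))).
  by apply: rs; apply: (proj2 (rc _ _ _ h1)).
by apply: rs; apply: (proj1 (rc _ _ _ h2)).
Qed.

Lemma qcls_rep A : qcls (qrep A) = A.
Proof.
by apply: sig_ext => /=; rewrite -qrepP.
Qed.

Lemma qopA A B C : qop A (qop B C) = qop (qop A B) C.
Proof.
rewrite -(qcls_rep A) -(qcls_rep B) -(qcls_rep C).
by rewrite !qop_cls sg_opA.
Qed.

Definition quotient_sg : semigroup := Semigroup qopA.

End Quotient.

Lemma rees_congruence (X : semigroup) (I : set X) :
  is_ideal I -> congruence (rees_rel I).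
Proof.
move=> HI; split.
- by move=> x; left.
- by move=> x y [->|[]]; [left|right].
- move=> x y z [->|[Ix Iy]] // [<-|[_ Iz]]; [right|right] => //.
- move=> x y z [->|[Ix Iy]]; first by split; left.
  have := HI _ z Ix; have := HI _ z Iy; by split; right; tauto.
Qed.

(* Rees quotient X/I (for I = set0 this is (isomorphic to) X itself) *)
Definition rees_quotient (X : semigroup) (I : set X) (HI : is_ideal I) :
  semigroup := quotient_sg (rees_congruence HI).

Section Hsub.
Variables (X : semigroup) (e : X).
Local Notation "x * y" := (sg_op x y).

Definition Kset : set X :=
  [set x | [/\ e * x = x, x * e = x &
     exists y, [/\ e * y = y, y * e = y, x * y = e & y * x = e]]].

Lemma subgroup_identity (G : set X) : is_subgroup G -> G e -> idempotent_el e ->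
  forall x, G x -> e * x = x /\ x * e = x.
Proof.
move=> [_ [_ [u [Gu Hu Hinv]]]] Ge ee.
have eu : e = u.
  have [y [Gy ey ye]] := Hinv e Ge.
  have [ue eu'] := Hu e Ge.
  have h : y * e = (y * e) * e by rewrite -sg_opA ee.
  by rewrite ye in h; rewrite [RHS]h ue.
by rewrite eu; exact: Hu.
Qed.

Lemma Hmax_K x : idempotent_el e -> Hmax e x -> Kset x.
Proof.
move=> ee [G [sG Ge Gx]].
have hid := subgroup_identity sG Ge ee.
have [ex xe] := hid x Gx.
have sG' := sG; case: sG' => [_ [_ [u [Gu Hu Hinv]]]].
have eu : u = e.
  by have [ue _] := Hu e Ge; have [_ eu'] := hid u Gu; rewrite -eu' ue.
have [y [Gy xy yx]] := Hinv x Gx.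
have [ey ye] := hid y Gy.
by split => //; exists y; split => //; rewrite -eu.
Qed.

Lemma K_subgroup : idempotent_el e -> is_subgroup Kset.
Proof.
move=> ee; split; first by exists e; split => //; exists e.
split.
- move=> x y [ex xe [x' [ex' x'e xx' x'x]]] [ey ye [y' [ey' y'e yy' y'y]]].
  split; first by rewrite sg_opA ex.
  - by rewrite -sg_opA ye.
  exists (y' * x'); split.
  + by rewrite sg_opA ey'.
  + by rewrite -sg_opA x'e.
  + by rewrite -sg_opA (sg_opA y) yy' (sg_opA x) xe.
  + by rewrite -sg_opA (sg_opA x') x'x (sg_opA y') y'e.
- exists e; split.
  + by split => //; exists e.
  + by move=> x [ex xe _].
  + move=> x [ex xe [y [ey ye xy yx]]]; exists y; split => //.
    by split => //; exists x.
Qed.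

Lemma Hmax_closed x y : idempotent_el e -> Hmax e x -> Hmax e y -> Hmax e (x * y).
Proof.
move=> ee hx hy; exists Kset; split.
- exact: K_subgroup.
- by split => //; exists e.
- have [_ [cl _]] := K_subgroup ee.
  by apply: cl; exact: Hmax_K.
Qed.

End Hsub.

Definition Hsg (X : semigroup) (e : X) (ee : idempotent_el e) : semigroup.
Proof.
refine (@Semigroup {x : X | Hmax e x}
  (fun a b => exist _ (sg_op (proj1_sig a) (proj1_sig b))
     (Hmax_closed ee (proj2_sig a) (proj2_sig b))) _).
move=> [a ha] [b hb] [c hc] /=; apply: sig_ext => /=; exact: sg_opA.
Defined.

Definition topsg (Y : topologicalType) (mul : Y -> Y -> Y) :=
  (forall x y z, mul x (mul y z) = mul (mul x y) z) /\
  continuous (fun p : Y * Y => mul p.1 p.2).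

Definition tychonoff_space (Y : topologicalType) :=
  accessible_space Y /\
  forall (B : set Y) (a : Y), closed B -> ~ B a ->
    exists f : Y -> Rdefinitions.R, [/\ continuous f, f a = 0%R & forall b, B b -> f b = 1%R].

Definition zero_dim_space (Y : topologicalType) :=
  forall (y : Y) (U : set Y), nbhs y U -> exists V, [/\ clopen V, V y & V `<=` U].

Inductive sep_class := T1c | T2c | Tzc.

Definition in_class (i : sep_class) (Y : topologicalType) (mul : Y -> Y -> Y) :=
  topsg mul /\
  match i with
  | T1c => accessible_space Y
  | T2c => hausdorff_space Y
  | Tzc => tychonoff_space Y /\ zero_dim_space Y
  end.

Definition is_hom (X : semigroup) (Y : Type) (mul : Y -> Y -> Y) (h : X -> Y) :=
  forall a b, h (sg_op a b) = mul (h a) (h b).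

Definition discrete_subspace (Y : topologicalType) (A : set Y) :=
  forall y, A y -> exists U, open U /\ U `&` A = [set y].

(* ---------- Closedness properties (X carries the discrete topology) ---------- *)

Definition C_closed (i : sep_class) (X : semigroup) :=
  forall (Y : topologicalType) (mul : Y -> Y -> Y) (h : X -> Y),
    in_class i mul -> is_hom mul h -> injective h ->
    discrete_subspace (range h) -> (* h is a topological embedding *)
    closed (range h).

Definition inj_C_closed (i : sep_class) (X : semigroup) :=
  forall (Y : topologicalType) (mul : Y -> Y -> Y) (h : X -> Y),
    in_class i mul -> is_hom mul h -> injective h -> closed (range h).

Definition abs_C_closed (i : sep_class) (X : semigroup) :=
  forall (Y : topologicalType) (mul : Y -> Y -> Y) (h : X -> Y),
    in_class i mul -> is_hom mul h -> closed (range h).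

Definition C_discrete (i : sep_class) (X : semigroup) :=
  forall (Y : topologicalType) (mul : Y -> Y -> Y) (h : X -> Y),
    in_class i mul -> is_hom mul h -> injective h -> discrete_subspace (range h).

Definition proj_C_closed (i : sep_class) (X : semigroup) :=
  forall (Rel : X -> X -> Prop) (HR : congruence Rel),
    C_closed i (quotient_sg HR).

Definition ideal_C_closed (i : sep_class) (X : semigroup) :=
  forall (I : set X) (HI : is_ideal I), C_closed i (rees_quotient HI).

(* Main.v *)
(* Non-closedness is witnessed by filters. Let K be a family of proper filters on a semigroup M
   which is stable under products and such that each member has a base of sets P decided by K
   (every q in K contains P or its complement). Then K is a Tychonoff zero-dimensional
   topological semigroup. So if X is T_zS-closed, then no such family on X^1 that contains the
   principal filters of X has a nonprincipal member concentrated on X.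

   For filters concentrated on the center this yields: a central set with constant product is
   finite; monotone sequences of central idempotents stabilize; the center is periodic; and a
   central subgroup V is bounded when every orbit tV is either bounded or has a small stabilizer,
   for otherwise V contains a sequence x_n in n!V growing so fast that the sums of the tails
   generate a nonprincipal filter. Passing to a Rees quotient that makes the orbits free or zero
   gives (3), and descent along the idempotents below the unit of V gives (4).

   For (1) and (2), an infinite abelian group contains an element of infinite order, a
   quasicyclic subgroup, or an infinite subgroup whose elements have squarefree orders. In the
   first two cases the preceding method applies, with the neighborhood filter of 0 in a
   nondiscrete group topology for (1); in the third case every subgroup is an intersection of
   subgroups of finite index, and one uses the profinite completion.

   For (5), a quotient of H_e with its limit points is glued to the Rees quotient of X by the
   complement of H_e / e; for (6), a homomorphism from H_e is extended by an isolated zero.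

   For (7), nil elements of the center modulo an ideal form a finite set, by induction on the
   nilpotency degree. An infinite set of idempotents e would contain a chain or an antichain, and
   an antichain would produce infinitely many central nil elements modulo an ideal. *)
Require Import Defs.
From HB Require Import structures.
From mathcomp Require Import all_boot all_order all_algebra.
From mathcomp Require Import all_classical all_reals all_analysis.
From mathcomp Require Import Rstruct Rstruct_topology zify.

Set Implicit Arguments.
Unset Strict Implicit.
Unset Printing Implicit Defensive.
Local Open Scope classical_set_scope.

(** * Semigroups of filters *)

(** The delicate requirement is that base sets be decided: along each filter of the family, the
    equation s v = t w with w in the base set must be solvable for almost all v or for almost none.
    In an unbounded group V, one solution turns such equations into memberships in the stabilizer of
    t, and the two conditions on the sequence x_n answer the two kinds of stabilizers. Divisibility
    by n! puts the tails into every stabilizer that contains some qV; rapid growth lets a short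
    combination enter a small stabilizer only if its late coefficients vanish. Smallness is measured
    by finite sets [Z r] instead of {0}, because stabilizers in a quasicyclic group can be finite
    and nonzero. When X must stay discrete, its points are principal filters. In the injective
    setting the points of X e may be blurred into neighborhood filters, which makes the image
    nondiscrete or admits profinite limits. *)

Section NeighborhoodBase.
Variables (T : Type) (N : T -> set (set T)).
Hypothesis Nex : forall y, exists A, N y A.
Hypothesis NI : forall y A B, N y A -> N y B -> exists2 C, N y C & C `<=` A `&` B.

(** The two hypotheses are arguments of this copy of [T], so that the topology declared on it can
    depend on [N] and on them. *)
Definition nbspace of (forall y, exists A, N y A) &
  (forall y A B, N y A -> N y B -> exists2 C, N y C & C `<=` A `&` B) : Type := T.

Definition nbopen : set (set T) :=
  [set U | forall y, U y -> exists2 A, N y A & A `<=` U].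

Lemma nbopenT : nbopen setT.
Proof. by move=> y _; have [A NA] := Nex y; exists A. Qed.

Lemma nbopenI : setI_closed nbopen.
Proof.
move=> U V oU oV y [/oU [A NA AU] /oV [B NB BV]].
have [C NC CAB] := NI NA NB; exists C => // z /CAB [/AU ? /BV ?]; by split.
Qed.

Lemma nbopen_bigU (I : Type) (f : I -> set T) :
  (forall i, nbopen (f i)) -> nbopen (\bigcup_i f i).
Proof.
move=> of_ y [i _ /of_ [A NA Af]]; exists A => // z /Af fz; by exists i.
Qed.

HB.instance Definition _ := gen_eqMixin (nbspace Nex NI).
HB.instance Definition _ := gen_choiceMixin (nbspace Nex NI).
HB.instance Definition _ :=
  isOpenTopological.Build (nbspace Nex NI) nbopenT nbopenI nbopen_bigU.

Lemma nbspace_openE (U : set (nbspace Nex NI)) :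
  open U <-> forall y, U y -> exists2 A, N y A & A `<=` U.
Proof. by []. Qed.

End NeighborhoodBase.

Section TopologicalSemigroups.
Variables (Y : topologicalType) (mul : Y -> Y -> Y).

Lemma mul_continuousP :
  continuous (fun p : Y * Y => mul p.1 p.2) <->
  forall a b O, open O -> O (mul a b) -> exists U V, [/\ open U, U a, open V, V b &
    forall x y, U x -> V y -> O (mul x y)].
Proof.
split=> [mc a b O oO Oab|H [a b] O /=].
  have /= := mc (a, b) O (open_nbhs_nbhs (conj oO Oab)).
  case=> -[A B] /= [nA nB] AB.
  move: nA nB; rewrite !nbhsE => -[U [oU Ua] UA] [V [oV Vb] VB].
  exists U, V; split => // x y Ux Vy.
  by apply: (AB (x, y)); split; [exact: UA|exact: VB].
rewrite nbhsE => -[G' [oG' G'ab] G'O].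
have [U [V [oU Ua oV Vb UV]]] := H _ _ _ oG' G'ab.
exists (U, V); first by split; apply: open_nbhs_nbhs.
by move=> [x y] [/= Ux Vy]; apply/G'O/UV.
Qed.

Lemma closure_openP (A : set Y) y :
  closure A y <-> forall O, open O -> O y -> A `&` O !=set0.
Proof.
split=> [cA O oO Oy|H B]; first exact/cA/open_nbhs_nbhs.
rewrite nbhsE => -[ O [oO Oy] OB]; have [z [Az Oz]] := H _ oO Oy.
by exists z; split => //; exact: OB.
Qed.

(** The separating function is 0 on a clopen neighborhood of [a] that misses [B], and 1
    elsewhere. *)
Lemma zero_dim_tychonoff :
  accessible_space Y -> zero_dim_space Y -> tychonoff_space Y.
Proof.
move=> T1 zd; split => // B a cB Ba.
have nB : nbhs a (~` B) by apply: open_nbhs_nbhs; split => //; exact: closed_openC.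
have [V [[oV cV] Va VB]] := zd _ _ nB.
pose f y : Rdefinitions.R := if `[< V y >] then 0%R else 1%R.
exists f; split; last 2 first.
- by rewrite /f asboolT.
- by move=> b Bb; rewrite /f asboolF // => /VB.
apply/continuousP => A oA.
have -> : f @^-1` A = ([set y | A 0%R] `&` V) `|` ([set y | A 1%R] `&` ~` V).
  apply/seteqP; split=> y /=; rewrite /f; case: asboolP => Vy.
  - by left.
  - by right.
  - by case=> -[].
  - by case=> -[].
apply: openU; apply: openI => //; last exact: closed_openC.
  by have [A0|A0] := pselect (A 0%R); [rewrite (_ : mkset _ = setT)|
    rewrite (_ : mkset _ = set0)]; do ?[exact: openT|exact: open0];
    apply/seteqP; split.
by have [A0|A0] := pselect (A 1%R); [rewrite (_ : mkset _ = setT)|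
    rewrite (_ : mkset _ = set0)]; do ?[exact: openT|exact: open0];
    apply/seteqP; split.
Qed.

Lemma zero_dim_hausdorff :
  accessible_space Y -> zero_dim_space Y -> hausdorff_space Y.
Proof.
move=> T1 zd; rewrite open_hausdorff => x y xy.
have [A [oA /set_mem Ax /set_mem Ay]] := T1 _ _ xy.
have [V [[oV cV] Vx VA]] := zd x A (open_nbhs_nbhs (conj oA Ax)).
exists (V, ~` V) => /=.
  by split; apply/mem_set => // /VA.
by split => //; [exact: closed_openC|rewrite setICr].
Qed.

(** [Tzc] is the smallest of the three classes, so closedness for any [i] yields closedness for
    [Tzc], the class of all filter spaces below. *)
Lemma in_class_Tz (i : sep_class) : in_class Tzc mul -> in_class i mul.
Proof.
case=> ts [[T1 ty] zd]; split => //; case: i => //; exact: zero_dim_hausdorff.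
Qed.

Lemma in_class_T1 (i : sep_class) : in_class i mul -> accessible_space Y.
Proof. by case: i => -[] _ => [//|/hausdorff_accessible //|[[]]]. Qed.

Lemma in_class_TzI : (forall x y z, mul x (mul y z) = mul (mul x y) z) ->
  (forall a b O, open O -> O (mul a b) -> exists U V, [/\ open U, U a, open V, V b &
    forall x y, U x -> V y -> O (mul x y)]) ->
  accessible_space Y -> zero_dim_space Y -> in_class Tzc mul.
Proof.
move=> mA /mul_continuousP mc T1 zd; split; first by split.
by split => //; exact: zero_dim_tychonoff.
Qed.

End TopologicalSemigroups.

Lemma C_closed_Tz (i : sep_class) (X : semigroup) : C_closed i X -> C_closed Tzc X.
Proof. by move=> H Y mul h /(in_class_Tz i); exact: H. Qed.

Lemma proper_meets (T : Type) (F : set_system T) P Q :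
  ProperFilter F -> F P -> F Q -> exists x, P x /\ Q x.
Proof. by move=> FF FP FQ; exact: filter_ex (filterI FP FQ). Qed.

Section FilterSemigroup.
Variables (M : semigroup) (K : set (set (set M))).
Local Notation "x * y" := (sg_op x y).

(** Convergence of the product to [r] along [p] and [q]: [r] is coarser than the filter generated by
    the products of members, in general not equal to it. *)
Definition filter_mul (p q r : set (set M)) := forall R, r R ->
  exists P Q, [/\ p P, q Q & forall x y, P x -> Q y -> R (x * y)].

(* [P] induces the clopen subset [set q in K | q P] of the space of filters [K]. *)
Definition decided (P : set M) := forall q, K q -> q P \/ q (~` P).

Hypothesis KF : forall p, K p -> ProperFilter p.
Hypothesis Kdec : forall p P, K p -> p P -> exists P', [/\ p P', P' `<=` P & decided P'].
Hypothesis Kmul : forall p q, K p -> K q -> exists2 r, K r & filter_mul p q r.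

Lemma filter_disjoint p P : K p -> p P -> p (~` P) -> False.
Proof.
move=> /KF Fp pP pP'; by have [x [? ?]] := proper_meets Fp pP pP'.
Qed.

(** If [r'] contained the complement of a decided member of [r], one product [x * y] would lie both
    in this member and outside it. Hence limits of products are unique in [K]. *)
Lemma filter_mul_sub p q r r' : K p -> K q -> K r -> K r' ->
  filter_mul p q r -> filter_mul p q r' -> r `<=` r'.
Proof.
move=> Kp Kq Kr Kr' m m' R rR.
have [R' [rR' R'R dR']] := Kdec Kr rR.
have [|cR'] := dR' _ Kr'; first by have := KF Kr' => ?; exact: filterS.
have [P [Q [pP qQ PQ]]] := m _ rR'.
have [P' [Q' [pP' qQ' PQ']]] := m' _ cR'.
have Fp := KF Kp; have Fq := KF Kq.
have [x [Px P'x]] := proper_meets _ pP pP'.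
have [y [Qy Q'y]] := proper_meets _ qQ qQ'.
by case: (PQ' _ _ P'x Q'y); exact: PQ.
Qed.

Lemma filter_mul_unique p q r r' : K p -> K q -> K r -> K r' ->
  filter_mul p q r -> filter_mul p q r' -> r = r'.
Proof.
by move=> *; apply/seteqP; split; apply: (@filter_mul_sub p q).
Qed.

Let pts := {p | K p}.
Let hat (P : set M) : set pts := [set p | proj1_sig p P].
Let N (p : pts) : set (set pts) :=
  [set A | exists P, [/\ proj1_sig p P, decided P & A = hat P]].

Let Nex p : exists A, N p A.
Proof.
exists (hat setT), setT; split => //.
  by have := KF (proj2_sig p) => ?; exact: filterT.
by move=> q /KF Fq; left; exact: filterT.
Qed.

Let decidedI P Q : decided P -> decided Q -> decided (P `&` Q).
Proof.
move=> dP dQ q Kq; have Fq := KF Kq.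
case: (dP _ Kq) => [qP|qP]; last by right; apply: filterS qP => x Px [].
case: (dQ _ Kq) => [qQ|qQ]; last by right; apply: filterS qQ => x Px [].
by left; exact: filterI.
Qed.

Let NI p A B : N p A -> N p B -> exists2 C, N p C & C `<=` A `&` B.
Proof.
move=> [P [pP dP ->]] [Q [pQ dQ ->]].
have Fp := KF (proj2_sig p).
exists (hat (P `&` Q)).
  by exists (P `&` Q); split => //; [exact: filterI|exact: decidedI].
move=> q qPQ; have Fq := KF (proj2_sig q).
by split; apply: filterS qPQ => x [].
Qed.

Let Y : topologicalType := nbspace Nex NI.

Let hat_open P : decided P -> open (hat P : set Y).
Proof. by move=> dP; apply/nbspace_openE => p pP; exists (hat P) => //; exists P. Qed.

Let decidedC P : decided P -> decided (~` P).
Proof. by move=> dP q Kq; rewrite setCK; have [] := dP q Kq; [right|left]. Qed.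

Let hatC P : decided P -> ~` hat P = hat (~` P).
Proof.
move=> dP; apply/seteqP; split => q /=.
  by have [] := dP _ (proj2_sig q).
by move=> h1 h2; exact: (filter_disjoint (proj2_sig q) h2 h1).
Qed.

Let hat_clopen P : decided P -> clopen (hat P : set Y).
Proof.
move=> dP; split; first exact: (hat_open dP).
rewrite -openC (hatC dP); apply: (hat_open (decidedC dP)).
Qed.

Let mul_ex (p q : Y) : exists r : Y,
  filter_mul (proj1_sig p) (proj1_sig q) (proj1_sig r).
Proof.
by have [r Kr rP] := Kmul (proj2_sig p) (proj2_sig q); exists (exist _ r Kr).
Qed.

Let mul (p q : Y) : Y := projT1 (cid (mul_ex p q)).

Let mulP (p q : Y) :
  filter_mul (proj1_sig p) (proj1_sig q) (proj1_sig (mul p q)).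
Proof. by rewrite /mul; case: cid. Qed.

(** Different filters of [K] are separated by a decided set, and then a single triple of points of
    [M] would violate associativity. *)
Lemma filter_mulA p q r pq qr s s' : K p -> K q -> K r -> K pq -> K qr -> K s -> K s' ->
  filter_mul p q pq -> filter_mul q r qr -> filter_mul pq r s -> filter_mul p qr s' ->
  s = s'.
Proof.
move=> Kp Kq Kr Kpq Kqr Ks Ks' mpq mqr ms ms'.
suff H : s `<=` s'.
  apply/seteqP; split => // R s'R.
  have [R' [s'R' R'R dR']] := Kdec Ks' s'R.
  have Fs := KF Ks; case: (dR' _ Ks) => [|/H h]; first exact: filterS.
  by case: (filter_disjoint Ks' s'R' h).
move=> R sR; have Fs' := KF Ks'.
have [R' [sR' R'R dR']] := Kdec Ks sR.
have [|cR'] := dR' _ Ks'; first exact: filterS.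
have [A [B [pA qrB AB]]] := ms' _ cR'.
have [C [D [pqC rD CD]]] := ms _ sR'.
have [E [F [qE rF EF]]] := mqr _ qrB.
have [G [I [pG qI GI]]] := mpq _ pqC.
have [Fp Fq Fr] := And3 (KF Kp) (KF Kq) (KF Kr).
have [x [Ax Gx]] := proper_meets _ pA pG.
have [y [Ey Iy]] := proper_meets _ qE qI.
have [z [Dz Fz]] := proper_meets _ rD rF.
case: (AB x (y * z)) => //; first exact: EF.
by rewrite sg_opA; apply: CD => //; exact: GI.
Qed.

(** The filters containing a given decided set form a basic open set, whose complement is basic for
    the complementary decided set; so the base is clopen. Later proofs see the space only through
    [pt]. *)
Lemma filter_semigroup : exists (Y : topologicalType) (mul : Y -> Y -> Y)
    (pt : Y -> set (set M)),
  [/\ in_class Tzc mul, forall y, K (pt y), injective pt, forall p, K p -> exists y, pt y = p &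
   (forall y z, filter_mul (pt y) (pt z) (pt (mul y z))) /\
   (forall U : set Y, open U <-> forall y, U y ->
     exists P, [/\ pt y P, decided P & forall z, pt z P -> U z])].
Proof.
exists Y, mul, (fun p => proj1_sig p); split.
- apply: in_class_TzI.
  + move=> p q r; apply: sig_ext.
    have [kp kq kr] := And3 (proj2_sig p) (proj2_sig q) (proj2_sig r).
    apply/esym/(filter_mulA kp kq kr (proj2_sig (mul p q)) (proj2_sig (mul q r)));
      do ?[exact: mulP|exact: proj2_sig].
  + move=> p q O oO Opq.
    have [_ [R [rR dR ->]] RO]   := (nbspace_openE _).1 oO _ Opq.
    have [P [Q [pP qQ PQ]]] := mulP rR.
    have [P' [pP' P'P dP']] := Kdec (proj2_sig p) pP.
    have [Q' [qQ' Q'Q dQ']] := Kdec (proj2_sig q) qQ.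
    exists (hat P'), (hat Q'); split => //; do ?exact: hat_open.
    move=> x y xP yQ; apply: RO; rewrite /hat /=.
    have [//|cR] := dR _ (proj2_sig (mul x y)).
    have [A [B [xA yB AB]]] := mulP cR.
    have Fx := KF (proj2_sig x); have Fy := KF (proj2_sig y).
    have [a [Aa P'a]] := proper_meets _ xA xP.
    have [b [Bb Q'b]] := proper_meets _ yB yQ.
    by case: (AB _ _ Aa Bb); apply: PQ; [exact: P'P|exact: Q'Q].
  + move=> p q /eqP pq.
    suff [P [pP dP qP]] : exists P, [/\ proj1_sig p P, decided P & proj1_sig q (~` P)].
      exists (hat P); split; [exact: hat_open|exact/mem_set|].
      by apply/mem_set; rewrite hatC.
    apply: contrapT => nP; apply: pq; apply: sig_ext.
    have Fp := KF (proj2_sig p); have Fq := KF (proj2_sig q).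
    suff H : proj1_sig p `<=` proj1_sig q.
      apply/seteqP; split => // R qR.
      have [R' [qR' R'R dR']] := Kdec (proj2_sig q) qR.
      case: (dR' _ (proj2_sig p)) => [|/H h]; first exact: filterS.
      by case: (filter_disjoint (proj2_sig q) qR' h).
    move=> R pR; have [R' [pR' R'R dR']] := Kdec (proj2_sig p) pR.
    have [|cR'] := dR' _ (proj2_sig q); first exact: filterS.
    by case: nP; exists R'.
  + move=> p U; rewrite nbhsE => -[ O [oO Op] OU].
    have [_ [P [pP dP ->]] PO]   := (nbspace_openE _).1 oO _ Op.
    exists (hat P); split => //; first exact: hat_clopen.
    by move=> z /PO /OU.
- by move=> y; exact: proj2_sig.
- by move=> p q; exact: sig_ext.
- by move=> p Kp; exists (exist _ p Kp).
split; first exact: mulP.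
move=> U; split=> [oU y Uy|H].
  have [_ [P [pP dP ->]] PO] := (nbspace_openE _).1 oU _ Uy.
  by exists P; split => // z zP; exact: PO.
apply/nbspace_openE => y Uy; have [P [yP dP PU]] := H _ Uy.
by exists (hat P); [exists P|move=> z /PU].
Qed.

End FilterSemigroup.

Section Adjoin1.
Variable X : semigroup.

Definition adj1_op (a b : option X) : option X :=
  match a, b with
  | Some x, Some y => Some (sg_op x y)
  | Some x, None => Some x
  | None, _ => b
  end.

Lemma adj1_opA a b c : adj1_op a (adj1_op b c) = adj1_op (adj1_op a b) c.
Proof. by case: a b c => [a|] [b|] [c|] //=; rewrite sg_opA. Qed.

(** A unit is adjoined even if [X] has one: the points of [X] are then translates of the principal
    filter at [None], and every filter is its own translate by [None]. *)
Definition adj1 : semigroup := Defs.Semigroup adj1_opA.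

Lemma sg_op1x (a : adj1) : sg_op (None : adj1) a = a.
Proof. by case: a. Qed.

Lemma sg_opx1 (a : adj1) : sg_op a (None : adj1) = a.
Proof. by case: a. Qed.

Lemma sg_op_Some (x y : X) :
  sg_op (Some x : adj1) (Some y : adj1) = (Some (sg_op x y) : adj1).
Proof. by []. Qed.

Lemma adj1_center_Some (z : X) : sg_center X z -> sg_center adj1 (Some z : adj1).
Proof. by move=> Zz [x|] //=; congr Some; exact: Zz. Qed.

Lemma adj1_center_None : sg_center adj1 (None : adj1).
Proof. by move=> [x|]. Qed.

End Adjoin1.

(* A filter in K containing range f is a limit of range f in the semigroup K. *)
Lemma closed_filters (X M : semigroup) (f : X -> M) (K : set (set (set M))) :
  C_closed Tzc X ->
  (forall a b, f (sg_op a b) = sg_op (f a) (f b)) -> injective f ->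
  (forall p, K p -> ProperFilter p) ->
  (forall p P, K p -> p P -> exists P', [/\ p P', P' `<=` P & decided K P']) ->
  (forall p q, K p -> K q -> exists2 r, K r & filter_mul p q r) ->
  (forall x, K [set P | P (f x)]) ->
  forall p, K p -> p (range f) -> exists x, p [set f x].
Proof.
move=> cX fM f_inj KF Kdec Kmul Kf p Kp pf.
have [Y [mul [pt [inY Kpt pt_inj pt_surj [mulP openP]]]]] :=
  filter_semigroup KF Kdec Kmul.
pose h x := projT1 (cid (pt_surj _ (Kf x))).
have hP x : pt (h x) = [set P | P (f x)] by rewrite /h; case: cid.
have hom_h : is_hom mul h.
  move=> a b; apply: pt_inj.
  apply: (@filter_mul_unique M K KF Kdec (pt (h a)) (pt (h b))) => //.
  rewrite !hP => R /= Rab; exists [set f a], [set f b]; split => //.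
  by move=> _ _ -> ->; rewrite -fM.
have h_inj : injective h.
  move=> a b hab; apply: f_inj; move: (hP a); rewrite hab hP => e.
  by have /= : [set P | P (f b)] [set f a] by rewrite e.
have [y py] := pt_surj _ Kp.
suff [x _ hx] : range h y.
  by exists x; rewrite -py -hx hP.
apply: (cX Y mul h inY hom_h h_inj) => [_ [x _ <-]|].
  (* A decided member of this principal filter inside the singleton of [f x] is that singleton, so
     [h x] is isolated in the image. *)
  have [P [xP Pf dP]] := Kdec _ [set f x] (Kf x) (erefl _).
  have Px : P = [set f x] by apply/seteqP; split => // _ ->.
  exists [set y | pt y P]; split.
    by apply/openP => z zP; exists P.
  apply/seteqP; split=> [z [/= zP [w _ wz]]|_ ->]; last first.
    by split; [rewrite /= hP Px|exists x].
  by move: zP; rewrite -wz hP Px /= => /f_inj ->.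
apply/closure_openP => U /openP oU /oU [P [yP dP PU]].
have Fp := KF _ Kp; rewrite py in yP.
have [_ [[x _ <-] Pfx]] := proper_meets Fp pf yP.
exists (h x); split; first by exists x.
by apply: PU; rewrite hP.
Qed.

(** * Central filters *)

(* The family K consists of the filters t (phi i), t in X^1. Since phi i and phi j are
   concentrated on the center, (t (phi i)) (s (phi j)) = (t s u) (phi k). *)
Section CentralFilters.
Variables (X : semigroup) (I : Type) (phi : I -> set (set (adj1 X))).
Local Notation "x * y" := (sg_op x y).
Hypothesis phiF : forall i, ProperFilter (phi i).
Hypothesis phiZ : forall i, phi i (sg_center (adj1 X)).
Hypothesis phi1 : exists i, phi i = [set P | P None].
Hypothesis phiM : forall i j, exists k (u : adj1 X), forall R, phi k [set v | R (u * v)] ->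
  exists P Q, [/\ phi i P, phi j Q & forall x y, P x -> Q y -> R (x * y)].
Hypothesis phi_dec : forall (t : adj1 X) i P, phi i P ->
  exists P', [/\ phi i P', P' `<=` P & forall (s : adj1 X) j,
    phi j [set v | exists2 w, P' w & s * v = t * w] \/
    phi j [set v | ~ exists2 w, P' w & s * v = t * w]].

Lemma central_filters : C_closed Tzc X ->
  forall i, phi i (range Some) -> exists x : X, phi i [set Some x].
Proof.
move=> cX i phii.
pose F (t : adj1 X) i := [set P | phi i [set v | P (t * v)]].
pose K := [set p | exists t i, p = F t i].
have FE t j P : F t j P = phi j [set v | P (t * v)] by [].
have [i1 phi1P] := phi1.
have Fpr t j : ProperFilter (F t j).
  have Pj := phiF j; split; first exact: filter_not_empty.
  split; first exact: filterT.
    by move=> A B; exact: filterI.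
  by move=> A B AB; apply: filterS => v; exact: AB.
suff [x phix] : exists x : X, F None i [set (Some x : adj1 X)].
  have Pi := phiF i; exists x; rewrite /F /= in phix; exact: filterS phix.
apply: (@closed_filters X (adj1 X) Some K) => //.
- by move=> _ [t [j ->]]; exact: Fpr.
- move=> _ P [t [j ->]] /phi_dec-/(_ t) [P' [P'j P'P dP']].
  have Pj := phiF j.
  exists [set t * w | w in P']; split.
  + by rewrite FE; apply: filterS P'j => v; exists v.
  + by move=> _ [w /P'P ? <-].
  move=> _ [s [k ->]]; have Pk := phiF k; case: (dP' s k) => H; [left|right].
    by rewrite FE; apply: filterS H => v [w P'w e]; exists w.
  by rewrite FE; apply: filterS H => v nv [w P'w e]; apply: nv; exists w.
- move=> _ _ [t [j ->]] [s [k ->]].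
  have [l [u mP]] := phiM j k.
  exists (F ((t * s) * u) l); first by exists ((t * s) * u), l.
  move=> R FR; have /mP [P [Q [Pj Qk PQ]]] : phi l [set v | [set w | R ((t * s) * w)] (u * v)].
    have Fl := phiF l; move: FR; rewrite FE; apply: filterS => v Rv.
    by change (R ((t * s) * (u * v))); rewrite sg_opA.
  have [Fj Fk] := (phiF j, phiF k).
  exists [set t * x | x in P `&` sg_center (adj1 X)], [set s * y | y in Q]; split.
  + have PZ : phi j (P `&` sg_center (adj1 X)) by exact: filterI.
    by rewrite FE; apply: filterS PZ => v; exists v.
  + by rewrite FE; apply: filterS Qk => v; exists v.
  move=> _ _ [x [Px Zx] <-] [y Qy <-].
  suff <- : (t * s) * (x * y) = (t * x) * (s * y) by exact: PQ.
  by rewrite -!sg_opA (sg_opA s x) (Zx s) -!sg_opA.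
- move=> x; exists (Some x), i1; rewrite /F phi1P; apply/funext => P.
  by apply/propext.
- by exists None, i.
Qed.

End CentralFilters.

(** * Constant products and filters of central subsemigroups *)

Lemma free_ultrafilter (T : Type) (A : set T) : infinite_set A ->
  exists U : set (set T), [/\ UltraFilter U, U A & forall B, finite_set B -> U (~` B)].
Proof.
move=> iA; pose F := [set P : set T | finite_set (A `\` P)].
have PF : ProperFilter F.
  split; first by rewrite /F /= setD0.
  split; first by rewrite /F /= setDT; exact: finite_set0.
    by move=> P Q FP FQ; rewrite /F /= setDIr finite_setU.
  move=> P Q PQ; apply: sub_finite_set => x [Ax nQx]; split => // /PQ //.
have [U [UU FU]] := ultraFilterLemma PF.
exists U; split => //; first by apply: FU; rewrite /F /= setDv; exact: finite_set0.
move=> B fB; apply: FU; apply: sub_finite_set fB => x [_] /=; exact: contrapT.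
Qed.

(* The case of two filters: F and the principal filter at 1. *)
Section OneCentralFilter.
Variables (X : semigroup) (F : set (set (adj1 X))).
Local Notation "x * y" := (sg_op x y).
Hypothesis FF : ProperFilter F.
Hypothesis FZ : F (sg_center (adj1 X)).
Hypothesis FM : exists u : adj1 X,
  (forall R, F [set v | R (u * v)] ->
     exists P Q, [/\ F P, F Q & forall x y, P x -> Q y -> R (x * y)]) \/
  (forall R, R u ->
     exists P Q, [/\ F P, F Q & forall x y, P x -> Q y -> R (x * y)]).
Hypothesis F_dec : forall (t : adj1 X) P, F P ->
  exists P', [/\ F P', P' `<=` P & forall s : adj1 X,
    F [set v | exists2 w, P' w & s * v = t * w] \/
    F [set v | ~ exists2 w, P' w & s * v = t * w]].
Hypothesis F_dec1 : forall t s : adj1 X, F [set v | s * v = t] \/ F [set v | s * v <> t].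

Lemma one_central_filter : C_closed Tzc X ->
  F (range Some) -> exists x : X, F [set Some x].
Proof.
move=> cX FS.
pose phi (b : bool) := if b then F else [set P | P None].
have phiF b : ProperFilter (phi b).
  case: b => //=; split => //; split => // P Q PQ; exact: PQ.
apply: (@central_filters X bool phi phiF _ _ _ _ cX true FS).
- by case => //=; exact: adj1_center_None.
- by exists false.
- case=> [] [] /=.
  + have [u [mF|m1]] := FM; [by exists true, u|exists false, u => R Ru].
    by apply: m1; rewrite -[u]sg_opx1.
  + exists true, None => R FR; exists R, [set None]; split => // x _ Rx ->.
    by case: x Rx.
  + exists true, None => R FR; by exists [set None], R; split => // _ x -> Rx.
  + exists false, None => R FR; exists [set None], [set None].
    by split => // _ _ -> ->.
move=> t [] P /= FP.
  have [P' [FP' P'P H]] := F_dec t FP; exists P'; split => // s.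
  by case; [exact: H|exact: EM].
exists [set None]; split => //= [_ -> //|s [] /=]; last exact: EM.
have [H|H] := F_dec1 t s; [left|right]; apply: filterS H => v.
  by move=> e; exists None; [by []|exact: etrans e (esym (sg_opx1 t))].
by move=> ne [_ -> e]; apply: ne; exact: etrans e (sg_opx1 t).
Qed.

End OneCentralFilter.

Section Nonsingular.
Variable X : semigroup.
Local Notation "x * y" := (sg_op x y).

(** A free ultrafilter on an infinite [A] has the principal filter at [c] as its square, and an
    ultrafilter decides every set; it would be a nonprincipal limit. *)
Lemma nonsingular (A : set X) c : C_closed Tzc X -> A `<=` sg_center X ->
  (forall a b, A a -> A b -> a * b = c) -> finite_set A.
Proof.
move=> cX AZ Ac; apply: contrapT => iA.
have [U [UU UA Ufin]] := free_ultrafilter iA.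
pose F := [set P : set (adj1 X) | U [set x | P (Some x)]].
have FF : ProperFilter F.
  split; first exact: filter_not_empty.
  split; first exact: filterT.
    by move=> P Q; exact: filterI.
  by move=> P Q PQ; apply: filterS => x; exact: PQ.
have Fdec (P : set (adj1 X)) : F P \/ F (~` P).
  exact: (in_ultra_setVsetC (Some @^-1` P) UU).
suff [x Fx] : exists x : X, F [set Some x].
  have [y [nyx [yx]]] := proper_meets _ (Ufin _ (finite_set1 x)) (Fx : U _).
  exact: nyx.
apply: (@one_central_filter X F FF _ _ _ _ cX).
- rewrite /F /=; apply: filterS UA => x /AZ; exact: adj1_center_Some.
- exists (Some c : adj1 X); right => R Rc.
  have FA : F [set Some a | a in A].
    by rewrite /F /=; apply: filterS UA => x; exists x.
  exists [set Some a | a in A], [set Some a | a in A]; split => //.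
  by move=> _ _ [a Aa <-] [b Ab <-]; rewrite sg_op_Some Ac.
- by move=> t P FP; exists P; split => // s; exact: Fdec.
- by move=> t s; exact: Fdec.
- by rewrite /F /=; apply: filterS UA => x _; exists x.
Qed.

End Nonsingular.

Section SubsemigroupFilter.
Variables (X : semigroup) (F : nat -> set X).
Local Notation "x * y" := (sg_op x y).
Hypothesis F_center : forall m, F m `<=` sg_center X.
Hypothesis F_ex : forall m, F m !=set0.
Hypothesis F_anti : forall m n, (m <= n)%N -> F n `<=` F m.
Hypothesis FM : forall m x y, F m x -> F m y -> F m (x * y).
Hypothesis F_dec : forall (t s : adj1 X) m,
  (exists m', forall x, F m' x -> exists2 w, F m w & s * Some x = t * Some w) \/
  (exists m', forall x w, F m' x -> F m w -> s * Some x <> t * Some w).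
Hypothesis F_dec1 : forall t s : adj1 X,
  (exists m, forall x, F m x -> s * Some x = t) \/
  (exists m, forall x, F m x -> s * Some x <> t).

(** Since every [F m] is a subsemigroup, the filter generated by them is its own square. It must be
    principal, so a singleton contains some [F m]. *)
Lemma subsemigroup_filter : C_closed Tzc X -> exists m x, F m `<=` [set x].
Proof.
move=> cX; pose G := [set P : set (adj1 X) | exists m, F m `<=` [set x | P (Some x)]].
have GF : ProperFilter G.
  split; first by move=> [m Fm]; have [x /Fm] := F_ex m.
  split; first by exists 0.
    move=> P Q [m Pm] [n Qn]; exists (maxn m n) => x Fx; split.
      by apply/Pm/(F_anti _ Fx); exact: leq_maxl.
    by apply/Qn/(F_anti _ Fx); exact: leq_maxr.
  by move=> P Q PQ [m Pm]; exists m => x /Pm /PQ.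
have GFm m : G [set Some x | x in F m] by exists m => x Fx; exists x.
suff [x [m Fm]] : exists x : X, G [set Some x].
  by exists m, x => y /Fm [].
apply: (@one_central_filter X G GF _ _ _ _ cX).
- by exists 0 => x /F_center /adj1_center_Some.
- exists None; left => R [m Rm].
  exists [set Some x | x in F m], [set Some x | x in F m]; split => //.
  by move=> _ _ [a Fa <-] [b Fb <-]; exact: (Rm _ (FM Fa Fb)).
- move=> t P [m Pm]; exists [set Some x | x in F m]; split => //.
    by move=> _ [x Fx <-]; exact: Pm.
  move=> s; case: (F_dec t s m) => -[m' H]; [left|right]; exists m'.
    by move=> x /H [w Fw e]; exists (Some w) => //; exists w.
  by move=> x Fx [_ [w Fw <-]]; exact: H.
- by move=> t s; case: (F_dec1 t s) => -[m H]; [left|right]; exists m.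
- by exists 0 => x _; exists x.
Qed.

End SubsemigroupFilter.

(** * Monotone sequences of central idempotents *)

Section Chains.
Variables (X : semigroup) (e : nat -> X).
Local Notation "x * y" := (sg_op x y).
Hypothesis cX : C_closed Tzc X.
Hypothesis eZ : forall n, sg_center X (e n).

Let se (s : adj1 X) n : adj1 X := s * Some (e n).
Let tail m := [set x | exists2 n, (m <= n)%N & x = e n].

Lemma chain_stationary :
  (forall m x y, tail m x -> tail m y -> tail m (x * y)) ->
  (forall (t s : adj1 X) m,
    (exists m', forall n, (m' <= n)%N -> exists2 k, (m <= k)%N & se s n = se t k) \/
    (exists m', forall n k, (m' <= n)%N -> (m <= k)%N -> se s n <> se t k)) ->
  (forall t s : adj1 X, (exists m, forall n, (m <= n)%N -> se s n = t) \/
    (exists m, forall n, (m <= n)%N -> se s n <> t)) ->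
  exists m, forall n, (m <= n)%N -> e n = e m.
Proof.
move=> tM tdec tdec1.
suff [m [x Fm]] : exists m x, tail m `<=` [set x].
  have ex n : (m <= n)%N -> e n = x by move=> mn; apply: (Fm (e n)); exists n.
  by exists m => n mn; rewrite ex // ex.
apply: (@subsemigroup_filter X tail _ _ _ tM _ _ cX).
- by move=> m _ [n _ ->].
- by move=> m; exists (e m), m.
- by move=> m n mn _ [k nk ->]; exists k => //; exact: leq_trans nk.
- move=> t s m; case: (tdec t s m) => -[m' H]; [left|right]; exists m'.
    by move=> _ [n m'n ->]; have [k mk h] := H n m'n; exists (e k) => //; exists k.
  by move=> _ _ [n m'n ->] [k mk ->]; exact: H.
- move=> t s; case: (tdec1 t s) => -[m' H]; [left|right]; exists m';
  by move=> _ [n m'n ->]; exact: H.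
Qed.

(** Multiplying s e_n = t e_k by a later e_m gives s e_m = t e_m, and this equality persists. So s
    e_n = t e_n for all large n, or no s e_n equals any t e_k. *)
Lemma descending_chain : (forall n m, (n <= m)%N -> e n * e m = e m) ->
  exists m, forall n, (m <= n)%N -> e n = e m.
Proof.
move=> desc.
have seM s n m : (n <= m)%N -> se (se s n) m = se s m.
  by move=> nm; rewrite /se -sg_opA sg_op_Some desc.
have se_up s t n m : (n <= m)%N -> se s n = se t n -> se s m = se t m.
  by move=> nm snt; rewrite -(seM s n m nm) snt seM.
have se_down s n m : (n <= m)%N -> se (se s m) n = se s m.
  by move=> nm; rewrite /se -sg_opA sg_op_Some (eZ n (e m)) desc.
apply: chain_stationary.
- move=> m _ _ [k mk ->] [l ml ->]; have [kl|lk] := leqP k l.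
    by exists l => //; exact: desc.
  by exists k => //; rewrite (eZ l (e k)) desc // ltnW.
- move=> t s m; have [[j Hj]|H] := EM (exists j, se s j = se t j).
    left; exists (maxn j m) => n; rewrite geq_max => /andP[jn mn]; exists n => //.
    exact: se_up Hj.
  right; exists 0 => n k _ _ snk; apply: H; exists (maxn n k).
  by rewrite -(seM s n) ?leq_maxl // snk seM ?leq_maxr.
- move=> t s; have [H|] := EM (forall m, exists2 n, (m <= n)%N & se s n = t).
    left; have [n0 _ sn0] := H 0; exists n0 => n n0n.
    have [k nk sk] := H n.
    rewrite -(seM s n0 n n0n) sn0 -sk; exact: se_down.
  move=> /existsNP[m Hm]; right; exists m => n mn sn.
  by apply: Hm; exists n.
Qed.

Lemma ascending_chain : (forall n m, (n <= m)%N -> e n * e m = e n) ->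
  exists m, forall n, (m <= n)%N -> e n = e m.
Proof.
move=> asc.
have seM s n m : (n <= m)%N -> se (se s n) m = se s n.
  by move=> nm; rewrite /se -sg_opA sg_op_Some asc.
have seM' s n m : (n <= m)%N -> se (se s m) n = se s n.
  by move=> nm; rewrite /se -sg_opA sg_op_Some (eZ n (e m)) asc.
have const s n m j : (n <= j <= m)%N -> se s n = se s m -> se s j = se s n.
  by move=> /andP[nj jm] snm; rewrite -(seM' s j m jm) -snm seM.
apply: chain_stationary.
- move=> m _ _ [k mk ->] [l ml ->]; have [kl|lk] := leqP k l.
    by exists k => //; exact: asc.
  by exists l => //; rewrite (eZ l (e k)) asc // ltnW.
- move=> t s m.
  have [[m' H]|H] := EM (exists m', forall n k, (m' <= n)%N -> (m <= k)%N -> se s n <> se t k).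
    by right; exists m'.
  left; have {}H m' : exists n k, [/\ (m' <= n)%N, (m <= k)%N & se s n = se t k].
    apply: contrapT => nH; apply: H; exists m' => n k mn mk st.
    by apply: nH; exists n, k.
  have [Heq|/existsNP[j0 Hj0]] := EM (forall j, se s j = se t j).
    by exists m => n mn; exists n.
  exists j0 => n j0n; have [n' [k [nn' mk snk]]] := H n; exists k => //.
  (* For [k] at least [j0], multiplication of the equality by [e j0] would contradict the choice of
     [j0]. *)
  have kn' : (k < j0)%N.
    rewrite ltnNge; apply/negP => j0k; apply: Hj0.
    have j0n' := leq_trans j0n nn'.
    by rewrite -(seM' s _ _ j0n') snk seM'.
  have kn'' : (k <= n')%N by apply: leq_trans nn'; apply: leq_trans j0n; exact: ltnW.
  (* Multiplication by [e k] shows that the translate by [s] takes the same value at [k] and [n'],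
     hence also at [n] in between. *)
  have sk : se s k = se s n'.
    by rewrite -(seM' s _ _ kn'') snk seM.
  rewrite (const s k n') // ?sk // nn' andbT.
  by apply: leq_trans j0n; exact: ltnW.
- move=> t s; have [H|] := EM (forall m, exists2 n, (m <= n)%N & se s n = t).
    left; have [n0 _ sn0] := H 0; exists n0 => n n0n.
    have [k nk sk] := H n.
    by rewrite (const s n0 k n) ?n0n // sn0 sk.
  move=> /existsNP[m Hm]; right; exists m => n mn sn.
  by apply: Hm; exists n.
Qed.

End Chains.

(** * Powers and periodicity of the center *)

Lemma dvdn_fact_fact m n : (m <= n)%N -> (m`! %| n`!)%N.
Proof.
move=> /subnKC <-; elim: (n - m)%N => [|k IH]; first by rewrite addn0.
by rewrite addnS factS dvdn_mull.
Qed.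

Section Powers.
Variable X : semigroup.
Local Notation "x * y" := (sg_op x y).
Implicit Types x y z : X.

Lemma centerM x y : sg_center X x -> sg_center X y -> sg_center X (x * y).
Proof. by move=> Zx Zy z; rewrite sg_opA Zx -sg_opA Zy sg_opA. Qed.

Lemma spowD x n m : spow x (n + m).+1 = spow x n * spow x m.
Proof.
elim: m => [|m IH]; first by rewrite addn0.
by rewrite addnS -[LHS]/(spow x (n + m).+1 * x) IH -sg_opA.
Qed.

Lemma xpow1 x : xpow x 1 = x. Proof. by []. Qed.

Lemma xpowD x n m : (0 < n)%N -> (0 < m)%N -> xpow x (n + m) = xpow x n * xpow x m.
Proof.
by case: n m => [|n] [|m] // _ _; rewrite /xpow addSn addnS /= -spowD.
Qed.

Lemma xpowS x n : (0 < n)%N -> xpow x n.+1 = xpow x n * x.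
Proof. by move=> n0; rewrite -addn1 xpowD. Qed.

Lemma xpow_center x n : sg_center X x -> sg_center X (xpow x n).
Proof.
by move=> Zx; rewrite /xpow; elim: n.-1 => //= k IH; exact: centerM.
Qed.

Lemma xpowM x n m : (0 < n)%N -> (0 < m)%N -> xpow (xpow x n) m = xpow x (n * m).
Proof.
move=> n0; elim: m => [//|[|m] IH] _; first by rewrite muln1.
by rewrite xpowS // IH // (mulnS n m.+1) addnC xpowD // muln_gt0 n0.
Qed.

Lemma xpow_mul x y n : sg_center X x -> xpow (x * y) n = xpow x n * xpow y n.
Proof.
move=> Zx; rewrite /xpow; elim: n.-1 => //= k ->.
rewrite -!sg_opA; congr (_ * _).
by rewrite sg_opA Zx -sg_opA.
Qed.

Lemma xpow_idem x n : (0 < n)%N -> idempotent_el x -> xpow x n = x.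
Proof.
move=> n0 xx; elim: n n0 => [//|[|n] IH] _ //.
by rewrite xpowS // IH.
Qed.

End Powers.

Section Periodicity.
Variable X : semigroup.
Local Notation "x * y" := (sg_op x y).

(* The filter generated by the sets [F m] makes z^(n!) converge to a new
   idempotent unless z is periodic. *)
Lemma center_periodic (z : X) : C_closed Tzc X -> sg_center X z ->
  exists2 n, (0 < n)%N & idempotent_el (xpow z n).
Proof.
move=> cX Zz; pose F m := [set x | exists n, [/\ (m < n)%N, (m`! %| n)%N & x = xpow z n]].
suff [m [x Fm]] : exists m x, F m `<=` [set x].
  have lt n : (m < n.+1 * (m.+1)`!)%N.
    rewrite (leq_trans _ (leq_pmull _ _)) //.
    by rewrite factS leq_pmulr // fact_gt0.
  (* All positive multiples of (m+1)! give the same power; taking N = (m+1)! and 2N makes it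
     idempotent. *)
  have Fx n : xpow z (n.+1 * (m.+1)`!) = x.
    by apply: (Fm _); exists (n.+1 * (m.+1)`!)%N; split => //; rewrite factS !dvdn_mull.
  have p0 : (0 < 1 * (m.+1)`!)%N by rewrite mul1n fact_gt0.
  exists (1 * (m.+1)`!)%N => //.
  by rewrite /idempotent_el -xpowD // -mulnDl !Fx.
pose sz (s : adj1 X) n : adj1 X := s * Some (xpow z n).
have szD s n m : (0 < n)%N -> (0 < m)%N -> sz (sz s n) m = sz s (n + m)%N.
  by move=> n0 m0; rewrite /sz -sg_opA sg_op_Some -xpowD.
have sz_shift t s n k j : (0 < n)%N -> (0 < k)%N -> sz s n = sz t k -> sz s (n + j)%N = sz t (k + j)%N.
  by case: j => [|j] n0 k0 e; rewrite ?addn0 // -!szD // e.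
apply: (@subsemigroup_filter X F _ _ _ _ _ _ cX).
- by move=> m _ [n [_ _ ->]]; exact: xpow_center.
- move=> m; exists (xpow z (m.+1)`!), (m.+1)`!.
  by rewrite factS dvdn_mull // leq_pmulr ?fact_gt0.
- move=> m n mn _ [k [nk dk ->]]; exists k; split => //; first exact: leq_ltn_trans nk.
  exact: dvdn_trans (dvdn_fact_fact mn) dk.
- move=> m _ _ [k [mk dk ->]] [l [ml dl ->]]; exists (k + l)%N; split.
  + exact: ltn_addr.
  + exact: dvdn_add.
  + by rewrite xpowD //; [exact: leq_ltn_trans mk|exact: leq_ltn_trans ml].
- move=> t s m.
  (* A single equality s z^n = t z^k, multiplied by z^(j-n), serves every later exponent j of the
     filter. *)
  have [[n [k [mn dn mk dk e]]]|H] := EM (exists n k, [/\ (m < n)%N, (m`! %| n)%N, (m < k)%N,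
      (m`! %| k)%N & sz s n = sz t k]).
    left; exists (maxn m n) => _ [j [ + dj ->]]; rewrite gtn_max => /andP[mj nj].
    exists (xpow z (k + (j - n))); last first.
      rewrite -[LHS]/(sz s j) -[RHS]/(sz t (k + (j - n))) -{1}(subnKC (ltnW nj)).
      by apply: sz_shift => //; [exact: leq_ltn_trans mn|exact: leq_ltn_trans mk].
    exists (k + (j - n))%N; split => //; first exact: ltn_addr.
    rewrite dvdn_add // dvdn_sub //.
    by apply: dvdn_trans dj; apply: dvdn_fact_fact; exact: leq_maxl.
  right; exists m => _ _ [n [mn dn ->]] [k [mk dk ->]] e; apply: H.
  by exists n, k.
- move=> t s; have [H|] := EM (forall m, exists n, [/\ (m < n)%N, (m`! %| n)%N & sz s n = t]); last first.
    move=> /existsNP[m Hm]; right; exists m => _ [n [mn dn ->]] e.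
    by apply: Hm; exists n.
  left; have [n1 [n10 _ s1]] := H 0; have [n2 [n12 _ s2]] := H n1.
  (* The sequence s z^n is periodic from [n1] on with period [d], and the exponents of a late tail
     are all divisible by [d]. *)
  pose d := (n2 - n1)%N; have d0 : (0 < d)%N by rewrite subn_gt0.
  have per n i : (n1 <= n)%N -> sz s (n + i * d)%N = sz s n.
    elim: i n => [|i IH] n n1n; first by rewrite addn0.
    rewrite mulSn addnA IH; last exact: leq_trans (leq_addr _ _).
    have -> : (n + d = n2 + (n - n1))%N by rewrite /d; lia.
    rewrite -[in RHS](subnKC n1n).
    by apply: sz_shift => //; [exact: leq_ltn_trans n12|rewrite s1].
  exists (maxn n1 d) => _ [n [+ dn ->]]; rewrite gtn_max => /andP[n1n dn'].
  have [k [nk dk <-]] := H (maxn n d).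
  move: nk; rewrite gtn_max => /andP[nk dk'].
  have dvd1 : (d %| n)%N.
    by apply: dvdn_trans dn; apply: dvdn_fact; rewrite d0 leq_maxr.
  have dvd2 : (d %| k)%N.
    by apply: dvdn_trans dk; apply: dvdn_fact; rewrite d0 leq_maxr.
  have /dvdnP[i ki] : (d %| k - n)%N by rewrite dvdn_sub.
  by rewrite -[LHS]/(sz s n) -(per n i (ltnW n1n)) -ki subnKC // ltnW.
Qed.

End Periodicity.

(** * Bounded central subgroups *)

Section Pigeonhole.

(** The bound [B] is uniform in [f]. As every difference j - i divides B!, it will turn finiteness
    into one common exponent. *)
Lemma pigeonhole (T : Type) (A : set T) : finite_set A ->
  exists B, forall f : nat -> T, (forall i, A (f i)) ->
    exists i j, [/\ (i < j)%N, (j <= B)%N & f i = f j].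
Proof.
move=> fA; pose U : choiceType := {classic T}.
have [s As] := (@finite_seqP U A).1 fA.
exists (size s) => f fs.
pose t := [seq (f i : U) | i <- iota 0 (size s).+1].
have st : size t = (size s).+1 by rewrite size_map size_iota.
have : ~~ uniq t.
  have ts : {subset t <= s} by move=> _ /mapP[i _ ->]; have := fs i; rewrite As.
  by apply/negP => ut; have := uniq_leq_size ut ts; rewrite st ltnn.
move=> /(uniqPn (f 0 : U)) [i [j [ij]]]; rewrite st ltnS => js.
rewrite !(nth_map 0%N) ?size_iota ?ltnS //; last exact: leq_trans (ltnW ij) js.
rewrite !nth_iota ?ltnS //; last exact: leq_trans (ltnW ij) js.
by move=> fij; exists i, j.
Qed.

End Pigeonhole.

(** * Fast sequences in unbounded abelian groups *)

Section FastSequences.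
Import GRing.Theory Num.Theory.
Local Open Scope ring_scope.
Variable V : zmodType.
Implicit Types (v w : V) (s : seq V) (d : nat -> int).

Lemma finite_multiples_bounded (n : nat) : (0 < n)%N ->
  finite_set (range (fun v : V => v *+ n)) ->
  exists2 m, (0 < m)%N & forall v, v *+ m = 0.
Proof.
move=> n0 /pigeonhole [B HB]; exists (n * B`!)%N; first by rewrite muln_gt0 n0 fact_gt0.
move=> v; have [i|i [j [ij jB e]]] := HB (fun i => v *+ i *+ n).
  by exists (v *+ i).
have {}e : v *+ n *+ (j - i) = 0.
  by rewrite mulrnBr ?(ltnW ij) // mulrnAC -e mulrnAC subrr.
have /dvdnP[k ->] : (j - i %| B`!)%N.
  by apply: dvdn_fact; rewrite subn_gt0 ij (leq_trans (leq_subr _ _) jB).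
by rewrite (mulnC k) mulrnA mulrnA e mul0rn.
Qed.

(** Coefficients in [-N, N] are encoded as ordinals shifted by [N], so that finiteness is that of a
    type of finite functions. *)
Definition bounded_combinations (N : nat) s : set V :=
  [set \sum_(i < size s) s`_i *~ ((f i : nat)%:Z - N%:Z)
     | f in [set: {ffun 'I_(size s) -> 'I_(N + N).+1}]].

Lemma finite_bounded_combinations N s : finite_set (bounded_combinations N s).
Proof. by apply: finite_image; exact: finite_finset. Qed.

Lemma mem_bounded_combinations N s d :
  (forall i, (i < size s)%N -> (`|d i| <= N)%N) ->
  bounded_combinations N s (\sum_(i < size s) s`_i *~ d i).
Proof.
move=> dN; exists [ffun i : 'I_(size s) => inord (absz (d i + N%:Z))] => //.
apply: eq_bigr => i _; congr (_ *~ _); rewrite ffunE inordK.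
  have := dN i (ltn_ord i); lia.
have := dN i (ltn_ord i); lia.
Qed.

Hypothesis V_unbounded : forall n, (0 < n)%N -> exists v, v *+ n != 0.
Variable Z : nat -> set V.
Hypothesis Z_finite : forall n, finite_set (Z n).

(** Otherwise every element of r!V has a nonzero multiple, with factor at most 3r in absolute value,
    in one fixed finite set. Then r!(3r)!V is finite and V is bounded. *)
Lemma fast_step s : let r := size s in exists x, (exists v, x = v *+ r`!) /\
  forall d (c : int), (forall i, (i < r)%N -> (`|d i| <= 3 * r)%N) ->
    (0 < `|c| <= 3 * r)%N -> ~ Z r (\sum_(i < r) s`_i *~ d i + x *~ c).
Proof.
move=> r; apply: contrapT => H.
pose F := [set z - w | z in Z r & w in bounded_combinations (3 * r) s].
have fF : finite_set F.
  by apply: finite_image2; [exact: Z_finite|exact: finite_bounded_combinations].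
pose F' := F `|` [set - f | f in F].
have fF' : finite_set F' by rewrite finite_setU; split => //; exact: finite_image.
pose F'' := [set f *+ k | f in F' & k in `I_((3 * r)`!).+1].
have fF'' : finite_set F'' by apply: finite_image2 => //; exact: finite_II.
have n0 : (0 < r`! * (3 * r)`!)%N by rewrite muln_gt0 !fact_gt0.
have [m m0 Hm] : exists2 m, (0 < m)%N & forall v, v *+ m = 0.
  apply: (finite_multiples_bounded n0); apply: sub_finite_set fF'' => _ [v _ <-].
  have [d [c [dr cr Zdc]]] : exists d (c : int),
    [/\ (forall i, (i < r)%N -> (`|d i| <= 3 * r)%N), (0 < `|c| <= 3 * r)%N &
      Z r (\sum_(i < r) s`_i *~ d i + (v *+ r`!) *~ c)].
    apply: contrapT => nH; apply: H; exists (v *+ r`!); split; first by exists v.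
    by move=> d c dr cr Zdc; apply: nH; exists d, c.
  have Fc : F ((v *+ r`!) *~ c).
    exists (\sum_(i < r) s`_i *~ d i + (v *+ r`!) *~ c) => //.
    exists (\sum_(i < r) s`_i *~ d i); first exact: mem_bounded_combinations.
    by rewrite addrC addKr.
  have F'c : F' ((v *+ r`!) *+ `|c|%N).
    case: (intP c) Fc {cr Zdc} => [|k|k] Fc; [by left|by left|right].
    exists ((v *+ r`!) *~ - k.+1%:Z) => //.
    by rewrite mulrNz opprK abszN.
  have /dvdnP[k kE] : (`|c| %| (3 * r)`!)%N by exact: dvdn_fact.
  exists ((v *+ r`!) *+ `|c|%N) => //; exists k.
    rewrite /= ltnS kE leq_pmulr //; by case/andP: cr.
  by rewrite kE -!mulrnA mulnA (mulnC k) !mulnA.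
by have [v] := V_unbounded m0; rewrite Hm eqxx.
Qed.

(** The factorials make the tails act trivially on bounded orbits; the second condition controls
    orbits with small stabilizers. The factor 3 is spent in [tails_decided]. *)
Lemma fast_sequence : exists x : nat -> V,
  (forall n, exists v, x n = v *+ n`!) /\
  forall r d, (forall i, (i <= r)%N -> (`|d i| <= 3 * r)%N) -> d r != 0 ->
    ~ Z r (\sum_(i < r.+1) x i *~ d i).
Proof.
have [f Hf] := choice fast_step.
pose L := fix L n : seq V := if n is n'.+1 then rcons (L n') (f (L n')) else [::].
pose x n := f (L n).
have LE n : L n = mkseq x n.
  by elim: n => //= n IH; rewrite {1}IH /mkseq -addn1 iotaD map_cat /= cats1.
have sL n : size (L n) = n by rewrite LE size_mkseq.
exists x; split=> [n|r d dr dr0].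
  by have [[v e] _] := Hf (L n); exists v; rewrite /x e sL.
have [_] := Hf (L r); move=> /(_ d (d r)); rewrite sL => H.
rewrite big_ord_recr /=.
have -> : \sum_(i < r) x i *~ d i = \sum_(i < r) (L r)`_i *~ d i.
  by apply: eq_bigr => i _; rewrite LE nth_mkseq.
apply: H => [i ir|]; first by apply: dr; exact: ltnW.
by rewrite dr // andbT absz_gt0.
Qed.

End FastSequences.

Section SequenceFilters.
Import GRing.Theory Num.Theory.
Local Open Scope ring_scope.
Variables (V : zmodType) (Z : nat -> set V) (x : nat -> V).
Implicit Types (d : nat -> int) (g : V).
Hypothesis x_fast : forall r d, (forall i, (i <= r)%N -> (`|d i| <= 3 * r)%N) ->
  d r != 0 -> ~ Z r (\sum_(i < r.+1) x i *~ d i).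

Definition comb d r : V := \sum_(i < r) x i *~ d i.

Lemma comb_widen d r r' : (r <= r')%N -> (forall i, (r <= i)%N -> d i = 0) ->
  comb d r' = comb d r.
Proof.
move=> /subnKC <- d0; elim: (r' - r)%N => [|k IH]; first by rewrite addn0.
by rewrite addnS -IH /comb big_ord_recr /= d0 ?leq_addr // mulr0z addr0.
Qed.

Lemma combD d d' r : comb (fun i => d i + d' i) r = comb d r + comb d' r.
Proof. by rewrite /comb -big_split; apply: eq_bigr => i _; rewrite mulrzDr. Qed.

Lemma combN d r : comb (fun i => - d i) r = - comb d r.
Proof. by rewrite /comb -sumrN; apply: eq_bigr => i _; rewrite mulrNz. Qed.

(** If some coefficient beyond [m] were nonzero, growth at the last such index would keep the
    combination out of [Z r], hence out of [N]. *)
Lemma comb_eq0 (N : set V) d r0 m R : (forall r, (r0 <= r)%N -> N `<=` Z r) ->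
  (r0 <= m)%N -> (forall i, (R <= i)%N -> d i = 0) ->
  (forall i r, (m <= r)%N -> (i <= r)%N -> (`|d i| <= 3 * r)%N) ->
  N (comb d R) -> forall i, (m <= i)%N -> d i = 0.
Proof.
move=> NZ r0m dR dB NdR i0 mi0; apply: contrapT => /eqP di0.
pose P i := (m <= i)%N && (d i != 0).
have exP : exists i, P i by exists i0; rewrite /P mi0.
have PB i : P i -> (i <= R)%N.
  by move=> /andP[_]; apply: contraR; rewrite -ltnNge => /ltnW/dR ->.
case: (ex_maxnP exP PB) => r /andP[mr dr] rmax.
have drmax i : (r.+1 <= i)%N -> d i = 0.
  move=> ri; apply: contrapT => /eqP di; have := rmax i; rewrite /P di.
  by rewrite (leq_trans mr (ltnW ri)) leqNgt ri => /(_ isT).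
have rR : (r.+1 <= R)%N.
  by rewrite ltnNge; apply/negP => /dR e; rewrite e eqxx in dr.
apply: (@x_fast r d) => //; first by move=> i; exact: dB.
apply: (NZ r (leq_trans r0m mr)).
by rewrite -[X in N X]/(comb d r.+1) -(comb_widen rR drmax).
Qed.

Variables (J : Type) (C : nat -> J -> set (nat -> int)).
Hypothesis C_bnd : forall k, exists i0, forall m d i, C m k d -> (`|d i| <= maxn i i0)%N.
Hypothesis C_paste : forall m m' k l d u u', (m <= m')%N ->
  C m k d -> C m' l u -> C m' l u' -> (forall i, (m' <= i)%N -> d i = u i) ->
  C m k (fun i => d i - u i + u' i).

(** The admissible coefficients [C] are left abstract because two instances are used: sums of k
    terms, and neighborhoods of 0 in a group topology. *)
Definition tails m k : set V :=
  [set v | exists d r, [/\ C m k d, forall i, (r <= i)%N -> d i = 0 & v = comb d r]].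

(** A late solution (u, v) must have equal coefficients beyond m', since [comb_eq0] applies to the
    difference. Replacing the part [u] of [v] by any other [u'] solves the equation for [u']. *)
Lemma tails_decided (N : set V) r0 g k l m :
  (forall u v : V, N u -> N v -> N (u - v)) ->
  (forall r, (r0 <= r)%N -> N `<=` Z r) ->
  (forall m', exists u v, [/\ tails m' l u, tails m k v & N (g + u - v)]) ->
  exists m', forall u, tails m' l u -> exists2 v, tails m k v & N (g + u - v).
Proof.
move=> NB NZ H.
have ND (u v : V) : N u -> N v -> N (u + v).
  move=> Nu Nv; have N0 : N 0 by rewrite -(subrr u); exact: NB.
  by rewrite -[v]opprK -[- v]sub0r; apply: (NB) => //; apply: (NB).
have [ik Hik] := C_bnd k; have [il Hil] := C_bnd l.
have [_ [_ [[d0 [s0 [Cd0 d0s0 ->]]] [e0 [t0 [Ce0 e0t0 ->]]] N0]]] := H 0%N.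
pose r1 := maxn s0 t0.
rewrite -(comb_widen (leq_maxl s0 t0) d0s0) -(comb_widen (leq_maxr s0 t0) e0t0) -/r1 in N0.
(* Modulo [N], the element [g] is the fixed combination with coefficients [b]. *)
pose b i := e0 i - d0 i.
have br1 i : (r1 <= i)%N -> b i = 0.
  by rewrite geq_max => /andP[? ?]; rewrite /b d0s0 // e0t0 // subrr.
have Nb : N (g - comb b r1) by rewrite /b combD combN opprB addrA.
move: b br1 Nb => b br1 Nb.
pose B := \max_(i < r1) absz (b i).
have bB i : (`|b i| <= B)%N.
  have [ir|/br1 ->] := ltnP i r1; last by rewrite absz0.
  exact: (@leq_bigmax_cond _ xpredT (fun i : 'I_r1 => absz (b i)) (Ordinal ir)).
pose m' := (m + r0 + r1 + ik + il + B)%N.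
have [_ [_ [[u [s [Cu us ->]]] [v [t [Cv vt ->]]] Nuv]]] := H m'.
exists m' => _ [u' [s' [Cu' us' ->]]].
pose R := (r1 + s + t)%N.
rewrite -(comb_widen (_ : s <= R)%N us) in Nuv; last by rewrite /R; lia.
rewrite -(comb_widen (_ : t <= R)%N vt) in Nuv; last by rewrite /R; lia.
pose D i := b i + (u i - v i).
have ND' : N (comb D R).
  rewrite /D !combD combN (comb_widen (_ : r1 <= R)%N br1); last by rewrite /R; lia.
  have -> : comb b r1 + (comb u R - comb v R) =
    (g + comb u R - comb v R) - (g - comb b r1).
    by rewrite opprB -(addrA g) [RHS]addrC [RHS]addrA subrK.
  exact: NB.
(* Each of [b], [u], [v] has coefficients at most r in absolute value at this stage; their sum gives
   the bound 3r. *)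
have D0 : forall i, (m' <= i)%N -> D i = 0.
  apply: (@comb_eq0 N D r0 m' R NZ _ _ _ ND'); first by rewrite /m'; lia.
    by move=> i Ri; rewrite /D br1 ?us ?vt ?subrr ?addr0 //; rewrite /R in Ri; lia.
  move=> i r m'r ir.
  have hb := bB i.
  have hu : (`|u i| <= r)%N.
    apply: leq_trans (Hil _ _ i Cu) _; rewrite geq_max ir /=; rewrite /m' in m'r; lia.
  have hv : (`|v i| <= r)%N.
    apply: leq_trans (Hik _ _ i Cv) _; rewrite geq_max ir /=; rewrite /m' in m'r; lia.
  have hB : (B <= r)%N by rewrite /m' in m'r; lia.
  rewrite /D; lia.
have vu i : (m' <= i)%N -> v i = u i.
  move=> m'i; have := D0 _ m'i; rewrite /D br1; last by rewrite /m' in m'i; lia.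
  by rewrite add0r => /eqP; rewrite subr_eq0 => /eqP.
exists (comb (fun i => v i - u i + u' i) (R + s')).
  exists (fun i => v i - u i + u' i), (R + s')%N; split => //.
    by apply: (C_paste _ Cv Cu Cu' vu); rewrite /m'; lia.
  by move=> i Ri; rewrite vt ?us ?us' ?subrr ?addr0 //; rewrite /R in Ri; lia.
rewrite !combD combN (comb_widen (_ : R <= R + s')%N (_ : forall i, (R <= i)%N -> v i = 0)); last 2 first.
- by rewrite leq_addr.
- by move=> i Ri; rewrite vt //; rewrite /R in Ri; lia.
rewrite (comb_widen (_ : R <= R + s')%N (_ : forall i, (R <= i)%N -> u i = 0)); last 2 first.
- by rewrite leq_addr.
- by move=> i Ri; rewrite us //; rewrite /R in Ri; lia.
rewrite (comb_widen (leq_addl R s') us').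
by have -> : g + comb u' s' - (comb v R - comb u R + comb u' s') = g + comb u R - comb v R
  by rewrite opprD addrACA subrr addr0 opprB addrA.
Qed.

End SequenceFilters.

Section CombSingle.
Import Order.TTheory GRing.Theory Num.Theory.
Local Open Scope ring_scope.
Variables (V : zmodType) (x : nat -> V).

Lemma sum_single (j r : nat) (c : int) : (j < r)%N ->
  \sum_(i < r) (if (i : nat) == j then c else 0) = c.
Proof.
move=> jr; rewrite (bigD1 (Ordinal jr)) //= eqxx big1 ?addr0 // => i.
by rewrite -val_eqE /= => /negbTE ->.
Qed.

Lemma comb_single (j r : nat) (c : int) : (j < r)%N ->
  comb x (fun i => if i == j then c else 0) r = x j *~ c.
Proof.
move=> jr; rewrite /comb (bigD1 (Ordinal jr)) //= eqxx big1 ?addr0 // => i.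
by rewrite -val_eqE /= => /negbTE ->; rewrite mulr0z.
Qed.

Lemma fast_neq (Z : nat -> set V) r :
  (forall r d, (forall i, (i <= r)%N -> (`|d i| <= 3 * r)%N) ->
    d r != 0 -> ~ Z r (\sum_(i < r.+1) x i *~ d i)) ->
  Z r.+1 0 -> x r.+1 <> x r.
Proof.
move=> x_fast Z0 e.
pose d i := (if i == r.+1 then 1%:Z else 0) + (if i == r then -1 else 0) : int.
apply: (x_fast r.+1 d).
- by move=> i _; rewrite /d; case: eqP; case: eqP => //=; lia.
- by rewrite /d eqxx gtn_eqF.
rewrite -[X in Z _ X]/(comb x d r.+2) combD !comb_single //.
by rewrite mulr1z mulrN1z e subrr.
Qed.

End CombSingle.

Section UnboundedCentral.
Import Order.TTheory GRing.Theory Num.Theory.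
Local Open Scope ring_scope.
Variables (X : semigroup) (V : zmodType) (io : V -> X) (Z : nat -> set V).
Local Notation "x ** y" := (sg_op x y) (at level 40, left associativity).
Hypothesis cX : C_closed Tzc X.
Hypothesis ioD : forall u v, io (u + v) = io u ** io v.
Hypothesis io_inj : injective io.
Hypothesis ioZ : forall v, sg_center X (io v).
Hypothesis Z_finite : forall n, finite_set (Z n).
Hypothesis stab : forall t : X,
  (exists2 q, (0 < q)%N & forall v, t ** io (v *+ q) = t ** io 0) \/
  (exists r0, forall r v, (r0 <= r)%N -> t ** io v = t ** io 0 -> Z r v).

Let coeffs (m k : nat) : set (nat -> int) :=
  [set d | [/\ forall i, (i < m)%N -> d i = 0, forall i, 0 <= d i &
    exists2 r, forall i, (r <= i)%N -> d i = 0 & \sum_(i < r) d i = k%:Z]].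

Let sum_widen (d : nat -> int) r r' : (r <= r')%N -> (forall i, (r <= i)%N -> d i = 0 :> int) ->
  \sum_(i < r') d i = \sum_(i < r) d i.
Proof.
move=> rr' d0; have := comb_widen (fun=> 1 : int) rr' d0.
by rewrite /comb; under eq_bigr do rewrite -mulrzl mulr1 intz;
  under [in X in _ = X -> _]eq_bigr do rewrite -mulrzl mulr1 intz.
Qed.

Let coeffs_le m k d i : coeffs m k d -> d i <= k%:Z.
Proof.
move=> [_ d0 [r dr dk]]; have [ir|ri] := ltnP i r; last by rewrite dr.
by rewrite -dk (bigD1 (Ordinal ir)) //= lerDl; apply: sumr_ge0 => j _; exact: d0.
Qed.

Let coeffs_bnd k : exists i0, forall m d i, coeffs m k d -> (`|d i| <= maxn i i0)%N.
Proof.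
exists k => m d i Cd; apply: leq_trans (leq_maxr _ _).
have := coeffs_le i Cd; case: Cd => _ d0 _; have := d0 i; lia.
Qed.

Let coeffs_paste m m' k l d u u' : (m <= m')%N ->
  coeffs m k d -> coeffs m' l u -> coeffs m' l u' -> (forall i, (m' <= i)%N -> d i = u i) ->
  coeffs m k (fun i => d i - u i + u' i).
Proof.
move=> mm' [dm d0 [r dr dk]] [um u0 [s us ul]] [u'm u'0 [s' us' ul']] du; split.
- move=> i im; have im' := leq_trans im mm'.
  by rewrite dm // um // u'm // subrr addr0.
- move=> i; have [im'|m'i] := ltnP i m'; first by rewrite um // u'm // subr0 addr0.
  by rewrite du // subrr add0r.
pose R := (r + s + s')%N.
exists R => [i Ri|]; first by rewrite dr ?us ?us' ?subrr ?addr0 //; rewrite /R in Ri; lia.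
rewrite big_split sumrB /= (sum_widen _ dr) ?(sum_widen _ us) ?(sum_widen _ us') /R; try lia.
by rewrite dk ul ul' subrK.
Qed.

Let single_coeffs m k j : (m <= j)%N ->
  coeffs m k (fun i => if i == j then k%:Z else 0).
Proof.
move=> mj; split.
- by move=> i im; rewrite ltn_eqF //; exact: leq_trans mj.
- by move=> i; case: eqP.
by exists j.+1 => [i ji|]; [rewrite gtn_eqF|exact: sum_single].
Qed.

(* The filter phi k is generated by the sums of k terms of a tail of the fast sequence x, so that
   phi k + phi l = phi (k + l). If phi 1 were principal, then x would be eventually constant. *)
Lemma central_group_bounded : exists2 n, (0 < n)%N & forall v : V, v *+ n = 0.
Proof.
apply: contrapT => unb.
have V_unb n : (0 < n)%N -> exists v : V, v *+ n != 0.
  move=> n0; apply: contrapT => H; apply: unb; exists n => // v.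
  by apply: contrapT => /eqP vn; apply: H; exists v.
have [x [x_fact x_fast]] := fast_sequence V_unb Z_finite.
pose W := tails x coeffs.
have W0 m v : W m 0%N v -> v = 0.
  move=> [d [r [Cd dr ->]]]; rewrite /comb big1 // => i _.
  suff -> : d i = 0 by rewrite mulr0z.
  apply/eqP; rewrite eq_le (coeffs_le i Cd) /=.
  by case: Cd => _ d0 _; exact: d0.
have Wx m k j : (m <= j)%N -> W m k (x j *~ k%:Z).
  move=> mj; exists (fun i => if i == j then k%:Z else 0), j.+1; split.
  - exact: single_coeffs.
  - by move=> i ji; rewrite gtn_eqF.
  - by rewrite comb_single.
have Wanti m m' k v : (m <= m')%N -> W m' k v -> W m k v.
  move=> mm' [d [r [[dm d0 ds] dr ->]]]; exists d, r; split => //; split => // i im.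
  by apply: dm; exact: leq_trans mm'.
have WD m k l u v : W m k u -> W m l v -> W m (k + l)%N (u + v).
  move=> [d [r [[dm d0 [dr' ds dk]] dr ->]]] [e [s [[em e0 [es' ess el]] es ->]]].
  exists (fun i => d i + e i), (r + s)%N; split; first split.
  - by move=> i im; rewrite dm // em.
  - by move=> i; rewrite addr_ge0.
  - exists (dr' + es')%N => [i ri|]; first by rewrite ds ?ess //; lia.
    rewrite big_split /= (sum_widen _ ds) ?(sum_widen _ ess) ?leq_addr ?leq_addl //.
    by rewrite dk el.
  - by move=> i ri; rewrite dr ?es //; lia.
  by rewrite combD (comb_widen _ _ dr) ?(comb_widen _ _ es) ?leq_addr ?leq_addl.
(* For k = 0 the value is the adjoined unit and not [io 0]: [phi 0] has to be the principal filter
   at [None]. *)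
pose emb k v : adj1 X := if k is 0%N then None else Some (io v).
pose phi k := [set P : set (adj1 X) | exists m, forall v, W m k v -> P (emb k v)].
have phiF k : ProperFilter (phi k).
  split; first by move=> [m /(_ _ (Wx m k m (leqnn m)))].
  split; first by exists 0%N.
    move=> P Q [m Pm] [n Qn]; exists (maxn m n) => v Wv; split.
      by apply/Pm/(Wanti _ _ _ _ _ Wv); exact: leq_maxl.
    by apply/Qn/(Wanti _ _ _ _ _ Wv); exact: leq_maxr.
  by move=> P Q PQ [m Pm]; exists m => v /Pm /PQ.
have embM k l u v m : W m k u -> W m l v ->
    sg_op (emb k u) (emb l v) = emb (k + l)%N (u + v).
  case: k l => [|k] [|l] // Wu Wv; rewrite /emb.
  - by rewrite (W0 _ _ Wu) add0r add0n.
  - by rewrite (W0 _ _ Wv) addr0 addn0.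
  - by rewrite addSn ioD.
suff [y [m phiy]] : exists y : X, phi 1%N [set Some y].
  (* If the orbit of [io 0] is bounded, then so is [V]; otherwise 0 belongs to [Z r] for large r,
     and [fast_neq] applies. *)
  have [[q q0 Hq]|[r0 Hr0]] := stab (io 0).
    apply: unb; exists q => // v; apply: io_inj.
    by have := Hq v; rewrite -!ioD !add0r.
  have xy i : (m <= i)%N -> io (x i) = y.
    by move=> mi; have [] := phiy _ (Wx m 1%N i mi).
  pose i := (m + r0)%N.
  apply: (@fast_neq _ x Z i x_fast).
    by apply: (Hr0 i.+1 0) => //; rewrite /i; lia.
  by apply: io_inj; rewrite !xy // /i; lia.
apply: (@central_filters X nat phi phiF _ _ _ _ cX 1%N).
- move=> k; exists 0%N => v _; case: k => [|k]; first exact: adj1_center_None.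
  exact: adj1_center_Some.
- exists 0%N; apply/funext => P; apply/propext; split => [[m]|PN].
    by move=> /(_ _ (Wx m 0%N m (leqnn m))).
  by exists 0%N.
- move=> k l; exists (k + l)%N, None => R [m Rm].
  exists [set emb k u | u in W m k], [set emb l u | u in W m l]; split.
  + by exists m => v; exists v.
  + by exists m => v; exists v.
  by move=> _ _ [u Wu <-] [v Wv <-]; rewrite (embM k l u v m) //; apply/Rm/WD.
- move=> t k P [m Pm]; exists [set emb k v | v in W m k]; split.
  + by exists m => v; exists v.
  + by move=> _ [v Wv <-]; exact: Pm.
  move=> s l.
  have [Hd|H] := EM (exists m', forall u, W m' l u ->
      ~ exists2 v, W m k v & sg_op s (emb l u) = sg_op t (emb k v)).
    right; have [m' Hm'] := Hd; exists m' => u Wu [_ [v Wv <-] e].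
    by apply: (Hm' u Wu); exists v.
  left; have {}H m' : exists u v, [/\ W m' l u, W m k v &
      sg_op s (emb l u) = sg_op t (emb k v)].
    apply: contrapT => nH; apply: H; exists m' => u Wu [v Wv e].
    by apply: nH; exists u, v.
  suff [m' Hm'] : exists m', forall u, W m' l u -> exists2 v, W m k v &
      sg_op s (emb l u) = sg_op t (emb k v).
    by exists m' => u /Hm' [v Wv e]; exists (emb k v) => //; exists v.
  case: l H => [|l] H.
    have [u [v [_ Wv e]]] := H 0%N.
    by exists 0%N => u' _; exists v.
  (* On the range of [io] the adjoined unit acts as [io 0], which allows replacing [s] and [t] by
     elements of [X]. *)
  pose base (s : adj1 X) : X := if s is Some a then a else io 0.
  have baseE p w : sg_op p (Some (io w) : adj1 X) = Some (base p ** io w).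
    by case: p => [a|] //=; rewrite -ioD add0r.
  have base0 w : sg_op (Some (io w) : adj1 X) (Some (io 0) : adj1 X) = Some (io w).
    by rewrite sg_op_Some -ioD addr0.
  have tE v : sg_op (sg_op t (emb k v)) (Some (io 0) : adj1 X) =
      Some (base t ** io (if k is 0%N then 0 else v)).
    case: k {Pm phi phiF embM H} => [|k].
      by rewrite -[LHS]/(sg_op (sg_op t (None : adj1 X)) (Some (io 0) : adj1 X)) sg_opx1 baseE.
    by rewrite -sg_opA base0 baseE.
  have kv v : W m k v -> (if k is 0%N then 0 else v) = v.
    by case: k {Pm phi phiF embM H tE} => // Wv; rewrite (W0 _ _ Wv).
  have eqbase u v : W m k v -> sg_op s (emb l.+1 u) = sg_op t (emb k v) ->
      base s ** io u = base t ** io v.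
    move=> Wv e; have := tE v; rewrite -e (kv v Wv) /emb -sg_opA base0 baseE.
    by case.
  (* For k = 0, equality of [t] with a product by some [io u] forces [t] to absorb [io 0]. *)
  have tabs : forall v, W m k v -> sg_op t (emb k v) = Some (base t ** io v).
    have [u [v [_ _ e]]] := H 0%N.
    case: k Pm H tE kv eqbase e => [|k] Pm H tE kv eqbase e w Ww; last by rewrite /emb baseE.
    have t0 : sg_op (sg_op t (emb 0%N 0)) (Some (io 0) : adj1 X) = Some (base t ** io 0).
      exact: tE.
    have e' : sg_op t (emb 0%N 0) = sg_op s (emb l.+1 u) := esym e.
    rewrite (W0 _ _ Ww) -t0 e' /emb -sg_opA.
    by rewrite base0.
  have [u0 [v0 [_ Wv0 /(eqbase _ _ Wv0) e0]]] := H 0%N.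
  (* One solution (u0, v0) makes [s] act on [V] as [t] translated by [g]; all further equations are
     memberships in the stabilizer [N] of [t]. *)
  pose g := v0 - u0.
  have gE : base s ** io 0 = base t ** io g.
    have -> : io 0 = io u0 ** io (- u0) by rewrite -ioD subrr.
    by rewrite sg_opA e0 -sg_opA -ioD.
  have sE u : base s ** io u = base t ** io (g + u).
    have -> : io u = io 0 ** io u by rewrite -ioD add0r.
    by rewrite sg_opA gE -sg_opA -ioD.
  pose N := [set w | base t ** io w = base t ** io 0].
  have NE w v : base t ** io w = base t ** io v <-> N (w - v).
    split=> [e|Nwv].
      by rewrite /N /= ioD sg_opA e -sg_opA -ioD subrr.
    by rewrite -[w](subrK v) ioD sg_opA Nwv -sg_opA -ioD add0r.
  have NB u v : N u -> N v -> N (u - v).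
    by move=> Nu Nv; apply: (NE u v).1; exact: etrans Nu (esym Nv).
  have {}H m' : exists u v, [/\ W m' l.+1 u, W m k v & N (g + u - v)].
    have [u [v [Wu Wv /(eqbase _ _ Wv) e]]] := H m'.
    by exists u, v; split => //; apply: (NE (g + u) v).1; rewrite -sE.
  suff [m' Hm'] : exists m', forall u, W m' l.+1 u -> exists2 v, W m k v & N (g + u - v).
    exists m' => u /Hm' [v Wv Nv]; exists v => //; have e := (NE (g + u) v).2 Nv.
    by rewrite tabs // /emb baseE sE e.
  have [[q q0 Hq]|[r0 Hr0]] := stab (base t); last first.
    apply: (tails_decided (Z := Z) (r0 := r0) x_fast coeffs_bnd coeffs_paste NB) => //.
    by move=> r rr0 w Nw; exact: (Hr0 r w rr0 Nw).
  have N0 : N 0 by [].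
  have ND u v : N u -> N v -> N (u + v).
    by move=> Nu Nv; rewrite -[v]opprK -[- v]sub0r; apply: (NB) => //; exact: (NB).
  have Nn u (n : nat) : N u -> N (u *+ n).
    by move=> Nu; elim: n => [//|n IH]; rewrite mulrS; exact: ND.
  have Nz u (c : int) : N u -> N (u *~ c).
    move=> Nu; case: (intP c) => [//|n|n]; first exact: Nn.
    by rewrite mulrNz -[- _]sub0r; apply: (NB) => //; exact: Nn.
  (* Here the divisibility of [x i] by i! is used: late terms fix a bounded orbit. *)
  have Nx i : (q <= i)%N -> N (x i).
    move=> qi; have [v ->] := x_fact i.
    have /dvdnP[c ->] : (q %| i`!)%N by apply: dvdn_fact; rewrite q0.
    by rewrite mulrnA; exact: Hq.
  have NW u : W q l.+1 u -> N u.
    move=> [d [r [[dq _ _] _ ->]]].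
    apply: (big_ind N) => // i _; have [iq|qi] := ltnP i q.
      by rewrite dq // mulr0z.
    by apply: Nz; exact: Nx.
  have [u1 [v1 [Wu1 Wv1 N1]]] := H q.
  exists q => u Wu; exists v1 => //.
  have -> : g + u - v1 = (g + u1 - v1) + (u - u1).
    by rewrite [RHS]addrACA [in RHS](addrAC g) [RHS]addrACA subrr addr0.
  by apply: ND => //; apply: (NB); exact: NW.
- by exists 0%N.
Qed.

End UnboundedCentral.

(** * Finite central subgroups *)

(* K consists of the filters t (phi j) for the points t of the ideal X e, e = io 0, and of the
   principal filters of the other points. The filter phi eps is the neighborhood filter of 0 in
   the group V, hence a point t of X e is represented by t (phi eps). *)
Section GroupFilters.
Import GRing.Theory.
Local Open Scope ring_scope.
Variables (X : semigroup) (V : zmodType) (io : V -> X).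
Local Notation "x ** y" := (sg_op x y) (at level 40, left associativity).
Hypothesis ioD : forall u v, io (u + v) = io u ** io v.
Hypothesis io_inj : injective io.
Hypothesis ioZ : forall v, sg_center X (io v).
Variables (J : Type) (phi : J -> set (set V)) (eps : J).
Hypothesis phiF : forall i, ProperFilter (phi i).
Let mulJ i j k := forall R, phi k R ->
  exists P Q, [/\ phi i P, phi j Q & forall x y, P x -> Q y -> R (x + y)].
Hypothesis phiM : forall i j, exists k, mulJ i j k.
Hypothesis epsM : mulJ eps eps eps.
Hypothesis eps0 : forall R, phi eps R -> R 0.
Hypothesis phi_dec : forall (t : X) i P, t ** io 0 = t -> phi i P ->
  exists P', [/\ phi i P', P' `<=` P & forall (s : X) j, s ** io 0 = s ->
    phi j [set v | exists2 w, P' w & s ** io v = t ** io w] \/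
    phi j [set v | ~ exists2 w, P' w & s ** io v = t ** io w]].
Hypothesis phi_sep : forall t s, t ** io 0 = t -> s ** io 0 = s -> t <> s ->
  exists2 P, phi eps P & forall w, P w -> s <> t ** io w.

Let F (t : X) j : set (set X) := [set P | phi j [set v | P (t ** io v)]].
Let h x : set (set X) := if `[< x ** io 0 = x >] then F x eps else [set P | P x].
Let K : set (set (set X)) := [set p | (exists2 x, x ** io 0 <> x & p = [set P | P x]) \/
  exists t j, t ** io 0 = t /\ p = F t j].

Let io0 v : io v ** io 0 = io v.
Proof. by rewrite -ioD addr0. Qed.

Let ioC v x : io v ** x = x ** io v.
Proof. by rewrite (ioZ v x). Qed.

Let abs_r x y : y ** io 0 = y -> (x ** y) ** io 0 = x ** y.
Proof. by move=> e; rewrite -sg_opA e. Qed.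

Let abs_l x y : x ** io 0 = x -> (x ** y) ** io 0 = x ** y.
Proof. by move=> e; rewrite -sg_opA -ioC sg_opA e. Qed.

Let FF t j : ProperFilter (F t j).
Proof.
have Pj := phiF j; split; first exact: filter_not_empty.
split; first exact: filterT.
  by move=> A B; exact: filterI.
by move=> A B AB; apply: filterS => v; exact: AB.
Qed.

Let hK x : K (h x).
Proof.
rewrite /h; case: asboolP => xe; [right|left]; last by exists x.
by exists x, eps.
Qed.

Let KF p : K p -> ProperFilter p.
Proof.
case=> [[x _ ->]|[t [j [_ ->]]]]; last exact: FF.
by split => //; split => // P Q PQ; exact: PQ.
Qed.

Let Kdec p P : K p -> p P -> exists P', [/\ p P', P' `<=` P & decided K P'].
Proof.
move=> [[x xe ->] /= Px|[t [i [te ->]]] /(phi_dec te) [P' [P'i P'P dP']]].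
  exists [set x]; split => // [_ -> //|q [[y ye ->]|[s [j [se ->]]]]]; first exact: EM.
  right; have Fj := phiF j; rewrite /F /=; apply: (@filterS _ (phi j) _ setT _ _ filterT).
  by move=> v _ /= sx; apply: xe; rewrite -sx -sg_opA io0.
exists [set t ** io w | w in P']; split.
- by have Fi := phiF i; rewrite /F /=; apply: filterS P'i => v; exists v.
- by move=> _ [w /P'P ? <-].
move=> q [[y ye ->]|[s [j [se ->]]]]; first exact: EM.
have Fj := phiF j; rewrite /F /=; case: (dP' s j se) => H; [left|right].
  by apply: filterS H => v [w P'w e]; exists w.
by apply: filterS H => v nv [w P'w e]; apply: nv; exists w.
Qed.

(** The product of two points outside X e may fall into X e, where it is represented by a filter
    coarser than the principal one. *)
Let mul_pp x y : filter_mul [set P | P x] [set P | P y] (h (x ** y)).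
Proof.
move=> R hR; exists [set x], [set y]; split => // _ _ -> ->; move: hR; rewrite /h.
by case: asboolP => [xye /eps0 /=|_ //]; rewrite xye.
Qed.

Let mul_pF x t j : filter_mul [set P | P x] (F t j) (F (x ** t) j).
Proof.
move=> R FR; exists [set x], [set t ** io v | v in [set v | R (x ** t ** io v)]]; split => //.
  by have Fj := phiF j; move: FR; rewrite /F /=; apply: filterS => v; exists v.
by move=> _ _ -> [v Rv <-]; rewrite sg_opA.
Qed.

Let mul_Fp x t j : filter_mul (F t j) [set P | P x] (F (t ** x) j).
Proof.
move=> R FR; exists [set t ** io v | v in [set v | R (t ** x ** io v)]], [set x]; split => //.
  by have Fj := phiF j; move: FR; rewrite /F /=; apply: filterS => v; exists v.
by move=> _ _ [v Rv <-] ->; rewrite -sg_opA ioC sg_opA.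
Qed.

Let mul_FF t s i j k : mulJ i j k -> filter_mul (F t i) (F s j) (F (t ** s) k).
Proof.
move=> m R /m [P [Q [Pi Qj PQ]]].
exists [set t ** io v | v in P], [set s ** io v | v in Q]; split.
- by have Fi := phiF i; rewrite /F /=; apply: filterS Pi => v; exists v.
- by have Fj := phiF j; rewrite /F /=; apply: filterS Qj => v; exists v.
move=> _ _ [u Pu <-] [v Qv <-].
have := PQ _ _ Pu Qv => /=; rewrite ioD; congr (R _).
by rewrite !sg_opA -(sg_opA t s) -(ioC u s) !sg_opA.
Qed.

Let Kmul p q : K p -> K q -> exists2 r, K r & filter_mul p q r.
Proof.
move=> [[x _ ->]|[t [i [te ->]]]] [[y _ ->]|[s [j [se ->]]]].
- by exists (h (x ** y)); [exact: hK|exact: mul_pp].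
- exists (F (x ** s) j); last exact: mul_pF.
  by right; exists (x ** s), j; split => //; exact: abs_r.
- exists (F (t ** y) i); last exact: mul_Fp.
  by right; exists (t ** y), i; split => //; exact: abs_l.
have [k m] := phiM i j; exists (F (t ** s) k); last exact: mul_FF.
by right; exists (t ** s), k; split => //; exact: abs_r.
Qed.

Let hM x y : filter_mul (h x) (h y) (h (x ** y)).
Proof.
have [xe|xe] := pselect (x ** io 0 = x); have [ye|ye] := pselect (y ** io 0 = y).
- rewrite /h !asboolT ?abs_r //; exact: mul_FF.
- rewrite /h (asboolT xe) (asboolF ye) asboolT ?abs_l //; exact: mul_Fp.
- rewrite /h (asboolT ye) (asboolF xe) asboolT ?abs_r //; exact: mul_pF.
by rewrite {1 2}/h (asboolF ye) (asboolF xe); exact: mul_pp.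
Qed.

Let h_inj : injective h.
Proof.
move=> x y; rewrite /h; case: asboolP => xe; case: asboolP => ye e.
- apply: contrapT => xy; have [P Pe HP] := phi_sep xe ye xy.
  have : F x eps [set x ** io v | v in P].
    by have Fe := phiF eps; rewrite /F /=; apply: filterS Pe => v; exists v.
  by rewrite e => /eps0 /= [v Pv]; rewrite ye => /esym; exact: HP.
- have : [set P : set X | P y] [set z | z ** io 0 = z].
    rewrite -e; have Fe := phiF eps; rewrite /F /=.
    by apply: (@filterS _ (phi eps) _ setT _ _ filterT) => v _ /=; rewrite -sg_opA io0.
  by move/ye.
- have : [set P : set X | P x] [set z | z ** io 0 = z].
    rewrite e; have Fe := phiF eps; rewrite /F /=.
    by apply: (@filterS _ (phi eps) _ setT _ _ filterT) => v _ /=; rewrite -sg_opA io0.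
  by move/xe.
have : [set P : set X | P y] [set x] by rewrite -e.
by move=> /= ->.
Qed.

Let space : exists (Y : topologicalType) (mul : Y -> Y -> Y) (pt : Y -> set (set X)) (g : X -> Y),
  [/\ in_class Tzc mul, is_hom mul g, injective g, forall x, pt (g x) = h x &
  [/\ forall y, K (pt y), injective pt, forall p, K p -> exists y, pt y = p &
   (forall U : set Y, open U <-> forall y, U y ->
     exists P, [/\ pt y P, decided K P & forall z, pt z P -> U z])]].
Proof.
have [Y [mul [pt [inY Kpt pt_inj pt_surj [mulP openP]]]]] := filter_semigroup KF Kdec Kmul.
pose g x := projT1 (cid (pt_surj _ (hK x))).
have gP x : pt (g x) = h x by rewrite /g; case: cid.
exists Y, mul, pt, g; split => //.
  move=> a b; apply: pt_inj.
  apply: (@filter_mul_unique X K KF Kdec (pt (g a)) (pt (g b))) => //.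
  by rewrite !gP; exact: hM.
by move=> a b gab; apply: h_inj; rewrite -!gP gab.
Qed.

(** This is the isolation of the image of [io 0]: in the topology with neighborhood filter [phi eps]
    at 0, the set [P] is a neighborhood of 0 and of no other point. *)
Lemma group_filters_discrete : C_discrete Tzc X ->
  exists2 P, phi eps P & forall v, phi eps [set w | P (v + w)] -> v = 0.
Proof.
move=> dX; have [Y [mul [pt [g [inY homg g_inj gP [Kpt pt_inj pt_surj openP]]]]]] := space.
have [|U [/openP oU Ug]] := dX Y mul g inY homg g_inj (g (io 0)); first by exists (io 0).
have Ug0 : U (g (io 0)) by have : [set g (io 0)] (g (io 0)) by []; rewrite -Ug => -[].
have [P [P0 dP PU]] := oU _ Ug0.
have hio v : h (io v) = F (io v) eps by rewrite /h asboolT.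
exists [set v | P (io v)].
  have Fe := phiF eps; move: P0; rewrite gP hio /F /=; apply: filterS => v /=.
  by rewrite -ioD add0r.
move=> v Pv; apply: io_inj; apply: g_inj.
suff : (U `&` range g) (g (io v)) by rewrite Ug.
split; last by exists (io v).
apply: PU; rewrite gP hio /F /=; have Fe := phiF eps; apply: filterS Pv => w /=.
by rewrite ioD.
Qed.

(** The filter of [phi j] transported by [io] is a limit of points [io v], so it equals [h x] for
    some [x]. As it contains the range of [io], this [x] is [io a]. *)
Lemma group_filters_closed : inj_C_closed Tzc X ->
  forall j, exists a, forall P, phi j P -> P a.
Proof.
move=> cX; have [Y [mul [pt [g [inY homg g_inj gP [Kpt pt_inj pt_surj openP]]]]]] := space.
have cg := cX Y mul g inY homg g_inj.
move=> j; have [y yj] : exists y, pt y = F (io 0) j.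
  by apply: pt_surj; right; exists (io 0), j.
have [x _ xy] : range g y.
  apply: cg; apply/closure_openP => U /openP oU /oU [P [yP dP PU]].
  have Fj := phiF j; have [v Pv] : exists v, P (io v).
    move: yP; rewrite yj /F /= => /filter_ex [v Pv].
    by exists v; rewrite -[v]add0r ioD; exact: Pv.
  exists (g (io v)); split; first by exists (io v).
  apply: PU; have [//|] := dP _ (Kpt (g (io v))).
  rewrite gP /h asboolT // => /eps0 /=; by rewrite io0 => /(_ Pv).
have hx : h x = F (io 0) j by rewrite -gP xy.
have Fio P : phi j P -> F (io 0) j [set io v | v in P].
  move=> Pj; have Fj := phiF j; rewrite /F /=; apply: filterS Pj => v Pv.
  by exists v => //; rewrite -ioD add0r.
have Fj := phiF j.
have hx_in P : h x P -> P x.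
  by rewrite /h; case: asboolP => [xe /eps0 /=|//]; rewrite xe.
have [a _ ax] : range io x.
  by apply: hx_in; rewrite hx; apply: (Fio setT); exact: filterT.
exists a => P /Fio; rewrite -hx => /hx_in [b Pb]; rewrite -ax => /io_inj <- //.
Qed.

End GroupFilters.

Section DiscreteCentral.
Import Order.TTheory GRing.Theory Num.Theory.
Local Open Scope ring_scope.
Variables (X : semigroup) (V : zmodType) (io : V -> X) (Z : nat -> set V).
Local Notation "x ** y" := (sg_op x y) (at level 40, left associativity).
Hypothesis dX : C_discrete Tzc X.
Hypothesis ioD : forall u v, io (u + v) = io u ** io v.
Hypothesis io_inj : injective io.
Hypothesis ioZ : forall v, sg_center X (io v).
Hypothesis Z_finite : forall n, finite_set (Z n).
Hypothesis stab : forall t : X,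
  (exists2 q, (0 < q)%N & forall v, t ** io (v *+ q) = t ** io 0) \/
  (exists r0, forall r v, (r0 <= r)%N -> t ** io v = t ** io 0 -> Z r v).

Let coeffs (m : nat) (_ : unit) : set (nat -> int) :=
  [set d | (forall i, (i < m)%N -> d i = 0) /\ forall i, (`|d i| * 2 ^ m <= i)%N].

Let coeffs_bnd k : exists i0, forall m d i, coeffs m k d -> (`|d i| <= maxn i i0)%N.
Proof.
exists 0%N => m d i [_ db]; rewrite maxn0; apply: leq_trans (db i).
by rewrite leq_pmulr // expn_gt0.
Qed.

Let coeffs_paste m m' k l d u u' : (m <= m')%N ->
  coeffs m k d -> coeffs m' l u -> coeffs m' l u' -> (forall i, (m' <= i)%N -> d i = u i) ->
  coeffs m k (fun i => d i - u i + u' i).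
Proof.
move=> mm' [dm db] [um ub] [u'm u'b] du; split=> i.
  by move=> im; have im' := leq_trans im mm'; rewrite dm // um // u'm // subrr addr0.
have [im'|m'i] := ltnP i m'; first by rewrite um // u'm // subr0 addr0.
rewrite du // subrr add0r; apply: leq_trans (u'b i).
by rewrite leq_mul2l leq_exp2l // mm' orbT.
Qed.

(* The sets U m, of the combinations with coefficients `|d i| <= i / 2^m that vanish for i < m,
   form a base at 0 of a group topology, which is nondiscrete as x_i belongs to U m for large i. *)
Lemma discrete_central_group_bounded : exists2 n, (0 < n)%N & forall v : V, v *+ n = 0.
Proof.
apply: contrapT => unb.
have V_unb n : (0 < n)%N -> exists v : V, v *+ n != 0.
  move=> n0; apply: contrapT => H; apply: unb; exists n => // v.
  by apply: contrapT => /eqP vn; apply: H; exists v.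
have [x [x_fact x_fast]] := fast_sequence V_unb Z_finite.
pose U m := tails x coeffs m tt.
have U0 m : U m 0.
  exists (fun=> 0), 0%N; split => //; by rewrite /comb big_ord0.
have Uanti m m' v : (m <= m')%N -> U m' v -> U m v.
  move=> mm' [d [r [[dm db] dr ->]]]; exists d, r; split => //; split => i.
    by move=> im; apply: dm; exact: leq_trans mm'.
  by apply: leq_trans (db i); rewrite leq_mul2l leq_exp2l // mm' orbT.
(* Passing from m to m+1 halves the allowed ratio of [|d i|] to i, which leaves room for a sum. *)
have UD m u v : U m.+1 u -> U m.+1 v -> U m (u + v).
  move=> [d [r [[dm db] dr ->]]] [e [s [[em eb] es ->]]].
  exists (fun i => d i + e i), (r + s)%N; split; first split.
  - by move=> i im; rewrite dm ?em // ltnW.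
  - move=> i; have := db i; have := eb i; rewrite expnS.
    move: (2 ^ m)%N => p; have : (absz (d i + e i)%R <= absz (d i) + absz (e i))%N by lia.
    by nia.
  - by move=> i ri; rewrite dr ?es //; lia.
  by rewrite combD (comb_widen _ _ dr) ?(comb_widen _ _ es) ?leq_addr ?leq_addl.
have Ux m n : (m <= n)%N -> (2 ^ m <= n)%N -> U m (x n).
  move=> mn m2n; exists (fun i => if i == n then 1 else 0), n.+1; split; first split.
  - by move=> i im; rewrite ltn_eqF //; exact: leq_trans mn.
  - by move=> i; case: eqP => [->|_]; rewrite ?mul1n ?mul0n.
  - by move=> i ni; rewrite gtn_eqF.
  - by rewrite comb_single // mulr1z.
pose phi (_ : unit) := [set P : set V | exists m, U m `<=` P].
have phiF k : ProperFilter (phi k).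
  split; first by move=> [m /(_ _ (U0 m))].
  split; first by exists 0%N.
    move=> P Q [m Pm] [n Qn]; exists (maxn m n) => v Uv; split.
      by apply/Pm/(Uanti _ _ _ _ Uv); exact: leq_maxl.
    by apply/Qn/(Uanti _ _ _ _ Uv); exact: leq_maxr.
  by move=> P Q PQ [m Pm]; exists m => v /Pm /PQ.
have phiM R : phi tt R -> exists P Q, [/\ phi tt P, phi tt Q &
    forall x y, P x -> Q y -> R (x + y)].
  move=> [m Rm]; exists (U m.+1), (U m.+1); split => //; try by exists m.+1.
  by move=> u v Uu Uv; apply/Rm/UD.
have io_sub t u v : t ** io 0 = t -> (t ** io u = t ** io v <-> t ** io (u - v) = t ** io 0).
  move=> te; split=> [e|e].
    by rewrite ioD sg_opA e -sg_opA -ioD subrr.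
  by rewrite -[u](subrK v) ioD sg_opA e -sg_opA -ioD add0r.
pose N t := [set w | t ** io w = t ** io 0].
have NB t : t ** io 0 = t -> forall u v, N t u -> N t v -> N t (u - v).
  by move=> te u v Nu Nv; apply: (io_sub t u v te).1; exact: etrans Nu (esym Nv).
have NU t q : t ** io 0 = t -> (0 < q)%N -> (forall v, t ** io (v *+ q) = t ** io 0) ->
    U q `<=` N t.
  move=> te q0 Hq; have N0 : N t 0 by [].
  have ND u v : N t u -> N t v -> N t (u + v).
    by move=> Nu Nv; rewrite -[v]opprK -[- v]sub0r; apply: (NB) => //; exact: (NB).
  have Nn u (n : nat) : N t u -> N t (u *+ n).
    by move=> Nu; elim: n => [//|n IH]; rewrite mulrS; exact: ND.
  have Nz u (c : int) : N t u -> N t (u *~ c).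
    move=> Nu; case: (intP c) => [//|n|n]; first exact: Nn.
    by rewrite mulrNz -[- _]sub0r; apply: (NB) => //; exact: Nn.
  move=> _ [d [r [[dq _] _ ->]]].
  apply: (big_ind (N t)) => // i _; have [iq|qi] := ltnP i q.
    by rewrite dq // mulr0z.
  apply: Nz; have [v ->] := x_fact i.
  have /dvdnP[c ->] : (q %| i`!)%N by apply: dvdn_fact; rewrite q0.
  by rewrite mulrnA; exact: Hq.
have [P0 [m mP] H] : exists2 P, phi tt P & forall v, phi tt [set w | P (v + w)] -> v = 0.
  apply: (@group_filters_discrete X V io ioD io_inj ioZ unit phi tt phiF _ phiM _ _ _ dX).
  - by move=> [] []; exists tt; exact: phiM.
  - by move=> R [m Rm]; exact/Rm/U0.
  - move=> t [] P te [m Pm]; exists (U m); split => //; first by exists m.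
    move=> s [] se.
    have [Hd|H] := EM (exists m', forall u, U m' u -> ~ exists2 v, U m v & s ** io u = t ** io v).
      by right.
    left; have {}H m' : exists u v, [/\ U m' u, U m v & s ** io u = t ** io v].
      apply: contrapT => nH; apply: H; exists m' => u Uu [v Uv e].
      by apply: nH; exists u, v.
    have [u0 [v0 [_ _ e0]]] := H 0%N.
    pose g := v0 - u0.
    have gE : s ** io 0 = t ** io g.
      have -> : io 0 = io u0 ** io (- u0) by rewrite -ioD subrr.
      by rewrite sg_opA e0 -sg_opA -ioD.
    have sE u : s ** io u = t ** io (g + u).
      have -> : io u = io 0 ** io u by rewrite -ioD add0r.
      by rewrite sg_opA gE -sg_opA -ioD.
    have {}H m' : exists u v, [/\ U m' u, U m v & N t (g + u - v)].
      have [u [v [Uu Uv e]]] := H m'.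
      by exists u, v; split => //; apply: (io_sub t (g + u) v te).1; rewrite -sE.
    suff [m' Hm'] : exists m', forall u, U m' u -> exists2 v, U m v & N t (g + u - v).
      exists m' => u /Hm' [v Uv Nv]; exists v => //.
      by rewrite sE; exact: (io_sub t (g + u) v te).2 Nv.
    have [[q q0 Hq]|[r0 Hr0]] := stab t; last first.
      apply: (tails_decided (Z := Z) (r0 := r0) x_fast coeffs_bnd coeffs_paste (NB t te)) => //.
      by move=> r rr0 w Nw; exact: (Hr0 r w rr0 Nw).
    have [u1 [v1 [Uu1 Uv1 N1]]] := H q.
    exists q => u Uu; exists v1 => //.
    have -> : g + u - v1 = (g + u1 - v1) - (u1 - u).
      by rewrite opprB [RHS]addrACA [in RHS](addrAC g) [RHS]addrACA subrr addr0.
    by apply: (NB) => //; apply: (NB) => //; exact: (NU t q).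
  - move=> t s te se ts.
    apply: contrapT => nH; have {}nH m : exists2 w, U m w & s = t ** io w.
      apply: contrapT => nH'; apply: nH; exists (U m); first by exists m.
      by move=> w Uw e; apply: nH'; exists w.
    apply: ts; have [[q q0 Hq]|[r0 Hr0]] := stab t.
      by have [w /(NU t q te q0 Hq) Nw ->] := nH q; rewrite -[LHS]te -Nw.
    (* Two representations of [s] are compared, by a fixed [b] and by a [d] that starts beyond the
       support of [b]; [comb_eq0] makes [d] vanish. *)
    have [g [b [r1 [_ br1 gb]]] sg] := nH 0%N.
    pose B := \max_(i < r1) absz (b i).
    have bB i : (`|b i| <= B)%N.
      have [ir|/br1 ->] := ltnP i r1; last by rewrite absz0.
      exact: (@leq_bigmax_cond _ xpredT (fun i : 'I_r1 => absz (b i)) (Ordinal ir)).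
    pose m := (r0 + r1 + B)%N.
    have [w [d [r [[dm db] dr wd]]] sw] := nH m.
    have d0 : forall i, (m <= i)%N -> b i - d i = 0.
      apply: (@comb_eq0 V Z x x_fast (N t) (fun i => b i - d i) r0 m (r1 + r)%N).
      - by move=> r2 rr0 v Nv; exact: (Hr0 r2 v rr0 Nv).
      - by rewrite /m; lia.
      - by move=> i ri; rewrite br1 ?dr ?subrr //; lia.
      - move=> i r2 mr ir; have := bB i.
        have : (`|d i| <= i)%N by apply: leq_trans (db i); rewrite leq_pmulr // expn_gt0.
        by rewrite /m in mr; lia.
      rewrite combD combN (comb_widen _ _ br1) ?leq_addr //.
      rewrite (comb_widen _ _ dr) ?leq_addl // -gb -wd.
      by apply: (io_sub t g w te).1; rewrite -sg -sw.
    have w0 : w = 0.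
      rewrite wd /comb big1 // => i _; have [im|mi] := ltnP i m.
        by rewrite dm // mulr0z.
      have := d0 _ mi; rewrite br1 ?sub0r; last by rewrite /m in mi; lia.
      by move=> /eqP; rewrite oppr_eq0 => /eqP ->; rewrite mulr0z.
    by rewrite sw w0 te.
(* For large n, the translate of U (m+1) by [x n] lies in U m and hence in [P0], so isolation forces
   [x n] to be 0. *)
have xn0 n : (m.+1 <= n)%N -> (2 ^ m.+1 <= n)%N -> x n = 0.
  move=> mn m2n; apply: H; exists m.+1 => w Uw; apply: mP.
  by apply: UD => //; exact: Ux.
have [[q q0 Hq]|[r0 Hr0]] := stab (io 0).
  apply: unb; exists q => // v; apply: io_inj.
  by have := Hq v; rewrite -!ioD !add0r.
pose i := (m.+1 + 2 ^ m.+1 + r0)%N.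
apply: (@fast_neq _ x Z i x_fast).
  by apply: (Hr0 i.+1 0) => //; rewrite /i; lia.
by rewrite !xn0 // /i; lia.
Qed.

End DiscreteCentral.

(** * Profinite completion of an abelian group *)

Section ResiduallyFinite.
Import GRing.Theory.
Local Open Scope ring_scope.
Variable V : zmodType.
Implicit Types (H N : set V) (z : set (set V)).

Definition additive_subgroup H := H 0 /\ forall u v, H u -> H v -> H (u - v).

Definition finite_index H := exists s : seq V, forall v, exists2 a, a \in s & H (v - a).

Definition coset a H : set V := [set v | H (v - a)].

Lemma subgroupD H u v : additive_subgroup H -> H u -> H v -> H (u + v).
Proof.
by move=> [H0 HB] Hu Hv; rewrite -[v]opprK -[- v]sub0r; apply: (HB) => //; exact: (HB).
Qed.

Lemma additive_subgroupI H N : additive_subgroup H -> additive_subgroup N ->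
  additive_subgroup (H `&` N).
Proof.
by move=> [H0 HB] [N0 NB]; split => // u v [? ?] [? ?]; split; [exact: HB|exact: NB].
Qed.

Lemma coset_refl a H : additive_subgroup H -> coset a H a.
Proof. by move=> [H0 _]; rewrite /coset /= subrr. Qed.

Lemma coset_eq a b H : additive_subgroup H -> coset a H b -> coset a H = coset b H.
Proof.
move=> sH ab; apply/seteqP; split=> v hv; rewrite /coset /=.
  have -> : v - b = (v - a) - (b - a) by rewrite opprB addrA subrK.
  by case: sH => _; apply.
have -> : v - a = (v - b) + (b - a) by rewrite addrA subrK.
exact: subgroupD.
Qed.

Lemma finite_indexI H N : additive_subgroup H -> additive_subgroup N ->
  finite_index H -> finite_index N -> finite_index (H `&` N).
Proof.
move=> sH sN [s Hs] [t Ht].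
(* One representative for each pair of cosets that meet; 0 is the default for the other pairs. *)
pose f (ab : V * V) := xget 0 (coset ab.1 H `&` coset ab.2 N).
exists [seq f (a, b) | a <- s, b <- t] => v.
have [a sa va] := Hs v; have [b tb vb] := Ht v.
exists (f (a, b)); first by apply/allpairsP; exists (a, b).
have [Ha Hb] : (coset a H `&` coset b N) (f (a, b)) by apply: xgetPex; exists v.
move: (f (a, b)) Ha Hb => c Ha Hb; split.
  rewrite (_ : v - c = (v - a) - (c - a)); last by rewrite opprB addrA subrK.
  by case: sH => _; apply.
rewrite (_ : v - c = (v - b) - (c - b)); last by rewrite opprB addrA subrK.
by case: sN => _; apply.
Qed.

Lemma ultra_finite_index (U : set (set V)) H : UltraFilter U -> finite_index H ->
  exists a, U (coset a H).
Proof.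
move=> UU [s Hs]; apply: contrapT => nU.
have nUa a : U (~` coset a H).
  by case: (in_ultra_setVsetC (coset a H) UU) => // ?; exfalso; apply: nU; exists a.
have : U [set v | forall a, a \in s -> ~ coset a H v].
  elim: (s) => [|b r IH]; first by apply: filterS filterT => v.
  apply: filterS (filterI (nUa b) IH) => v [nb nr] a.
  by rewrite inE => /predU1P[-> //|]; exact: nr.
by move=> /filter_ex [v Hv]; have [a sa Ha] := Hs v; exact: (Hv a sa).
Qed.

(* The points of the profinite completion of V. *)
Definition coset_filter z :=
  [/\ ProperFilter z,
      forall H, additive_subgroup H -> finite_index H -> exists a, z (coset a H) &
      forall P, z P -> exists H a,
        [/\ additive_subgroup H, finite_index H, z (coset a H) & coset a H `<=` P]].

Definition coset_sum z z' : set (set V) := [set R | exists H a b,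
  [/\ additive_subgroup H, finite_index H, z (coset a H), z' (coset b H) &
      coset (a + b) H `<=` R]].

Lemma coset_filter_sub z a b H N : coset_filter z -> additive_subgroup H ->
  additive_subgroup N -> N `<=` H -> z (coset a H) -> z (coset b N) ->
  coset b N `<=` coset a H.
Proof.
move=> [Fz _ _] sH sN NH za zb.
have [c [ac bc]] := proper_meets Fz za zb.
rewrite (coset_eq sH ac) (coset_eq sN bc) => v; exact: NH.
Qed.

Lemma coset_sum_filter z z' : coset_filter z -> coset_filter z' ->
  coset_filter (coset_sum z z').
Proof.
move=> cz cz'; have [Fz zH zP] := cz; have [Fz' z'H z'P] := cz'; split.
- split.
    by move=> [H [a [b [sH _ _ _ /(_ (a + b))]]]]; apply; exact: coset_refl.
  split.
  + exists setT, 0, 0; split => //; do ?[by exists [:: 0] => v; exists 0; rewrite ?inE];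
    by apply: (@filterS _ _ _ setT) => //; exact: filterT.
  + move=> P Q [H [a [b [sH fH za z'b abP]]]] [N [c [d [sN fN zc z'd cdQ]]]].
    have sHN := additive_subgroupI sH sN; have fHN := finite_indexI sH sN fH fN.
    have [k zk] := zH _ sHN fHN; have [l z'l] := z'H _ sHN fHN.
    have kl R r s : additive_subgroup R -> H `&` N `<=` R -> z (coset r R) -> z' (coset s R) ->
        coset (k + l) (H `&` N) `<=` coset (r + s) R.
      move=> sR HNR zr z's v Hv.
      have k1 := coset_filter_sub cz sR sHN HNR zr zk (coset_refl k sHN).
      have l1 := coset_filter_sub cz' sR sHN HNR z's z'l (coset_refl l sHN).
      rewrite /coset /= (_ : v - (r + s) = (v - (k + l)) + ((k - r) + (l - s))).
        by apply: subgroupD => //; [exact: HNR|exact: subgroupD].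
      by rewrite (addrACA k) -opprD addrA subrK.
    exists (H `&` N), k, l; split => // v Hv; split.
      by apply/abP/(kl H a b) => // ? [].
    by apply/cdQ/(kl N c d) => // ? [].
  + by move=> P Q PQ [H [a [b [sH fH za z'b abP]]]]; exists H, a, b; split => // v /abP /PQ.
- move=> H sH fH; have [a za] := zH _ sH fH; have [b z'b] := z'H _ sH fH.
  by exists (a + b); exists H, a, b; split.
move=> P [H [a [b [sH fH za z'b abP]]]]; exists H, (a + b); split => //.
by exists H, a, b; split.
Qed.

(** This filter is the limit of [U] in the profinite completion: an ultrafilter selects one coset of
    each subgroup of finite index. *)
Lemma ultra_coset_filter (U : set (set V)) : UltraFilter U ->
  coset_filter [set P | exists H a,
    [/\ additive_subgroup H, finite_index H, U (coset a H) & coset a H `<=` P]].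
Proof.
move=> UU; split.
- split.
    by move=> [H [a [sH _ _ /(_ a)]]]; apply; exact: coset_refl.
  split.
  + exists setT, 0; split => //; first by exists [:: 0] => v; exists 0; rewrite ?inE.
    by apply: (@filterS _ _ _ setT) => //; exact: filterT.
  + move=> P Q [H [a [sH fH Ua aP]]] [N [b [sN fN Ub bQ]]].
    have [c [ac bc]] := proper_meets _ Ua Ub.
    exists (H `&` N), c; split.
    * exact: additive_subgroupI.
    * exact: finite_indexI.
    * rewrite (_ : coset c (H `&` N) = coset a H `&` coset b N); first exact: filterI.
      by rewrite (coset_eq sH ac) (coset_eq sN bc).
    move=> v [Hv Nv]; split; first by apply: aP; rewrite (coset_eq sH ac).
    by apply: bQ; rewrite (coset_eq sN bc).
  + by move=> P Q PQ [H [a [sH fH Ua aP]]]; exists H, a; split => // v /aP /PQ.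
- move=> H sH fH; have [a Ua] := ultra_finite_index UU fH.
  by exists a; exists H, a; split.
by move=> P [H [a [sH fH Ua aP]]]; exists H, a; split => //; exists H, a; split.
Qed.

Definition coset_filter0 : set (set V) :=
  [set P | exists H, [/\ additive_subgroup H, finite_index H & H `<=` P]].

Lemma coset0 H : coset 0 H = H.
Proof. by apply/seteqP; split => v; rewrite /coset /= subr0. Qed.

Lemma coset_filter0P : coset_filter coset_filter0.
Proof.
split.
- split; first by move=> [H [[H0 _] _ /(_ _ H0)]].
  split.
  + by exists setT; split => //; exists [:: 0] => v; exists 0; rewrite ?inE.
  + move=> P Q [H [sH fH HP]] [N [sN fN NQ]]; exists (H `&` N); split.
    * exact: additive_subgroupI.
    * exact: finite_indexI.
    by move=> v [/HP ? /NQ ?].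
  + by move=> P Q PQ [H [sH fH HP]]; exists H; split => // v /HP /PQ.
- by move=> H sH fH; exists 0; rewrite coset0; exists H; split.
move=> P [H [sH fH HP]]; exists H, 0; rewrite coset0; split => //.
by exists H; split.
Qed.

Hypothesis V_infinite : infinite_set [set: V].
Hypothesis V_subgroups : forall N g, additive_subgroup N -> ~ N g ->
  exists H, [/\ additive_subgroup H, finite_index H, N `<=` H & ~ H g].

Lemma finite_index_neq0 H : additive_subgroup H -> finite_index H -> exists2 h, H h & h <> 0.
Proof.
move=> sH [s Hs]; apply: contrapT => nH; apply: V_infinite.
apply: (sub_finite_set _ (finite_seq s)) => v _ /=.
have [a sa Ha] := Hs v; suff /eqP : v - a = 0 by rewrite subr_eq0 => /eqP ->.
by apply: contrapT => va; apply: nH; exists (v - a).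
Qed.

(** Diagonal argument: cosets of subgroups of finite index decrease, and the n-th step leaves out
    [a n]. A limit of an ultrafilter containing all of them differs from every element of [V]. *)
Lemma coset_filter_nonprincipal (a : nat -> V) : (forall v, exists n, a n = v) ->
  exists2 z, coset_filter z & forall v, exists2 P, z P & ~ P v.
Proof.
move=> a_surj.
pose S := {p : V * set V | additive_subgroup p.2 /\ finite_index p.2}.
pose cs (p : S) := coset (proj1_sig p).1 (proj1_sig p).2.
have step (np : nat * S) : exists q : S, cs q `<=` cs np.2 /\ ~ cs q (a np.1).
  case: np => n [[c H] /= [sH fH]].
  have [h Hh h0] := finite_index_neq0 sH fH.
  have [c' cc' c'a] : exists2 c', coset c H c' & c' <> a n.
    have [ca|ca] := pselect (c = a n); last by exists c => //; exact: coset_refl.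
    exists (c + h); first by rewrite /coset /= addrAC subrr add0r.
    by rewrite -ca -[X in _ <> X]addr0 => /addrI.
  have [||H' [sH' fH' _ nH']] := V_subgroups (N := [set 0]) (g := a n - c').
  - by split => // u v -> ->; rewrite subrr.
  - by move=> /= /eqP; rewrite subr_eq0 => /eqP e; apply: c'a.
  have sI := additive_subgroupI sH sH'; have fI := finite_indexI sH sH' fH fH'.
  exists (exist _ (c', H `&` H') (conj sI fI)); split => [v [Hv _]|[_ //]].
  by rewrite /cs /= (coset_eq sH cc').
have [f fP] := choice step.
have s0 : additive_subgroup (0 : V, [set: V]).2 /\ finite_index (0 : V, [set: V]).2.
  by split => //; exists [:: 0] => v; exists 0; rewrite ?inE.
pose p := fix p n : S := if n is n'.+1 then f (n', p n') else exist _ (0, setT) s0.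
have pS n : cs (p n.+1) `<=` cs (p n) by have [] := fP (n, p n).
have pa n : ~ cs (p n.+1) (a n) by have [] := fP (n, p n).
have p_anti n m : (n <= m)%N -> cs (p m) `<=` cs (p n).
  move=> /subnKC <-; elim: (m - n)%N => [|k IH]; first by rewrite addn0.
  by rewrite addnS => v /pS /IH.
pose F := [set P : set V | exists n, cs (p n) `<=` P].
have pne n : exists v, cs (p n) v.
  by exists (proj1_sig (p n)).1; apply: coset_refl; case: (proj2_sig (p n)).
have FF : ProperFilter F.
  split; first by move=> [n Pn]; have [v /Pn] := pne n.
  split; first by exists 0%N.
    move=> P Q [n Pn] [m Qm]; exists (maxn n m) => v pv; split.
      by apply/Pn/(p_anti _ _ _ _ pv); exact: leq_maxl.
    by apply/Qm/(p_anti _ _ _ _ pv); exact: leq_maxr.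
  by move=> P Q PQ [n Pn]; exists n => v /Pn /PQ.
have [U [UU FU]] := ultraFilterLemma FF.
exists [set P | exists H a,
    [/\ additive_subgroup H, finite_index H, U (coset a H) & coset a H `<=` P]].
  exact: ultra_coset_filter.
move=> v; have [n <-] := a_surj v; exists (cs (p n.+1)); last exact: pa.
have [sp fp] := proj2_sig (p n.+1).
exists (proj1_sig (p n.+1)).2, (proj1_sig (p n.+1)).1; split => //.
by apply: FU; exists n.+1.
Qed.

Variables (X : semigroup) (io : V -> X).
Local Notation "x ** y" := (sg_op x y) (at level 40, left associativity).
Hypothesis ioD : forall u v, io (u + v) = io u ** io v.
Hypothesis io_inj : injective io.
Hypothesis ioZ : forall v, sg_center X (io v).

Let J := {z | coset_filter z}.
Let phi (j : J) := proj1_sig j.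
Let eps : J := exist _ _ coset_filter0P.

Let phiF j : ProperFilter (phi j).
Proof. by case: j => z []. Qed.

Let phiM i j : exists k, forall R, phi k R ->
  exists P Q, [/\ phi i P, phi j Q & forall x y, P x -> Q y -> R (x + y)].
Proof.
exists (exist _ _ (coset_sum_filter (proj2_sig i) (proj2_sig j))).
move=> R [H [a [b [sH fH za zb abR]]]]; exists (coset a H), (coset b H); split => //.
move=> u v au bv; apply: abR; rewrite /coset /= opprD addrACA; exact: subgroupD.
Qed.

Let epsM R : phi eps R ->
  exists P Q, [/\ phi eps P, phi eps Q & forall x y, P x -> Q y -> R (x + y)].
Proof.
move=> [H [sH fH HR]]; exists H, H; split; do ?[by exists H; split]; move=> //.
by move=> u v Hu Hv; apply: HR; exact: subgroupD.
Qed.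

Let eps0 R : phi eps R -> R 0.
Proof. by move=> [H [[H0 _] _ HR]]; exact: HR. Qed.

(** With cosets of the same [H] on both sides, translating one solution by elements of [H] gives
    solutions on the whole coset. *)
Let phi_dec (t : X) i P : t ** io 0 = t -> phi i P ->
  exists P', [/\ phi i P', P' `<=` P & forall (s : X) j, s ** io 0 = s ->
    phi j [set v | exists2 w, P' w & s ** io v = t ** io w] \/
    phi j [set v | ~ exists2 w, P' w & s ** io v = t ** io w]].
Proof.
move=> te; case: i => z [Fz zH zP] /= /zP [H [a [sH fH za aP]]].
exists (coset a H); split => // s [z' [Fz' z'H _]] se /=.
have [b z'b] := z'H _ sH fH.
have [[u [w [bu aw e]]]|nH] := EM (exists u w, [/\ coset b H u, coset a H w & s ** io u = t ** io w]).
  left; apply: filterS z'b => u' bu'; exists (w + (u' - u)).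
    rewrite /coset /= addrAC; apply: subgroupD => //.
    rewrite (_ : u' - u = (u' - b) - (u - b)); first by case: sH => _; apply.
    by rewrite opprB addrA subrK.
  by rewrite ioD sg_opA -e -sg_opA -ioD addrC subrK.
right; apply: filterS z'b => u bu [w aw e]; apply: nH; exists u, w; by split.
Qed.

(** If s is t translated by g, the separating subgroup must contain the stabilizer of t and avoid g.
    Hence the condition that every subgroup, and not just 0, is an intersection of subgroups of
    finite index. *)
Let phi_sep t s : t ** io 0 = t -> s ** io 0 = s -> t <> s ->
  exists2 P, phi eps P & forall w, P w -> s <> t ** io w.
Proof.
move=> te se ts; have [[g sg]|ns] := EM (exists g, s = t ** io g); last first.
  exists setT; last by move=> w _ e; apply: ns; exists w.
  by have := phiF eps => ?; exact: filterT.
have sN : additive_subgroup [set w | t ** io w = t].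
  split => // u v /= tu tv.
  have tv' : t ** io (- v) = t by rewrite -{1}tv -sg_opA -ioD subrr.
  by rewrite ioD sg_opA tu.
have [|H [sH fH NH nHg]] := V_subgroups sN (g := g).
  by move=> /= tg; apply: ts; rewrite sg tg.
exists H; first by exists H; split.
move=> w Hw e; apply: nHg.
have -> : g = (g - w) + w by rewrite subrK.
apply: subgroupD => //; apply: NH => /=.
by rewrite ioD sg_opA -sg e -sg_opA -ioD subrr.
Qed.

Lemma residually_finite_not_discrete : ~ C_discrete Tzc X.
Proof.
move=> dX.
have [P [H [sH fH HP]] HP0] :=
  group_filters_discrete ioD io_inj ioZ phiF phiM epsM eps0 phi_dec phi_sep dX.
have [h Hh] := finite_index_neq0 sH fH; apply; apply: HP0.
exists H; split => // w Hw; apply: HP; exact: subgroupD.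
Qed.

Lemma residually_finite_not_closed (a : nat -> V) : (forall v, exists n, a n = v) ->
  ~ inj_C_closed Tzc X.
Proof.
move=> a_surj cX; have [z cz nz] := coset_filter_nonprincipal a_surj.
have [v vP] := group_filters_closed ioD io_inj ioZ phiF phiM epsM eps0 phi_dec phi_sep cX
  (exist _ z cz).
have [P zP] := nz v; apply; exact: vP.
Qed.

End ResiduallyFinite.

Section CentralGroup.
Variables (X : semigroup) (G : set X).
Local Notation "x ** y" := (sg_op x y) (at level 40, left associativity).
Hypothesis sG : is_subgroup G.
Hypothesis cG : forall x y, G x -> G y -> x ** y = y ** x.

(** Commutativity is required within [G] only, so that a subgroup of the additive group of a
    [zmodType], seen as a semigroup, can be treated in the same way. *)
Definition comm_group of is_subgroup G & (forall x y, G x -> G y -> x ** y = y ** x) : Type :=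
  {x | G x}.
Local Notation gT := (comm_group sG cG).

HB.instance Definition _ := gen_eqMixin gT.
HB.instance Definition _ := gen_choiceMixin gT.

Let unit_ex := sG.2.2.
Let u := projT1 (cid unit_ex).
Let uP := projT2 (cid unit_ex).

Let add (a b : gT) : gT :=
  exist _ (proj1_sig a ** proj1_sig b) (sG.2.1 _ _ (proj2_sig a) (proj2_sig b)).
Let zero : gT := exist _ u (let: And3 h _ _ := uP in h).

Let inv_ex (a : gT) : exists b : gT, add b a = zero.
Proof.
have [_ _ /(_ _ (proj2_sig a)) [y [Gy _ yx]]] := uP.
by exists (exist _ y Gy); apply: sig_ext.
Qed.

Let opp (a : gT) : gT := projT1 (cid (inv_ex a)).

Let addA : associative add.
Proof. by move=> a b c; apply: sig_ext; exact: sg_opA. Qed.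

Let addC : commutative add.
Proof. by move=> a b; apply: sig_ext; apply: cG; exact: proj2_sig. Qed.

Let add0 : left_id zero add.
Proof.
by move=> a; apply: sig_ext => /=; have [_ /(_ _ (proj2_sig a)) []] := uP.
Qed.

Let addN : left_inverse zero opp add.
Proof. by move=> a; rewrite /opp; case: cid. Qed.

HB.instance Definition _ := GRing.isZmodule.Build gT addA addC add0 addN.

Lemma comm_group_zmod : exists (V : zmodType) (io : V -> X),
  [/\ forall a b, io (a + b)%R = io a ** io b, injective io & range io = G].
Proof.
exists gT, (@proj1_sig _ _); split => //.
  by move=> a b; exact: sig_ext.
apply/seteqP; split=> [_ [a _ <-]|x Gx]; first exact: proj2_sig.
by exists (exist _ x Gx).
Qed.

End CentralGroup.

Lemma central_subgroup_zmod (X : semigroup) (G : set X) :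
  is_subgroup G -> G `<=` sg_center X ->
  exists (V : zmodType) (io : V -> X),
  [/\ forall a b, io (a + b)%R = sg_op (io a) (io b), injective io & range io = G].
Proof. by move=> sG GZ; apply: comm_group_zmod => // x y Gx Gy; rewrite (GZ x Gx). Qed.

Section ZmodImage.
Import GRing.Theory.
Local Open Scope ring_scope.
Variables (X : semigroup) (V : zmodType) (io : V -> X).
Local Notation "x ** y" := (sg_op x y) (at level 40, left associativity).
Hypothesis ioD : forall u v, io (u + v) = io u ** io v.

Lemma io_xpow v n : (0 < n)%N -> xpow (io v) n = io (v *+ n).
Proof.
elim: n => [//|[|n] IH] _ //.
by rewrite xpowS // IH // -ioD -mulrSr.
Qed.

Lemma io_idempotent : idempotent_el (io 0).
Proof. by rewrite /idempotent_el -ioD addr0. Qed.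

Lemma zmod_sg_bounded n : (0 < n)%N -> (forall v : V, v *+ n = 0) -> sg_bounded (range io).
Proof.
move=> n0 Vn; exists n; split => // _ [v _ <-].
by rewrite io_xpow // Vn; exact: io_idempotent.
Qed.

Lemma image_subgroup (W : set V) : additive_subgroup W -> is_subgroup [set io w | w in W].
Proof.
move=> sW; have [W0 WB] := sW; split; first by exists (io 0); exists 0.
split.
  by move=> _ _ [v Wv <-] [w Ww <-]; exists (v + w); [exact: subgroupD|rewrite ioD].
exists (io 0); split; first by exists 0.
  by move=> _ [v Wv <-]; rewrite -!ioD add0r addr0.
move=> _ [v Wv <-]; exists (io (- v)); rewrite -!ioD subrr addNr; split => //.
by exists (- v) => //; rewrite -sub0r; exact: WB.
Qed.

Lemma stabilizer_subgroup (t : X) : additive_subgroup [set v | t ** io v = t ** io 0].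
Proof.
split => // u v /= tu tv.
by rewrite ioD sg_opA tu -tv -sg_opA -ioD subrr tv.
Qed.

End ZmodImage.

(** * Groups whose elements have squarefree order *)

Section Squarefree.
Import GRing.Theory Num.Theory.
Local Open Scope ring_scope.
Variable V : zmodType.

Definition squarefree n := (0 < n)%N /\ forall p, prime p -> ~~ (p * p %| n)%N.

Lemma subgroupMz (M : set V) v (c : int) : additive_subgroup M -> M v -> M (v *~ c).
Proof.
move=> sM Mv; have [M0 MB] := sM.
have Mn n : M (v *+ n).
  by elim: n => [//|n IH]; rewrite mulrS; exact: subgroupD.
case: (intP c) => [//|n|n]; first exact: Mn.
by rewrite mulrNz -[- _]sub0r; apply: MB => //; exact: Mn.
Qed.

Lemma subgroup_coprime (M : set V) v (a b : int) : additive_subgroup M ->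
  M (v *~ a) -> M (v *~ b) -> coprimez a b -> M v.
Proof.
move=> sM Ma Mb /eqP ab; have [x [y xy]] := Bezoutz a b.
have e : x * a + y * b = 1 by rewrite xy ab.
rewrite -[v]mulr1z -e mulrzDr (mulrC x) (mulrC y) !mulrzA.
by apply: subgroupD => //; exact: subgroupMz.
Qed.

(* A subgroup that is maximal among those containing N and avoiding g has finite index. *)
Lemma squarefree_subgroups (N : set V) g :
  (forall v : V, exists2 n, squarefree n & v *+ n = 0) ->
  additive_subgroup N -> ~ N g ->
  exists H, [/\ additive_subgroup H, finite_index H, N `<=` H & ~ H g].
Proof.
move=> Vsq sN nNg; have [N0 NB] := sN.
(* Zorn's lemma is also applied to the empty chain, whose union is empty; adding [N] makes it
   admissible. *)
pose P (H : set V) := additive_subgroup (H `|` N) /\ ~ (H `|` N) g.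
have [|A [[sA nAg] Amax]] := @Zorn_bigcup V P.
  move=> F FP totF; split; last by case=> [[H FH Hg]|//]; apply: (FP H FH).2; left.
  split; first by right.
  have key H u v : F H -> (H `|` N) u -> (H `|` N) v -> ((\bigcup_(X in F) X) `|` N) (u - v).
    move=> FH Hu Hv; have [[_ HB] _] := FP H FH.
    by case: (HB _ _ Hu Hv) => [?|?]; [left; exists H|right].
  move=> u v [[H FH Hu]|Nu] [[K FK Kv]|Nv].
  - have [HK|KH] := totF _ _ FH FK.
      by apply: (key K) => //; left => //; exact: HK.
    by apply: (key H) => //; left => //; exact: KH.
  - by apply: (key H) => //; [left|right].
  - by apply: (key K) => //; [right|left].
  by right; exact: NB.
pose M := A `|` N; have [M0 MB] := sA.
have gen h : ~ M h -> exists m (k : int), M m /\ g = m + h *~ k.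
  move=> nMh; pose B := [set v | exists m (k : int), M m /\ v = m + h *~ k].
  have MB' : M `<=` B by move=> m Mm; exists m, 0; rewrite mulr0z addr0.
  have NB' : B `|` N = B by apply/setUidPl => v Nv; apply: MB'; right.
  have Bh : B h by exists 0, 1; rewrite mulr1z add0r.
  apply: contrapT => nBg; apply: (Amax B).
    split; first by move=> v Av; apply: MB'; left.
    by move=> BA; apply: nMh; left; exact: BA.
  rewrite /P NB'; split => //; split; first by apply: MB'; right.
  move=> _ _ [m [k [Mm ->]]] [m' [k' [Mm' ->]]]; exists (m - m'), (k - k'); split.
    exact: MB.
  by rewrite mulrzBr opprD addrACA.
have mulzrnAC (v : V) (c : int) n : v *~ c *+ n = (v *+ n) *~ c.
  by rewrite pmulrn mulrzAC -pmulrn.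
have MMz v (c : int) : M v -> M (v *~ c) by exact: subgroupMz.
(* Let d be the order of g modulo M and p a prime factor of d. Then (d/p) g is outside M, so g is in
   M plus a multiple of (d/p) g, and p g is in M. *)
have [p p_pr Mgp] : exists2 p, prime p & M (g *+ p).
  have exd : exists d, (0 < d)%N && `[< M (g *+ d) >].
    have [n [n0 _] gn] := Vsq g; exists n; rewrite n0 gn; exact/asboolP.
  case: (ex_minnP exd) => d /andP[d0 /asboolP Md] dmin.
  have d1 : (1 < d)%N.
    rewrite ltn_neqAle d0 andbT; apply/eqP => d1; apply: nAg.
    by rewrite -d1 in Md.
  have p_pr := pdiv_prime d1; exists (pdiv d) => //.
  have /dvdnP[q dq] := pdiv_dvd d.
  have q0 : (0 < q)%N by move: d0; rewrite dq muln_gt0 => /andP[].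
  have [|m [k [Mm gE]]] := gen (g *+ q).
    move=> Mq; have := dmin q; rewrite q0 asboolT // => /(_ isT).
    by rewrite leqNgt [X in (_ < X)%N]dq ltn_Pmulr // prime_gt1.
  rewrite gE mulrnDl; apply: subgroupD => //; first exact: (MMz m (pdiv d)%:Z).
  rewrite mulzrnAC; apply: MMz.
  by rewrite -mulrnA -dq.
(* The multiples of g by 0, ..., p - 1 represent all cosets of M. *)
exists M; split => //; last by move=> v Nv; right.
exists [seq g *+ j | j <- iota 0 p] => h.
suff [u Mu] : exists u : int, M (h - g *~ u).
  have p0 : (p%:Z != 0) by have := prime_gt0 p_pr; lia.
  exists (g *+ absz (u %% p)%Z).
    apply/mapP; exists (absz (u %% p)%Z) => //.
    rewrite mem_iota add0n /=; have := ltz_pmod u (_ : 0 < p%:Z).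
    by rewrite ltz_nat prime_gt0 // => /(_ isT); have := modz_ge0 u p0; lia.
  have e : g *~ u = g *+ absz (u %% p)%Z + (g *+ p) *~ (u %/ p)%Z.
    rewrite {1}(divz_eq u p) mulrzDr addrC; congr (_ + _).
      by rewrite [RHS]pmulrn gez0_abs // modz_ge0.
    by rewrite mulrC mulrzA.
  rewrite -[h](subrK (g *~ u)) e -addrA; apply: subgroupD => //.
    by rewrite -e.
  by rewrite addrAC subrr add0r; exact: MMz.
have [Mh|nMh] := pselect (M h); first by exists 0; rewrite mulr0z subr0.
have nMg (a b : nat) : coprime a b -> M (g *+ a) -> M (g *+ b) -> False.
  by move=> ab Ma Mb; apply: nAg; apply: (@subgroup_coprime M g a b sA Ma Mb); rewrite coprimezE.
(* Otherwise g is in M plus a multiple of p h. Let n h = 0 with n squarefree. Then n g is in M, and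
   even (n/p) g if p divides n; either factor is prime to p, and p g is in M. *)
have Mhp : M (h *+ p).
  apply: contrapT => /gen [m [k [Mm gE]]].
  have [n [n0 nsq] hn] := Vsq h.
  have gn j : (h *+ p *+ j) = 0 -> M (g *+ j).
    move=> hpj; rewrite gE mulrnDl; apply: subgroupD => //; first exact: (MMz m j%:Z).
    by rewrite mulzrnAC hpj mul0rz.
  have [pn|pn] := boolP (p %| n)%N; last first.
    apply: (nMg p n) => //; first by rewrite prime_coprime.
    by apply: gn; rewrite mulrnAC hn mul0rn.
  have /dvdnP[q nq] := pn; apply: (nMg p q) => //.
    rewrite prime_coprime //; apply: contra (nsq p p_pr) => pq.
    by rewrite nq dvdn_mul.
  by apply: gn; rewrite -mulrnA mulnC -nq.
have [m [k [Mm gE]]] := gen h nMh.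
(* If p divided k, then g would be in M by [Mhp]. So k has an inverse x modulo p, and h is x g
   modulo M. *)
have kp : coprimez k p.
  rewrite coprimez_sym coprimezE prime_coprime //.
  apply/negP => /dvdnP [q kq]; apply: nAg; rewrite gE; apply: subgroupD => //.
  have : M ((h *+ p) *~ (Num.sg k * q%:Z)) by exact: MMz.
  rewrite [h *+ p]pmulrn -mulrzA; congr (M (_ *~ _)).
  by rewrite mulrCA -PoszM mulnC -kq -intEsg.
have [x [y xy]] := Bezoutz k p; exists x.
have -> : h - g *~ x = (h *+ p) *~ y - m *~ x.
  apply: (addIr (g *~ x)); rewrite subrK gE mulrzDl addrA addrNK.
  rewrite [h *+ p]pmulrn -!mulrzA -mulrzDr addrC (mulrC k) (mulrC p%:Z) xy.
  by move/eqP: kp => ->; rewrite mulr1z.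
by apply: MB; exact: MMz.
Qed.

End Squarefree.

(** * Torsion groups with few elements of squarefree order *)

Section Torsion.
Import GRing.Theory Num.Theory.
Local Open Scope ring_scope.
Variable V : zmodType.
Implicit Types v w : V.

Lemma prime_squarefree p : prime p -> squarefree p.
Proof.
move=> pp; split => [|q qp]; first exact: prime_gt0.
apply/negP => qqp; have qdp : (q %| p)%N by apply: dvdn_trans qqp; exact: dvdn_mulr.
move: qdp; rewrite dvdn_prime2 // => /eqP qE; move: qqp; rewrite qE => /dvdn_leq.
by rewrite prime_gt0 // => /(_ isT); have := prime_gt1 pp; nia.
Qed.

Lemma squarefree_lcm m n : squarefree m -> squarefree n -> squarefree (lcmn m n).
Proof.
move=> [m0 sm] [n0 sn]; split => [|p pp]; first by rewrite lcmn_gt0 m0.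
have := sm p pp; have := sn p pp; rewrite !mulnn !pfactor_dvdn ?lcmn_gt0 ?m0 //.
by rewrite logn_lcm // -!ltnNge gtn_max => -> ->.
Qed.

(** Compactness: otherwise each of the finitely many [u] fails at some stage, and then all of them
    fail at a common stage. *)
Lemma antitone_pigeonhole (T : Type) (F : set T) (Q : nat -> T -> Prop) : finite_set F ->
  (forall i j u, (i <= j)%N -> Q j u -> Q i u) ->
  (forall j, exists2 u, F u & Q j u) -> exists2 u, F u & forall j, Q j u.
Proof.
move=> fF Qanti Qex; apply: contrapT => nH.
have /choice [j jP] (u : T) : exists j, F u -> ~ Q j u.
  have [Fu|nFu] := pselect (F u); last by exists 0%N.
  have /existsNP [j nQ] : ~ forall j, Q j u by move=> H; apply: nH; exists u.
  by exists j.
have [B HB] : exists B, forall u, F u -> (j u <= B)%N.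
  have [s Fs] := (@finite_seqP {classic T} F).1 fF.
  exists (\max_(u <- s) j u) => u; rewrite Fs => us.
  exact: (@leq_bigmax_seq {classic T} s xpredT j u us isT).
have [u Fu Qu] := Qex B; apply: (jP u Fu); exact: (Qanti _ B u (HB u Fu) Qu).
Qed.

Hypothesis V_torsion : forall v, exists2 n, (0 < n)%N & v *+ n = 0.
Hypothesis S_finite : finite_set [set v : V | exists2 n, squarefree n & v *+ n = 0].

(** For a prime p dividing n, multiplication by p maps the n-torsion to the (n/p)-torsion, and its
    fibers are cosets of the p-torsion. *)
Lemma finite_torsion n : (0 < n)%N -> finite_set [set v : V | v *+ n = 0].
Proof.
elim/ltn_ind: n => n IH n0.
have [n1|n1] := leqP n 1.
  apply: (sub_finite_set _ (finite_set1 (0 : V))) => v /=.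
  by have -> : n = 1%N by [apply/eqP; rewrite eqn_leq n1].
have pp := pdiv_prime n1; set p := pdiv n in pp.
have /dvdnP[m nE] : (p %| n)%N := pdiv_dvd n.
have m0 : (0 < m)%N by move: n0; rewrite nE muln_gt0 => /andP[].
have mn : (m < n)%N by rewrite [X in (_ < X)%N]nE ltn_Pmulr // prime_gt1.
have fp : finite_set [set v : V | v *+ p = 0].
  by apply: sub_finite_set S_finite => v vp; exists p => //; exact: prime_squarefree.
apply: (@sub_finite_set _ _ (\bigcup_(w in [set w : V | w *+ m = 0]) [set v | v *+ p = w])).
  by move=> v /= vn; exists (v *+ p) => //=; rewrite -mulrnA mulnC -nE.
apply: bigcup_finite; first exact: IH.
move=> w _; have [[v0 v0w]|nv] := EM (exists v0, v0 *+ p = w).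
  apply: (@sub_finite_set _ _ [set v0 + v | v in [set v : V | v *+ p = 0]]).
    move=> v vw; exists (v - v0); last by rewrite addrC subrK.
    by rewrite /= mulrnBl v0w vw subrr.
  exact: finite_image.
apply: (@sub_finite_set _ _ set0); last exact: finite_set0.
by move=> v vw; apply: nv; exists v.
Qed.

Hypothesis V_infinite : infinite_set [set: V].

(** Only primes dividing a common exponent [L0] of the finite set of elements of squarefree order
    occur. If the p-primary part were bounded for each of them, V would be bounded, hence finite. *)
Lemma unbounded_prime : exists2 p, prime p &
  forall k, exists2 v : V, v *+ p ^ k.+1 = 0 & v *+ p ^ k <> 0.
Proof.
apply: contrapT => nH.
have /choice [kp kpP] (p : nat) : exists k, prime p -> forall v : V, v *+ p ^ k.+1 = 0 -> v *+ p ^ k = 0.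
  have [pp|npp] := boolP (prime p); last by exists 0%N.
  have /existsNP[k nk] : ~ forall k, exists2 v : V, v *+ p ^ k.+1 = 0 & v *+ p ^ k <> 0.
    by move=> H; apply: nH; exists p.
  exists k => _ v v1; apply: contrapT => v2; apply: nk; exists v => //.
have [L0 L00 SL0] : exists2 L0, (0 < L0)%N & forall v : V, (exists2 n, squarefree n & v *+ n = 0) ->
    v *+ L0 = 0.
  have [s Ss] := (finite_seqP _).1 S_finite.
  have /choice [od odP] (v : V) : exists n, (0 < n)%N /\ v *+ n = 0.
    by have [n ? ?] := V_torsion v; exists n.
  exists (\prod_(v <- s) od v)%N; first by apply: prodn_gt0 => v; have [] := odP v.
  move=> v Sv; have vs : v \in s by have : [set` s] v by rewrite -Ss.
  by rewrite (big_rem v) //= mulrnA (odP v).2 mul0rn.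
pose L := (\prod_(p <- primes L0) p ^ kp p)%N.
suff VL (v : V) : v *+ L = 0.
  apply: V_infinite; apply: sub_finite_set (finite_torsion (n := L) _) => [v _ //|].
  rewrite /L big_seq; apply: prodn_cond_gt0 => p; rewrite mem_primes => /andP[pp _].
  by rewrite expn_gt0 prime_gt0.
have exn : exists n, (0 < n)%N && (v *+ n == 0).
  by have [n n0 vn] := V_torsion v; exists n; rewrite n0 vn eqxx.
case: (ex_minnP exn) => n /andP[n0 /eqP vn] nmin.
have vlt m : (0 < m < n)%N -> v *+ m <> 0.
  by move=> /andP[m0 mn] /eqP vm; have := nmin m; rewrite m0 vm leqNgt mn => /(_ isT).
suff /dvdnP[c ->] : (n %| L)%N by rewrite mulnC mulrnA vn mul0rn.
apply/(dvdn_partP _ n0) => p; rewrite mem_primes => /and3P[pp _ pn].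
have /dvdnP[m nE] := pn.
have m0 : (0 < m)%N by move: n0; rewrite nE muln_gt0 => /andP[].
have mn : (m < n)%N by rewrite [X in (_ < X)%N]nE ltn_Pmulr // prime_gt1.
have vm : v *+ m <> 0 by apply: vlt; rewrite m0.
have pL0 : p \in primes L0.
  rewrite mem_primes pp L00 /=; apply: contrapT => /negP pL0; apply: vm.
  apply: (@subgroup_coprime V [set 0] (v *+ m) p L0).
  - by split => // a b -> ->; rewrite subrr.
  - by change (v *+ m *+ p = 0); rewrite -mulrnA -nE.
  - by apply: SL0; exists p; [exact: prime_squarefree|rewrite -mulrnA -nE].
  - by rewrite coprimezE prime_coprime.
rewrite /L (big_rem p) //= dvdn_mulr // p_part; apply: dvdn_exp2l.
rewrite leqNgt; apply/negP => kpn.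
have /dvdnP[q nq] : (p ^ (kp p).+1 %| n)%N by rewrite pfactor_dvdn.
apply: vm; have mE : m = (q * p ^ kp p)%N.
  by apply/eqP; rewrite -(eqn_pmul2r (prime_gt0 pp)) -nE nq expnSr mulnA.
by rewrite mE mulrnA; apply: (kpP p pp); rewrite -mulrnA -nq.
Qed.

Lemma quasicyclic_sequence : exists p (y : nat -> V),
  [/\ prime p, y 0%N = 0, y 1%N <> 0 & forall k, y k.+1 *+ p = y k].
Proof.
have [p pp Hp] := unbounded_prime.
(* The elements divisible by all powers of p. Roots are chosen inside [D], as another root may have
   no further roots. *)
pose D v := forall j, exists w, w *+ p ^ j = v.
have Danti i j v : (i <= j)%N -> (exists w, w *+ p ^ j = v) -> exists w, w *+ p ^ i = v.
  by move=> /subnK <- [w <-]; exists (w *+ p ^ (j - i)); rewrite -mulrnA expnD.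
have fp := finite_torsion (prime_gt0 pp).
have [y1 [y1p y1n0] Dy1] : exists2 v, [set v : V | v *+ p = 0 /\ v <> 0] v & D v.
  apply: antitone_pigeonhole => //; first by apply: sub_finite_set fp => v [].
  move=> j; have [v v1 v2] := Hp j; exists (v *+ p ^ j); last by exists v.
  by split => //; rewrite -mulrnA -expnSr.
have /choice [f fP] (v : V) : exists u, D v -> D u /\ u *+ p = v.
  have [Dv|nDv] := pselect (D v); last by exists 0.
  suff [u up Du] : exists2 u, [set u | u *+ p = v] u & D u by exists u.
  apply: antitone_pigeonhole => //.
    have [u0 u0v] := Dv 1%N; rewrite expn1 in u0v.
    apply: (@sub_finite_set _ _ [set u0 + v | v in [set v : V | v *+ p = 0]]).
      move=> w wv; exists (w - u0); last by rewrite addrC subrK.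
      by rewrite /= mulrnBl u0v wv subrr.
    exact: finite_image.
  move=> j; have [w wv] := Dv j.+1; exists (w *+ p ^ j); last by exists w.
  by rewrite /= -mulrnA -expnSr.
pose y k := if k is k'.+1 then iter k' f y1 else 0.
have Dy k : D (y k.+1) by elim: k => [//|k IH]; have [] := fP _ IH.
exists p, y; split => // -[|k]; first exact: y1p.
by have [] := fP _ (Dy k).
Qed.

End Torsion.

Lemma inj_C_closed_C_closed i X : inj_C_closed i X -> C_closed i X.
Proof. by move=> H Y mul h inY homh h_inj _; exact: (H Y mul h). Qed.

(** * Excluding infinite central subgroups *)

Section InfiniteCentral.
Import GRing.Theory Num.Theory.
Local Open Scope ring_scope.

Lemma sub_zmod (V : zmodType) (W : set V) : additive_subgroup W ->
  exists (V' : zmodType) (f : V' -> V),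
    [/\ forall a b, f (a + b) = f a + f b, injective f & range f = W].
Proof.
move=> sW; pose S : semigroup := @Defs.Semigroup V +%R (@addrA V).
have [W0 WB] := sW.
have sG : @is_subgroup S W.
  have -> : W = [set (id v : S) | v in W].
    by apply/seteqP; split => [v Wv|_ [v Wv <-]]; [exists v|exact: Wv].
  by apply: (@image_subgroup S V id).
by apply: (@comm_group_zmod S W sG) => a b _ _; exact: addrC.
Qed.

Section Morphism.
Variables (V V' : zmodType) (f : V' -> V).
Hypothesis fD : forall a b, f (a + b) = f a + f b.

Lemma zmorph0 : f 0 = 0.
Proof. by apply: (addIr (f 0)); rewrite -fD !add0r. Qed.

Lemma zmorphMn v n : f (v *+ n) = f v *+ n.
Proof.
elim: n => [|n IH]; first by rewrite !mulr0n zmorph0.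
by rewrite !mulrS fD IH.
Qed.

End Morphism.

Variable X : semigroup.
Local Notation "x ** y" := (sg_op x y) (at level 40, left associativity).
Hypothesis dcX : C_discrete Tzc X \/ inj_C_closed Tzc X.

Let bounded (V : zmodType) (io : V -> X) (Z : nat -> set V) :
  (forall u v, io (u + v) = io u ** io v) -> injective io ->
  (forall v, sg_center X (io v)) -> (forall n, finite_set (Z n)) ->
  (forall t : X,
    (exists2 q, (0 < q)%N & forall v, t ** io (v *+ q) = t ** io 0) \/
    (exists r0, forall r v, (r0 <= r)%N -> t ** io v = t ** io 0 -> Z r v)) ->
  exists2 n, (0 < n)%N & forall v : V, v *+ n = 0.
Proof.
move=> ioD io_inj ioZ Z_fin stab; case: dcX => [dX|/inj_C_closed_C_closed cX].
  exact: discrete_central_group_bounded stab.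
exact: central_group_bounded stab.
Qed.

Variables (V : zmodType) (io : V -> X).
Hypothesis ioD : forall u v, io (u + v) = io u ** io v.
Hypothesis io_inj : injective io.
Hypothesis ioZ : forall v, sg_center X (io v).

(** An element of infinite order would embed the integers. A nonzero stabilizer there has finite
    index, so each orbit is bounded or free, but the integers are unbounded. *)
Let V_torsion (v : V) : exists2 n, (0 < n)%N & v *+ n = 0.
Proof.
apply: contrapT => nv.
have v_inf (c : int) : v *~ c = 0 -> c = 0.
  move=> vc; apply: contrapT => /eqP c0; apply: nv; exists (absz c).
    by rewrite absz_gt0.
  by case: (intP c) vc {c0} => [//|n //|n]; rewrite mulrNz => /eqP; rewrite oppr_eq0 => /eqP.
have [n n0 Hn] : exists2 n, (0 < n)%N & forall c : int, c *+ n = 0.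
  apply: (@bounded _ (fun c => io (v *~ c)) (fun=> [set 0])).
  - by move=> a b; rewrite mulrzDr ioD.
  - move=> a b /io_inj ab; apply/eqP; rewrite -subr_eq0; apply/eqP; apply: v_inf.
    by rewrite mulrzBr ab subrr.
  - by move=> a.
  - by move=> _; exact: finite_set1.
  move=> t; have [[d d0 td]|nd] := EM (exists2 d : int, d <> 0 & t ** io (v *~ d) = t ** io (v *~ 0)).
    left; exists (absz d); first by rewrite absz_gt0; exact/eqP.
    move=> c; have sN := stabilizer_subgroup ioD t.
    rewrite -[c *+ _]mulr_natr natz abszEsg mulrA mulrC mulrzA mulr0z.
    apply: (@subgroupMz V _ (v *~ d) (c * sgz d) sN) => /=.
    by rewrite td mulr0z.
  right; exists 0%N => _ c _ tc; apply: contrapT => c0; apply: nd; exists c => //.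
by have := Hn 1; rewrite natz; lia.
Qed.

(** A proper subgroup misses some [y j] and then lies in the p^j-torsion; this is why [Z r] is taken
    to be the p^r-torsion. *)
Let no_quasicyclic p (y : nat -> V) : prime p -> y 0%N = 0 -> y 1%N <> 0 ->
  (forall k, y k.+1 *+ p = y k) -> (forall n, (0 < n)%N -> finite_set [set v : V | v *+ n = 0]) ->
  False.
Proof.
move=> pp y0 y1 yS fin_tors.
have p0 := prime_gt0 pp.
have yD k j : y (k + j)%N *+ p ^ j = y k.
  elim: j => [|j IH]; first by rewrite addn0.
  by rewrite addnS expnS mulrnA yS.
have yk k : y k *+ p ^ k = 0 by have := yD 0%N k; rewrite add0n y0.
pose W := [set v | exists k a, v = y k *+ a].
have sW : additive_subgroup W.
  split; first by exists 0%N, 0%N.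
  move=> _ _ [k [a ->]] [l [b ->]].
  have -> : y k *+ a = y (k + l)%N *+ (p ^ l * a) by rewrite mulrnA yD.
  have -> : y l *+ b = y (k + l)%N *+ (p ^ k * b) by rewrite mulrnA addnC yD.
  move: (k + l)%N (p ^ l * a)%N (p ^ k * b)%N => m c d.
  exists m, (c + d * (p ^ m).-1)%N; rewrite mulrnDr; congr (_ + _).
  apply/eqP; rewrite eq_sym -addr_eq0 -mulrnDr -mulnSr prednK ?expn_gt0 ?p0 //.
  by rewrite mulnC mulrnA yk mul0rn.
have [V' [f [fD f_inj fW]]] := sub_zmod sW.
have fy k : exists v', f v' = y k.
  have : range f (y k) by rewrite fW; exists k, 1%N.
  by case=> v' _ <-; exists v'.
have [n n0 Hn] : exists2 n, (0 < n)%N & forall v : V', v *+ n = 0.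
  apply: (@bounded _ (fun v => io (f v)) (fun r => [set v | v *+ p ^ r = 0])).
  - by move=> a b; rewrite fD ioD.
  - by move=> a b /io_inj /f_inj.
  - by move=> a.
  - move=> r; have pr0 : (0 < p ^ r)%N by rewrite expn_gt0 p0.
    have := @finite_preimage _ _ [set v : V | v *+ p ^ r = 0] f _ (fin_tors _ pr0).
    move=> H; apply: sub_finite_set (H _) => [v /= vr|a b _ _ /f_inj //].
    by rewrite -zmorphMn // vr zmorph0.
  move=> t; have sN := stabilizer_subgroup ioD t.
  have [Ny|/existsNP[j nNy]] := EM (forall k, t ** io (y k) = t ** io 0).
    left; exists 1%N => // v; rewrite mulr1n (zmorph0 fD).
    have : W (f v) by rewrite -fW; exists v.
    move=> [k [a ->]]; exact: (@subgroupMz V _ (y k) a sN (Ny k)).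
  right; exists j => r v jr; rewrite (zmorph0 fD) => Nv.
  apply: f_inj; rewrite zmorphMn // zmorph0 //.
  have : W (f v) by rewrite -fW; exists v.
  move=> [k [a fv]]; case: (posnP a) fv => [->|a0] fv; first by rewrite fv mulr0n mul0rn.
  apply: contrapT => vr; apply: nNy.
  (* v = y_k p^i a' with a' prime to p, of order p^(k-i) > p^j *)
  have [i [a' [pa' aE]]] : exists i a', ~~ (p %| a')%N /\ a = (a' * p ^ i)%N.
    have [a' pa' aE] := pfactor_coprime pp a0.
    by exists (logn p a), a'; rewrite -prime_coprime.
  have ik : (i + r < k)%N.
    rewrite ltnNge; apply/negP => kir; apply: vr; rewrite fv aE.
    rewrite -mulrnA -mulnA -expnD mulnC mulrnA -(subnKC kir) expnD mulrnA yk.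
    by rewrite !mul0rn.
  have vE : f v = y (k - i)%N *+ a'.
    by rewrite fv aE mulnC mulrnA -{1}(subnK (ltnW (leq_ltn_trans (leq_addr r i) ik))) yD.
  have : t ** io (y (k - i)%N) = t ** io 0.
    apply: (@subgroup_coprime V _ (y (k - i)%N) a' (p ^ (k - i))%N sN).
    - by rewrite /= -pmulrn -vE.
    - by rewrite /= -pmulrn yk.
    by rewrite coprimezE /= coprimeXr // coprime_sym prime_coprime.
  have jki : (j <= k - i)%N by rewrite leq_subRL; lia.
  move=> Nyki; rewrite -(yD j (k - i - j)%N) subnKC //.
  exact: (@subgroupMz V _ (y (k - i)%N) (p ^ (k - i - j))%N sN Nyki).
have [k [m [pm nE]]] : exists k m, ~~ (p %| m)%N /\ n = (m * p ^ k)%N.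
  have [m pm nE] := pfactor_coprime pp n0.
  by exists (logn p n), m; rewrite -prime_coprime.
(* The element [y 1] is p^k times [y k.+1], so it is killed by m as well as by p. *)
have [v' fv'] := fy k.+1; apply: y1.
apply: (@subgroup_coprime V [set 0] (y 1%N) m p).
- by split => // a b -> ->; rewrite subrr.
- change (y 1%N *+ m = 0); rewrite -(yD 1%N k) add1n -mulrnA mulnC -nE -fv'.
  by rewrite -zmorphMn // Hn zmorph0.
- by change (y 1%N *+ p = 0); rewrite yS.
by rewrite coprimezE /= coprime_sym prime_coprime.
Qed.

Let no_squarefree : infinite_set [set v : V | exists2 n, squarefree n & v *+ n = 0] -> False.
Proof.
move=> /infiniteP /card_leP [b0].
have nT (n : nat) : n \in [set: nat] by rewrite inE.
pose b n : V := \val (b0 (exist _ n (nT n))).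
have bS n : exists2 m, squarefree m & b n *+ m = 0 by exact: (set_mem (valP (b0 _))).
have b_inj : injective b.
  by move=> i j /val_inj bij; have [] := @inj _ _ _ b0 _ _ (in_setT _) (in_setT _) bij.
(* Lists of indices enumerate the subgroup generated by the [b i], and
   [residually_finite_not_closed] needs an enumeration. Opposites are sums as well, because the
   group is torsion. *)
pose sumb (l : seq nat) := \sum_(i <- l) b i.
pose W := [set v | exists l, v = sumb l].
have Wsq v : W v -> exists2 n, squarefree n & v *+ n = 0.
  move=> [l ->]; elim: l => [|i l [n sn IH]].
    by exists 1%N; [split => // p pp; rewrite dvdn1; have := prime_gt1 pp; nia|rewrite /sumb big_nil].
  have [m sm bm] := bS i; exists (lcmn m n); first exact: squarefree_lcm.
  rewrite /sumb big_cons mulrnDl.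
  have -> : b i *+ lcmn m n = 0.
    by have /dvdnP[c ->] := dvdn_lcml m n; rewrite mulnC mulrnA bm mul0rn.
  by rewrite add0r; have /dvdnP[d ->] := dvdn_lcmr m n; rewrite mulnC mulrnA IH mul0rn.
have WD u v : W u -> W v -> W (u + v).
  by move=> [l ->] [k ->]; exists (l ++ k); rewrite /sumb big_cat.
have sW : additive_subgroup W.
  split; first by exists [::]; rewrite /sumb big_nil.
  move=> u v Wu Wv; have [n n0 vn] := V_torsion v; apply: (WD) => //.
  have -> : - v = v *+ n.-1.
    by apply/eqP; rewrite eq_sym -addr_eq0 -mulrSr prednK // vn.
  elim: (n.-1) => [|k IH]; first by exists [::]; rewrite /sumb big_nil.
  by rewrite mulrS; exact: WD.
have [V' [f [fD f_inj fW]]] := sub_zmod sW.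
have Wf v : W (f v) by rewrite -fW; exists v.
have V'_inf : infinite_set [set: V'].
  have /choice [g gP] n : exists v', f v' = b n.
    have : range f (b n) by rewrite fW; exists [:: n]; rewrite /sumb big_seq1.
    by case=> v' _ <-; exists v'.
  have g_inj : injective g by move=> i j gij; apply: b_inj; rewrite -!gP gij.
  apply/infiniteP/pcard_leTP/injPex; exists g => // i j _ _; exact: g_inj.
have V'_sub N g : additive_subgroup N -> ~ N g -> exists H : set V',
    [/\ additive_subgroup H, finite_index H, N `<=` H & ~ H g].
  apply: squarefree_subgroups => v; have [n sn fn] := Wsq _ (Wf v); exists n => //.
  by apply: f_inj; rewrite zmorphMn // fn zmorph0.
have ioD' u v : io (f (u + v)) = io (f u) ** io (f v) by rewrite fD ioD.
have io_inj' : injective (io \o f) by move=> u v /io_inj /f_inj.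
case: dcX; first exact: (residually_finite_not_discrete V'_inf V'_sub ioD' io_inj').
have /choice [g gP] (l : seq nat) : exists v', f v' = sumb l.
  have : range f (sumb l) by rewrite fW; exists l.
  by case=> v' _ <-; exists v'.
apply: (residually_finite_not_closed V'_inf V'_sub ioD' io_inj' _
  (a := fun n => if unpickle n is Some l then g l else 0)) => // v.
have [l fv] := Wf v; exists (pickle l); rewrite pickleK.
by apply: f_inj; rewrite gP fv.
Qed.

Lemma central_group_finite : finite_set [set: V].
Proof.
apply: contrapT => V_inf.
have [S_fin|] := pselect (finite_set [set v : V | exists2 n, squarefree n & v *+ n = 0]);
  last exact: no_squarefree.
have [p [y [pp y0 y1 yS]]] := quasicyclic_sequence V_torsion S_fin V_inf.
apply: (no_quasicyclic pp y0 y1 yS) => n; exact: finite_torsion.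
Qed.

End InfiniteCentral.

Lemma center_group_finite X : C_discrete Tzc X \/ inj_C_closed Tzc X ->
  group_finite (sg_center X).
Proof.
move=> dcX G sG GZ.
have [V [io [ioD io_inj ioG]]] := central_subgroup_zmod sG GZ.
rewrite -ioG; apply: finite_image; apply: (central_group_finite dcX ioD io_inj).
by move=> v; apply: GZ; rewrite -ioG; exists v.
Qed.

(** * Subgroups of the center and of the ideal center *)

Section BoundedSubgroups.
Import GRing.Theory Num.Theory.
Local Open Scope ring_scope.
Variable X : semigroup.
Local Notation "x ** y" := (sg_op x y) (at level 40, left associativity).

Lemma qcls_inj (R : X -> X -> Prop) (HR : congruence R) a b : qcls R a = qcls R b -> R a b.
Proof. by case: HR => rf _ _ _ /(congr1 (@proj1_sig _ _)) /= ->; exact: rf. Qed.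

(* Modulo the ideal I of all x that do not divide the unit of V, every orbit of V is free or
   zero. *)
Lemma ideal_closed_group_bounded : ideal_C_closed Tzc X -> group_bounded (sg_center X).
Proof.
move=> iX G sG GZ; have [V [io [ioD io_inj ioG]]] := central_subgroup_zmod sG GZ.
have ioZ v : sg_center X (io v) by apply: GZ; rewrite -ioG; exists v.
pose divides (x : X) := exists a b : adj1 X,
  sg_op (sg_op a (Some x : adj1 X)) b = (Some (io 0) : adj1 X).
pose I := [set x | ~ divides x].
have HI : is_ideal I.
  move=> x y Ix; split=> -[a [b ab]]; apply: Ix.
    by exists a, (sg_op (Some y : adj1 X) b); rewrite -ab -(sg_op_Some x y) !sg_opA.
  by exists (sg_op a (Some y : adj1 X)), b; rewrite -ab -(sg_op_Some y x) !sg_opA.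
have qM a b : sg_op (qcls (rees_rel I) a : rees_quotient HI) (qcls (rees_rel I) b) =
    qcls (rees_rel I) (a ** b) by exact: (qop_cls (rees_congruence HI)).
have ioI v : ~ I (io v).
  move=> Iv; apply: Iv; exists None, (Some (io (- v)) : adj1 X).
  by rewrite sg_op1x sg_op_Some -ioD subrr.
rewrite -ioG; suff [n n0 Vn] : exists2 n, (0 < n)%N & forall v : V, v *+ n = 0.
  exact: zmod_sg_bounded Vn.
apply: (@central_group_bounded (rees_quotient HI) V (fun v => qcls (rees_rel I) (io v))
  (fun=> [set 0]) (iX I HI)).
- by move=> u v; rewrite ioD -qM.
- move=> u v /(qcls_inj (rees_congruence HI)) [/io_inj //|[/ioI //]].
- move=> v q; rewrite -(qcls_rep q) !qM; congr (qcls _ _); exact: ioZ.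
- by move=> n; exact: finite_set1.
move=> q; rewrite -(qcls_rep q); move: (qrep q) => x.
have [Ixe|nIxe] := pselect (I (x ** io 0)).
  left; exists 1%N => // v; rewrite !qM; apply: (qcls_eq (rees_congruence HI)).
  right; split => //; rewrite mulr1n -[v]add0r ioD sg_opA.
  by have [] := HI _ (io v) Ixe.
right; exists 0%N => _ v _; rewrite !qM => /(qcls_inj (rees_congruence HI)) [e|[_ //]].
have [a [b ab]] : divides (x ** io 0) by exact: contrapT.
apply: io_inj; have : (Some (io 0) : adj1 X) = Some (io v).
  have iv : sg_center (adj1 X) (Some (io v) : adj1 X) by exact: adj1_center_Some.
  transitivity (sg_op (sg_op (sg_op a (Some (x ** io 0) : adj1 X)) b) (Some (io v) : adj1 X)).
    rewrite -(sg_opA _ b) iv (sg_opA _ _ b) -(sg_opA a) sg_op_Some.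
    by rewrite -(sg_opA x) -ioD add0r e ab.
  by rewrite ab sg_op_Some -ioD add0r.
by case.
Qed.

Hypothesis cX : C_closed Tzc X.

Lemma ideal_center_ideal z x : sg_ideal_center X z -> sg_ideal_center X (z ** x).
Proof. by move=> [Zz zZ]; split => // w; rewrite -sg_opA. Qed.

Section Descent.
Variables (V : zmodType) (io : V -> X).
Hypothesis ioD : forall u v, io (u + v) = io u ** io v.
Hypothesis ioZ : forall v, sg_center X (io v).

Definition bounded_orbit (y : X) := exists2 q, (0 < q)%N & forall v, y ** io (v *+ q) = y ** io 0.

Lemma bounded_orbitM y w : bounded_orbit y -> bounded_orbit (y ** w).
Proof.
move=> [q q0 yq]; exists q => // v.
by rewrite -!sg_opA !(ioZ _ w) !sg_opA yq.
Qed.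

(* The set q V y has constant product, so it is finite. *)
Lemma bounded_orbit_sqr y : sg_center X y -> bounded_orbit (y ** y) -> bounded_orbit y.
Proof.
move=> Zy [q q0 yyq].
pose A := range (fun v : V => y ** io (v *+ q)).
have fA : finite_set A.
  apply: (@nonsingular X A (y ** y ** io 0) cX).
    by move=> _ [v _ <-]; apply: centerM.
  move=> _ _ [u _ <-] [v _ <-]; rewrite -sg_opA (sg_opA (io _)) -(ioZ _ y).
  by rewrite -(sg_opA y (io _)) sg_opA -ioD -mulrnDl yyq.
have [B HB] := pigeonhole fA; exists (B`! * q)%N; first by rewrite muln_gt0 fact_gt0.
move=> v; have [i|i [j [ij jB e]]] := HB (fun i => y ** io (v *+ i *+ q)); first by exists (v *+ i).
have sN := stabilizer_subgroup ioD y.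
have Nv : y ** io (v *+ (j - i) *+ q) = y ** io 0.
  rewrite mulrnBr ?(ltnW ij) // mulrnBl ioD sg_opA -e -sg_opA -ioD subrr //.
have /dvdnP[k ->] : (j - i %| B`!)%N.
  by apply: dvdn_fact; rewrite subn_gt0 ij (leq_trans (leq_subr _ _) jB).
have -> : v *+ (k * (j - i) * q) = (v *+ (j - i) *+ q) *~ k.
  by rewrite -pmulrn -!mulrnA; congr (_ *+ _); rewrite -mulnA mulnC mulnA.
exact: (subgroupMz _ sN).
Qed.

(** Iterated square roots descend from the exponent 2^k to 1, and y^(2^n) is a multiple of y^n. *)
Lemma bounded_orbit_xpow y n : sg_center X y -> (0 < n)%N -> bounded_orbit (xpow y n) ->
  bounded_orbit y.
Proof.
move=> Zy n0 yn.
suff H k z : sg_center X z -> bounded_orbit (xpow z (2 ^ k)%N) -> bounded_orbit z.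
  apply: (H n) => //; have n2 : (n < 2 ^ n)%N by exact: ltn_expl.
  by rewrite -(subnKC (ltnW n2)) xpowD ?subn_gt0 //; exact: bounded_orbitM.
elim: k z => [|k IH] z Zz; first by rewrite expn0.
rewrite expnS -xpowM // ?expn_gt0 // => /IH H; apply: bounded_orbit_sqr => //.
by apply: H; exact: centerM.
Qed.

End Descent.

Definition bad_idempotent (e : X) : Prop := idempotent_el e /\
  exists G, [/\ is_subgroup G, G e, G `<=` sg_ideal_center X & ~ sg_bounded G].

(* For y = t e, the idempotent power f of y is below e. If f = e, then the orbit of t is free.
   Otherwise f is not bad, hence the orbit of f is bounded, and so is the orbit of y. *)
Lemma bad_idempotent_descent e : bad_idempotent e ->
  exists f, [/\ bad_idempotent f, f <> e & f ** e = f].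
Proof.
move=> [ee [G [sG Ge GI nG]]].
have GZ : G `<=` sg_center X by move=> x /GI [].
have [V [io [ioD io_inj ioG]]] := central_subgroup_zmod sG GZ.
have Gio v : G (io v) by rewrite -ioG; exists v.
have ioZ v : sg_center X (io v) by exact: GZ.
have io0 : io 0 = e.
  have : range io e by rewrite ioG.
  case=> u _ ue; suff -> : e = io 0 by [].
  have uu : io (u + u) = io u by rewrite ioD ue.
  by rewrite -ue; congr io; apply: (addIr u); rewrite add0r (io_inj _ _ uu).
apply: contrapT => nf; apply: nG; rewrite -ioG.
suff [n n0 Vn] : exists2 n, (0 < n)%N & forall v : V, v *+ n = 0 by exact: zmod_sg_bounded Vn.
apply: (@central_group_bounded X V io (fun=> [set 0]) cX) => //.
move=> t; pose y := t ** io 0.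
(* The unit [io 0] must lie in the ideal center here, since [t] is arbitrary. *)
have Zy : sg_center X y by rewrite /y (ioZ 0 t); case: (GI _ (Gio 0)).
have yio v : y ** io v = t ** io v by rewrite /y -sg_opA -ioD add0r.
have [n n0 fi] := center_periodic cX Zy.
pose f := xpow y n.
have fE : exists w : adj1 X, forall v, (Some (f ** io v) : adj1 X) = sg_op w (Some (y ** io v) : adj1 X).
  rewrite /f; case: n n0 {fi f} => [//|[|n]] _.
    by exists None.
  exists (Some (xpow y n.+1) : adj1 X) => v.
  by rewrite (@xpowS _ y n.+1) // sg_op_Some sg_opA.
have [fe|fe] := pselect (f = e).
  right; exists 0%N => _ v _; rewrite -!yio => yv; have [w wP] := fE.
  have : (Some (f ** io v) : adj1 X) = Some (f ** io 0) by rewrite !wP yv.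
  by rewrite fe -io0 -!ioD !add0r => -[/io_inj].
left; suff [q q0 Hq] : bounded_orbit io y by exists q => // v; rewrite -!yio.
apply: (bounded_orbit_xpow ioD ioZ Zy n0); rewrite -/f.
have f0 : f ** io 0 = f.
  have [w wP] := fE; have y0 : y ** io 0 = y by rewrite yio.
  rewrite /f; case: n n0 {fi f fE fe w wP} => [//|[|n]] _ //.
  by rewrite (@xpowS _ y n.+1) // -sg_opA y0.
have fZ : sg_ideal_center X f.
  rewrite -f0 (ioZ 0 f); apply: ideal_center_ideal; exact: GI.
have Zf : sg_center X f by case: fZ.
have ff : f ** f = f := fi.
have mul_fv u w : f ** io u ** (f ** io w) = f ** io (u + w).
  by rewrite ioD sg_opA -(sg_opA f (io u) f) (Zf (io u)) !sg_opA ff.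
have [q [q0 fq]] : sg_bounded [set f ** io v | v in [set: V]].
  apply: contrapT => nb; apply: nf; exists f; split => //; last by rewrite -io0.
  split => //; exists [set f ** io v | v in [set: V]]; split => //.
  - split; first by exists (f ** io 0); exists 0.
    split.
      move=> _ _ [u _ <-] [v _ <-]; exists (u + v) => //.
    exists f; split; first by exists 0.
      move=> _ [v _ <-]; rewrite sg_opA ff; split => //.
      by rewrite -sg_opA (Zf (io v)) sg_opA ff.
    move=> _ [v _ <-]; exists (f ** io (- v)).
    by split; [exists (- v)|rewrite mul_fv subrr|rewrite mul_fv addNr].
  - by exists 0.
  - by move=> _ [v _ <-]; exact: ideal_center_ideal.
exists q => // v.
have fvE m : (0 < m)%N -> xpow (f ** io v) m = f ** io (v *+ m).
  by move=> m0; rewrite xpow_mul // xpow_idem // (io_xpow ioD).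
have : xpow (f ** io v) q ** xpow (f ** io v) q = xpow (f ** io v) q by apply: fq; exists v.
rewrite -xpowD // !fvE ?addn_gt0 ?q0 // mulrnDr ioD => e1.
have -> : f ** io 0 = (f ** io (v *+ q)) ** io (- (v *+ q)) by rewrite -sg_opA -ioD subrr.
rewrite -[in RHS]e1.
by rewrite -!sg_opA -ioD subrr -ioD addr0.
Qed.

Lemma ideal_center_group_bounded : group_bounded (sg_ideal_center X).
Proof.
move=> G sG GI; apply: contrapT => nG.
have [_ [_ [u [Gu Hu _]]]] := sG.
have bu : bad_idempotent u by split; [exact: (Hu u Gu).1|exists G].
have /choice [f fP] (e : X) : exists f, bad_idempotent e ->
    [/\ bad_idempotent f, f <> e & f ** e = f].
  have [be|nbe] := pselect (bad_idempotent e); last by exists e.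
  by have [f Hf] := bad_idempotent_descent be; exists f.
pose e n := iter n f u.
have be n : bad_idempotent (e n) by elim: n => [//|n IH]; have [] := fP _ IH.
have Ze n : sg_center X (e n).
  by have [_ [K [_ Ke KI _]]] := be n; have [] := KI _ Ke.
have [|m Hm] := descending_chain cX Ze.
  move=> n m /subnKC <-; elim: (m - n)%N => [|k IH]; first by rewrite addn0; exact: (be n).1.
  have [_ _ ek] := fP _ (be (n + k)%N).
  have {}ek : e (n + k).+1 ** e (n + k)%N = e (n + k).+1 := ek.
  rewrite addnS -{1}ek -Ze -sg_opA Ze IH //.
by have [_ ne _] := fP _ (be m); apply: ne; exact: (Hm m.+1 (leqnSn m)).
Qed.

End BoundedSubgroups.

(** * Maximal subgroups of viable idempotents *)

Lemma closure_mul (Y : topologicalType) (mul : Y -> Y -> Y) (D : set Y) y z :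
  topsg mul -> (forall a b, D a -> D b -> D (mul a b)) ->
  closure D y -> closure D z -> closure D (mul y z).
Proof.
move=> [_ /mul_continuousP mc] DM cy cz; apply/closure_openP => O oO Oyz.
have [U [W [oU Uy oW Wz UW]]] := mc _ _ _ oO Oyz.
have [a [Da Ua]] := (closure_openP _ _).1 cy _ oU Uy.
have [b [Db Wb]] := (closure_openP _ _).1 cz _ oW Wz.
by exists (mul a b); split; [exact: DM|exact: UW].
Qed.

(* The discrete semigroup R is embedded in the semigroup obtained by adding to R the
   limit points of f(P); the complement of P in R consists of zeros of R. *)
Section DiscreteExtension.
Variables (i : sep_class) (R : semigroup) (P : set R).
Variables (Y : topologicalType) (mul : Y -> Y -> Y) (f : R -> Y).
Local Notation "x * y" := (sg_op x y).
Hypothesis Y_class : in_class i mul.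
Hypothesis PM : forall a b, P a -> P b -> P (a * b) /\ f (a * b) = mul (f a) (f b).
Hypothesis zeroP : forall a b, ~ P a -> a * b = a /\ b * a = a.
Let D : set Y := f @` P.
Hypothesis D_discrete : discrete_subspace D.
Hypothesis D_cancel : forall a b c, D a -> D b -> D c ->
  (mul a b = mul a c -> b = c) /\ (mul b a = mul c a -> b = c).

Let Yts : topsg mul. Proof. by case: Y_class. Qed.
Let YT1 : accessible_space Y. Proof. exact: in_class_T1 Y_class. Qed.
Let mulA : forall x y z, mul x (mul y z) = mul (mul x y) z. Proof. by case: Yts. Qed.
Let mulC : forall a b O, open O -> O (mul a b) -> exists U V,
  [/\ open U, U a, open V, V b & forall x y, U x -> V y -> O (mul x y)].
Proof. by apply/mul_continuousP; case: Yts. Qed.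

Let DM a b : D a -> D b -> D (mul a b).
Proof. by move=> [x Px <-] [y Py <-]; have [Pxy <-] := PM Px Py; exists (x * y). Qed.

Let new (y : Y) := closure D y /\ ~ D y.

Let two_points y U : new y -> open U -> U y ->
  exists b c, [/\ D b, D c, U b, U c & b <> c].
Proof.
move=> [cy nDy] oU Uy; have [b [Db Ub]] := (closure_openP _ _).1 cy _ oU Uy.
have yb : y != b by apply/eqP => yb; apply: nDy; rewrite yb.
have [A [oA /set_mem Ay /set_mem nAb]] := YT1 yb.
have [||c [Dc [Uc Ac]]] := (closure_openP _ _).1 cy (U `&` A); [exact: openI|by []|].
by exists b, c; split => // bc; apply: nAb; rewrite bc.
Qed.

(** If the product were a point of D, it would be isolated in D. Two points of D near y, multiplied
    by one point of D near z, would then give the same product, against cancellation. *)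
Let new_mul y z : new y -> closure D z -> new (mul y z) /\ new (mul z y).
Proof.
move=> ny cz; have cy := ny.1; split; (split; first exact: closure_mul); move=> Dyz.
  have [U [oU UD]] := D_discrete Dyz.
  have Uyz : U (mul y z) by have : [set mul y z] (mul y z) by []; rewrite -UD => -[].
  have [A [B [oA Ay oB Bz AB]]] := mulC oU Uyz.
  have [b [c [Db Dc Ab Ac bc]]] := two_points ny oA Ay.
  have [d [Dd Bd]] := (closure_openP _ _).1 cz _ oB Bz.
  have H x : D x -> A x -> mul x d = mul y z.
    move=> Dx Ax; have : (U `&` D) (mul x d) by split; [exact: AB|exact: DM].
    by rewrite UD.
  by apply: bc; apply: (D_cancel Dd Db Dc).2; rewrite !H.
have [U [oU UD]] := D_discrete Dyz.
have Uyz : U (mul z y) by have : [set mul z y] (mul z y) by []; rewrite -UD => -[].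
have [B [A [oB Bz oA Ay BA]]] := mulC oU Uyz.
have [b [c [Db Dc Ab Ac bc]]] := two_points ny oA Ay.
have [d [Dd Bd]] := (closure_openP _ _).1 cz _ oB Bz.
have H x : D x -> A x -> mul d x = mul z y.
  move=> Dx Ax; have : (U `&` D) (mul d x) by split; [exact: BA|exact: DM].
  by rewrite UD.
by apply: bc; apply: (D_cancel Dd Db Dc).1; rewrite !H.
Qed.

Let op0 (s t : R + Y) : R + Y :=
  match s, t with
  | inl a, inl b => inl (a * b)
  | inl a, inr y => if `[< P a >] then inr (mul (f a) y) else inl a
  | inr y, inl a => if `[< P a >] then inr (mul y (f a)) else inl a
  | inr y, inr z => inr (mul y z)
  end.

Let ok (s : R + Y) := match s with inl _ => True | inr y => new y end.

Let clD a : P a -> closure D (f a).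
Proof. by move=> Pa; apply: subset_closure; exists a. Qed.

Let op0_ok s t : ok s -> ok t -> ok (op0 s t).
Proof.
case: s t => [a|y] [b|z] //= ny nz; last by have [] := new_mul ny nz.1.
  by case: asboolP => // Pa; have [] := new_mul nz (clD Pa).
by case: asboolP => // Pb; have [] := new_mul ny (clD Pb).
Qed.

Let PMl a b : P (a * b) -> P a.
Proof. by move=> Pab; apply: contrapT => na; move: Pab; rewrite (zeroP b na).1. Qed.

Let PMr a b : P (a * b) -> P b.
Proof. by move=> Pab; apply: contrapT => na; move: Pab; rewrite (zeroP a na).2. Qed.

Let PME a b : `[< P (a * b) >] = `[< P a >] && `[< P b >].
Proof.
apply/asboolP/andP => [Pab|[/asboolP Pa /asboolP Pb]]; last exact: (PM Pa Pb).1.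
by split; apply/asboolP; [exact: PMl Pab|exact: PMr Pab].
Qed.

Let op0A r s t : op0 r (op0 s t) = op0 (op0 r s) t.
Proof.
case: r s t => [a|x] [b|y] [c|z] /=; rewrite ?sg_opA ?mulA ?PME //.
- case: (asboolP (P b)) => Pb; case: (asboolP (P a)) => Pa /=;
    rewrite ?(asboolT Pa) ?(asboolF Pa) //=;
    first [by rewrite (PM Pa Pb).2 mulA|by rewrite (zeroP b Pa).1|by rewrite (zeroP a Pb).2].
- case: (asboolP (P c)) => Pc; case: (asboolP (P a)) => Pa /=;
    rewrite ?(asboolT Pa) ?(asboolF Pa) ?(asboolT Pc) ?(asboolF Pc) //= ?mulA //;
    first [by rewrite (zeroP c Pa).1|by rewrite (zeroP a Pc).2].
- by case: asboolP => Pa //=; rewrite (asboolF Pa).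
- case: (asboolP (P b)) => Pb; case: (asboolP (P c)) => Pc /=;
    rewrite ?(asboolT Pb) ?(asboolF Pb) ?(asboolT Pc) ?(asboolF Pc) //=;
    first [by rewrite (PM Pb Pc).2 mulA|by rewrite (zeroP b Pc).2|by rewrite (zeroP c Pb).1].
- by case: asboolP => Pb //=; rewrite ?(asboolF Pb) // mulA.
- by case: asboolP => Pc //=; rewrite ?(asboolF Pc) // mulA.
Qed.

Let T := {s : R + Y | ok s}.
Let op (s t : T) : T :=
  exist _ (op0 (proj1_sig s) (proj1_sig t)) (op0_ok (proj2_sig s) (proj2_sig t)).
Let old (a : R) : T := exist _ (inl a) I.

(** Old points enter a neighborhood of a new point through [f], which may identify many of them;
    they themselves stay isolated. *)
Let hat (O : set Y) : set T := [set t | match proj1_sig t with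
  | inl a => P a /\ O (f a) | inr y => O y end].

Let N (t : T) : set (set T) := match proj1_sig t with
  | inl a => [set [set old a]]
  | inr y => [set A | exists O, [/\ open O, O y & A = hat O]] end.

Let Nex t : exists A, N t A.
Proof.
case: t => [[a|y] st]; rewrite /N /=; first by exists [set old a].
by exists (hat setT), setT; split => //; exact: openT.
Qed.

Let NI t A B : N t A -> N t B -> exists2 C, N t C & C `<=` A `&` B.
Proof.
case: t => [[a|y] st]; rewrite /N /=.
  by move=> -> ->; exists [set old a] => // z.
move=> [U [oU Uy ->]] [W [oW Wy ->]]; exists (hat (U `&` W)).
  by exists (U `&` W); split => //; exact: openI.
by case=> [[b|z] sz]; rewrite /hat /= => -[]; [move=> Pb [? ?]|].
Qed.

Let S : topologicalType := nbspace Nex NI.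

Let old_open a : open ([set old a] : set S).
Proof.
apply/nbspace_openE => t ->; exists [set old a] => //.
Qed.

Let hat_open O : open O -> open (hat O : set S).
Proof.
move=> oO; apply/nbspace_openE => -[[a|y] st] hO; rewrite /N /=.
  exists [set old a] => // _ ->; exact: hO.
by exists (hat O) => //; exists O.
Qed.

Let open_new (U : set S) y (ny : new y) : open U -> U (exist _ (inr y) ny) ->
  exists O, [/\ open O, O y & hat O `<=` U].
Proof.
move=> /nbspace_openE oU /oU; rewrite /N /= => -[A [ O [oO Oy ->]] AU].
by exists O.
Qed.

Let old_eq a st : (exist _ (inl a) st : T) = old a.
Proof. exact: sig_ext. Qed.

Let hat_avoid y a : new y -> exists O, [/\ open O, O y & ~ hat O (old a)].
Proof.
move=> ny; have [Pa|nPa] := pselect (P a); last first.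
  by exists setT; split => //; [exact: openT|case].
have yfa : y != f a by apply/eqP => e; apply: ny.2; rewrite e; exists a.
have [A [oA /set_mem Ay /set_mem nA]] := YT1 yfa.
by exists A; split => // -[].
Qed.

Let S_T1 : accessible_space S.
Proof.
move=> [[a|y] st] t /eqP nt.
  exists [set old a]; split; [exact: old_open|by apply/mem_set; exact: old_eq|].
  by apply/mem_set => ta; apply: nt; rewrite old_eq.
case: t nt => [[b|z] nz] nt.
  have [ O [oO Oy nO]] := hat_avoid b st.
  by exists (hat O); split; [exact: hat_open|exact/mem_set|apply/mem_set; rewrite old_eq].
have yz : y != z by apply/eqP => yz; apply: nt; apply: sig_ext => /=; rewrite yz.
have [A [oA /set_mem Ay /set_mem nA]] := YT1 yz.
by exists (hat A); split; [exact: hat_open|exact/mem_set|exact/mem_set].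
Qed.

Let S_T2 : hausdorff_space Y -> hausdorff_space S.
Proof.
rewrite !open_hausdorff => YT2.
have sep a y (ny : new y) : exists A B : set S, [/\ open A, open B, A (old a),
    B (exist _ (inr y) ny) & A `&` B = set0].
  have [ O [oO Oy nO]] := hat_avoid a ny.
  exists [set old a], (hat O); split; [exact: old_open|exact: hat_open|by []|by []|].
  by apply/seteqP; split => // t [/= -> /nO].
move=> [[a|y] st] [[b|z] sz] /eqP nt.
- exists ([set old a], [set old b]); rewrite /= ?old_eq.
    by split; apply/mem_set.
  split; [exact: old_open|exact: old_open|].
  by apply/eqP/seteqP; split => // t [/= -> ab]; apply: nt; rewrite !old_eq ab.
- have [A [B [oA oB Aa Bz AB]]] := sep a z sz; exists (A, B); rewrite /= ?old_eq.
    by split; apply/mem_set.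
  by split => //; apply/eqP.
- have [A [B [oA oB Ab By AB]]] := sep b y st; exists (B, A); rewrite /= ?old_eq.
    by split; apply/mem_set.
  by split => //; rewrite setIC; apply/eqP.
have yz : y != z by apply/eqP => yz; apply: nt; apply: sig_ext => /=; rewrite yz.
have [[A B] /= [/set_mem Ay /set_mem Bz] [oA oB /eqP AB]] := YT2 _ _ yz.
exists (hat A, hat B) => /=; first by split; apply/mem_set.
split; [exact: hat_open|exact: hat_open|apply/eqP/seteqP; split => // -[[c|w] sw]].
  by rewrite /hat /= => -[[Pc Ac] [_ Bc]]; have : (A `&` B) (f c) by []; rewrite AB.
by rewrite /hat /= => -[Aw Bw]; have : (A `&` B) w by []; rewrite AB.
Qed.

Let S_zd : zero_dim_space Y -> zero_dim_space S.
Proof.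
move=> Yzd t U; rewrite nbhsE => -[W [oW Wt] WU].
case: t Wt => [[a|y] st] Wt.
  exists [set old a]; split => //; first split; first exact: old_open.
  + rewrite -openC; apply/nbspace_openE => -[[b|z] sz] nz; rewrite /N /=.
      by exists [set old b] => // _ -> /= ba; apply: nz; rewrite old_eq.
    have [ O [oO Oz nO]] := hat_avoid a sz; exists (hat O); first by exists O.
    by move=> s hs sa; apply: nO; rewrite -sa.
  by move=> _ ->; apply: WU; rewrite -(old_eq st).
have [ O [oO Oy OW]] := open_new oW Wt.
have [V [[oV cV] Vy VO]] := Yzd y O (open_nbhs_nbhs (conj oO Oy)).
exists (hat V); split => //; first split; first exact: hat_open.
  rewrite -openC; apply/nbspace_openE => -[[b|z] sz] nz; rewrite /N /=.
    by exists [set old b] => // _ -> hb; apply: nz; rewrite old_eq.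
  exists (hat (~` V)); first by exists (~` V); split => //; exact: closed_openC.
  by case=> [[c|w] sw]; rewrite /hat /=; [move=> [_ nV] [_ /nV]|].
move=> s hs; apply/WU/OW; case: s hs => [[c|w] sw]; rewrite /hat /=; last exact: VO.
by move=> [Pc /VO].
Qed.

Let S_topsg : topsg (op : S -> S -> S).
Proof.
split; first by move=> r s t; apply: sig_ext; exact: op0A.
apply/mul_continuousP => -[[a|y] sa] [[b|z] sb] U oU Uab.
- exists [set old a], [set old b]; split; do ?exact: old_open; do ?exact: old_eq.
  by move=> _ _ -> ->; rewrite -(old_eq sa) -(old_eq sb).
- have [Pa|nPa] := pselect (P a); last first.
    exists [set old a], (hat setT); split; do ?exact: old_open; do ?exact: old_eq.
    + by apply: hat_open; exact: openT.
    + by [].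
    move=> _ t -> _; suff -> : op (old a) t = op (exist _ (inl a) sa) (exist _ (inr z) sb) by [].
    apply: sig_ext; case: t => [[c|w] sw]; rewrite /= !(asboolF nPa) //.
    by rewrite (zeroP c nPa).1.
  have nw : new (mul (f a) z) by have [] := new_mul sb (clD Pa).
  have [ O [oO Oaz OU]] : exists O, [/\ open O, O (mul (f a) z) & hat O `<=` U].
    apply: (@open_new U _ nw oU); move: Uab; congr U; apply: sig_ext => /=.
    by rewrite (asboolT Pa).
  have [A [B [oA Aa oB Bz AB]]] := mulC oO Oaz.
  exists [set old a], (hat B); split; do ?exact: old_open; do ?exact: old_eq; do ?exact: hat_open.
  + by [].
  move=> _ t -> ht; apply: OU; rewrite /hat /=; case: t ht => [[c|w] sw]; rewrite /hat /=.
    by move=> [Pc Bc]; have [Pac ->] := PM Pa Pc; split => //; exact: AB.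
  by rewrite (asboolT Pa) => Bw; exact: AB.
- have [Pb|nPb] := pselect (P b); last first.
    exists (hat setT), [set old b]; split; do ?exact: old_open; do ?exact: old_eq.
    + by apply: hat_open; exact: openT.
    + by [].
    move=> t _ _ ->; suff -> : op t (old b) = op (exist _ (inr y) sa) (exist _ (inl b) sb) by [].
    apply: sig_ext; case: t => [[c|w] sw]; rewrite /= !(asboolF nPb) //.
    by rewrite (zeroP c nPb).2.
  have nw : new (mul y (f b)) by have [] := new_mul sa (clD Pb).
  have [ O [oO Oyb OU]] : exists O, [/\ open O, O (mul y (f b)) & hat O `<=` U].
    apply: (@open_new U _ nw oU); move: Uab; congr U; apply: sig_ext => /=.
    by rewrite (asboolT Pb).
  have [A [B [oA Ay oB Bb AB]]] := mulC oO Oyb.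
  exists (hat A), [set old b]; split; do ?exact: old_open; do ?exact: old_eq; do ?exact: hat_open.
  + by [].
  move=> t _ ht ->; apply: OU; rewrite /hat /=; case: t ht => [[c|w] sw]; rewrite /hat /=.
    by move=> [Pc Ac]; have [Pcb ->] := PM Pc Pb; split => //; exact: AB.
  by rewrite (asboolT Pb) => Aw; exact: AB.
have nw : new (mul y z) by have [] := new_mul sa sb.1.
have [ O [oO Oyz OU]] : exists O, [/\ open O, O (mul y z) & hat O `<=` U].
  by apply: (@open_new U _ nw oU); move: Uab; congr U; exact: sig_ext.
have [A [B [oA Ay oB Bz AB]]] := mulC oO Oyz.
exists (hat A), (hat B); split; do ?exact: hat_open; do ?by [].
move=> s t hs ht; apply: OU; case: s t hs ht => [[c|u] su] [[d|w] sw]; rewrite /hat /=.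
- by move=> [Pc Ac] [Pd Bd]; have [Pcd ->] := PM Pc Pd; split => //; exact: AB.
- by move=> [Pc Ac] Bw; rewrite (asboolT Pc); exact: AB.
- by move=> Au [Pd Bd]; rewrite (asboolT Pd); exact: AB.
- by move=> Au Bw; exact: AB.
Qed.

Let S_class : in_class i (op : S -> S -> S).
Proof.
split; first exact: S_topsg.
case: i Y_class => -[_ H] //; first exact: S_T2.
have zd := S_zd H.2; split => //; exact: zero_dim_tychonoff.
Qed.

Lemma discrete_extension_closed : C_closed i R -> closed D.
Proof.
move=> cR y cy; apply: contrapT => nDy; have ny : new y by [].
have : range old (exist _ (inr y) ny); last by case.
apply: (cR S op old S_class).
- by move=> a b; exact: sig_ext.
- by move=> a b [].
- move=> _ [a _ <-]; exists [set old a]; split; first exact: old_open.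
  by apply/seteqP; split => [t []//|t /= ->]; split => //; exists a.
apply/closure_openP => U oU Uy; have [ O [oO Oy OU]] := open_new oU Uy.
have [_ [[a Pa <-] Oa]] := (closure_openP _ _).1 cy _ oO Oy.
by exists (old a); split; [exists a|apply: OU].
Qed.

End DiscreteExtension.

(** * Adjoining an isolated zero *)

Section AdjoinZero.
Variables (i : sep_class) (Y : topologicalType) (mul : Y -> Y -> Y).
Hypothesis Y_class : in_class i mul.

Definition opt_mul (s t : option Y) : option Y :=
  match s, t with Some x, Some y => Some (mul x y) | _, _ => None end.

Let N (t : option Y) : set (set (option Y)) := match t with
  | None => [set [set None]]
  | Some y => [set A | exists O, [/\ open O, O y & A = Some @` O]] end.

Let Nex t : exists A, N t A.
Proof.
case: t => [y|]; last by exists [set None].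
by exists (Some @` setT), setT; split => //; exact: openT.
Qed.

Let NI t A B : N t A -> N t B -> exists2 C, N t C & C `<=` A `&` B.
Proof.
case: t => [y|] /=; last by move=> -> ->; exists [set None] => // z.
move=> [U [oU Uy ->]] [W [oW Wy ->]]; exists (Some @` (U `&` W)).
  by exists (U `&` W); split => //; exact: openI.
by move=> _ [z [Uz Wz] <-]; split; exists z.
Qed.

Let S : topologicalType := nbspace Nex NI.

Let None_open : open ([set None] : set S).
Proof. by apply/nbspace_openE => t ->; exists [set None]. Qed.

Let Some_open (O : set Y) : open O -> open (Some @` O : set S).
Proof.
by move=> oO; apply/nbspace_openE => _ [y Oy <-]; exists (Some @` O) => //; exists O.
Qed.

Let open_Some (U : set S) y : open U -> U (Some y) ->
  exists O, [/\ open O, O y & Some @` O `<=` U].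
Proof. by move=> /nbspace_openE oU /oU [A [ O [oO Oy ->]] AU]; exists O. Qed.

Let S_T1 : accessible_space S.
Proof.
have YT1 := in_class_T1 Y_class.
move=> [y|] [z|] // /eqP nt.
- have yz : y != z by apply/eqP => yz; apply: nt; rewrite yz.
  have [A [oA /set_mem Ay /set_mem nA]] := YT1 _ _ yz.
  exists (Some @` A); split; [exact: Some_open|by apply/mem_set; exists y|].
  by apply/mem_set => -[w Aw [wz]]; apply: nA; rewrite -wz.
- exists (Some @` setT); split; [by apply: Some_open; exact: openT|by apply/mem_set; exists y|].
  by apply/mem_set => -[].
- by exists [set None]; split => //; apply/mem_set.
by case: nt.
Qed.

Let S_T2 : hausdorff_space Y -> hausdorff_space S.
Proof.
rewrite !open_hausdorff => YT2 [y|] [z|] // /eqP nt.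
- have yz : y != z by apply/eqP => yz; apply: nt; rewrite yz.
  have [[A B] /= [/set_mem Ay /set_mem Bz] [oA oB /eqP AB]] := YT2 _ _ yz.
  exists (Some @` A, Some @` B) => /=; first by split; apply/mem_set; [exists y|exists z].
  split; [exact: Some_open|exact: Some_open|apply/eqP/seteqP; split => // _ [[w Aw <-] [v Bv [vw]]]].
  by suff : (A `&` B) w by [rewrite AB]; split => //; rewrite -vw.
- exists (Some @` setT, [set None]) => /=.
    by split; apply/mem_set; [exists y|].
  split; [by apply: Some_open; exact: openT|exact: None_open|].
  by apply/eqP/seteqP; split => // _ [[w _ <-]].
- exists ([set None], Some @` setT) => /=.
    by split; apply/mem_set; [|exists z].
  split; [exact: None_open|by apply: Some_open; exact: openT|].
  by apply/eqP/seteqP; split => // _ [-> [w _]].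
by case: nt.
Qed.

Let S_zd : zero_dim_space Y -> zero_dim_space S.
Proof.
have copen (V : set S) : (forall y, ~ V (Some y) -> exists O, [/\ open O, O y &
    forall z, O z -> ~ V (Some z)]) -> closed V.
  move=> H; rewrite -openC; apply/nbspace_openE => -[y|] nV /=; last first.
    by exists [set None] => // _ ->.
  have [ O [oO Oy nO]] := H _ nV; exists (Some @` O); first by exists O.
  by move=> _ [z Oz <-]; exact: nO.
move=> Yzd t U; rewrite nbhsE => -[W [oW Wt] WU].
case: t Wt => [y|] Wt.
  have [ O [oO Oy OW]] := open_Some oW Wt.
  have [V [[oV cV] Vy VO]] := Yzd y O (open_nbhs_nbhs (conj oO Oy)).
  exists (Some @` V); split; [split; first exact: Some_open|by exists y|].
    apply: copen => z nVz; exists (~` V); split; first exact: closed_openC.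
      by move=> Vz; apply: nVz; exists z.
    by move=> w nVw [v Vv [vw]]; apply: nVw; rewrite -vw.
  by move=> _ [v /VO Ov <-]; apply/WU/OW; exists v.
exists [set None]; split => //; last by move=> _ ->; exact: WU.
split; first exact: None_open.
by apply: copen => y _; exists setT; split => //; exact: openT.
Qed.

Let S_topsg : topsg (opt_mul : S -> S -> S).
Proof.
have [[mulA mc] _] := Y_class; split.
  by move=> [x|] [y|] [z|] //=; rewrite mulA.
move/mul_continuousP: mc => mc; apply/mul_continuousP => -[y|] [z|] U oU Uyz.
- have [ O [oO Oyz OU]] := open_Some oU Uyz.
  have [A [B [oA Ay oB Bz AB]]] := mc _ _ _ oO Oyz.
  exists (Some @` A), (Some @` B); split; do ?exact: Some_open; [by exists y|by exists z|].
  by move=> _ _ [a Aa <-] [b Bb <-]; apply: OU; exists (mul a b) => //; exact: AB.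
- exists setT, [set None]; split => //; [exact: openT|].
  by move=> [w|] _ _ ->.
- by exists [set None], setT; split => //; [exact: openT|move=> _ t ->].
- by exists [set None], setT; split => //; [exact: openT|move=> _ t ->].
Qed.

Let S_class : in_class i (opt_mul : S -> S -> S).
Proof.
split; first exact: S_topsg.
case: i Y_class => -[_ H] //; first exact: S_T2.
have zd := S_zd H.2; split => //; exact: zero_dim_tychonoff.
Qed.

(** The zero [None] is isolated, so limits in [Y] of the defined values are limits of the whole
    image. *)
Lemma partial_hom_closed (X : semigroup) (h : X -> option Y) :
  abs_C_closed i X -> is_hom opt_mul h -> closed [set y | exists x, h x = Some y].
Proof.
move=> cX homh y cy.
suff [x _ hx] : range (h : X -> S) (Some y) by exists x.
apply: (cX S opt_mul h S_class homh); apply/closure_openP => U oU Uy.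
have [ O [oO Oy OU]] := open_Some oU Uy.
have [z [[x hx] Oz]] := (closure_openP _ _).1 cy _ oO Oy.
by exists (Some z); split; [exists x|apply: OU; exists z].
Qed.

End AdjoinZero.

(** Closedness of the semigroup itself is recovered from the quotient by equality or by the empty
    ideal. *)
Lemma trivial_quotient_closed (i : sep_class) (S : semigroup) (Rel : S -> S -> Prop)
    (HR : congruence Rel) : (forall x y, Rel x y -> x = y) ->
  C_closed i (quotient_sg HR) -> C_closed i S.
Proof.
move=> Rel_eq qS Y mul h Y_class hom_h h_inj h_disc.
have repE a : qrep (qcls Rel a) = a by rewrite -(Rel_eq _ _ (qrepR HR a)).
have rh : range (fun q : quotient_sg HR => h (qrep q)) = range h.
  apply/seteqP; split=> [_ [q _ <-]|_ [a _ <-]]; first by exists (qrep q).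
  by exists (qcls Rel a) => //; rewrite repE.
rewrite -rh; apply: (qS Y mul _ Y_class); rewrite ?rh //.
  move=> a b; rewrite -hom_h; congr h.
  by rewrite -[sg_op a b]/(qcls Rel (sg_op (qrep a) (qrep b))) repE.
by move=> a b /h_inj ab; rewrite -(qcls_rep a) -(qcls_rep b) ab.
Qed.

Lemma proj_C_closed_C_closed (i : sep_class) (S : semigroup) :
  proj_C_closed i S -> C_closed i S.
Proof.
have ceq : congruence (fun x y : S => x = y).
  by split => [//|x y -> //|x y z -> //|x y z ->].
by move=> pS; apply: (@trivial_quotient_closed i S _ ceq) => //; exact: pS.
Qed.

Lemma ideal_C_closed_C_closed (i : sep_class) (S : semigroup) :
  ideal_C_closed i S -> C_closed i S.
Proof.
have I0 : is_ideal (set0 : set S) by [].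
move=> iS; apply: (@trivial_quotient_closed i S _ (rees_congruence I0)); last exact: iS.
by move=> x y [//|[]].
Qed.

(** * The retraction onto the maximal subgroup *)

Section Viable.
Variables (X : semigroup) (e : X).
Local Notation "x * y" := (sg_op x y).
Hypothesis ve : viable e.

Definition viable_part : set X := [set x | x * e = e * x /\ Hmax e (x * e)].

Lemma viable_ideal : is_ideal (~` viable_part).
Proof. exact: ve.2. Qed.

(** Viability gives the forward direction, and xye = (xe)(ye) the converse. So collapsing the
    complement yields a semigroup with zero whose nonzero elements are closed under products. *)
Lemma viable_partM x y : viable_part (x * y) <-> viable_part x /\ viable_part y.
Proof.
split=> [Pxy|[[xe Hx] [ye Hy]]].
  by split; apply: contrapT => nP; [have [] := viable_ideal y nP|have [] := viable_ideal x nP].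
have E : x * y * e = (x * e) * (y * e).
  by rewrite -!sg_opA; congr (_ * _); rewrite ye sg_opA ve.1.
by split; [rewrite -sg_opA ye sg_opA xe -sg_opA|rewrite E; exact: Hmax_closed ve.1 Hx Hy].
Qed.

Lemma viable_partMe x y : viable_part y -> x * y * e = (x * e) * (y * e).
Proof. by move=> [ye _]; rewrite -!sg_opA; congr (_ * _); rewrite ye sg_opA ve.1. Qed.

Lemma Hmax_unit : Hmax e e.
Proof.
exists (Kset e); split; [exact: K_subgroup ve.1| |]; split; rewrite ?ve.1 //;
  by exists e; rewrite !ve.1.
Qed.

Local Notation H := (Hsg ve.1).

Definition H_unit : H := exist _ e Hmax_unit.

Lemma Hmax_id x : Hmax e x -> e * x = x /\ x * e = x.
Proof. by move=> /(Hmax_K ve.1) []. Qed.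

Lemma viable_part_Hmax x : Hmax e x -> viable_part x.
Proof. by move=> Hx; have [ex xe] := Hmax_id Hx; split; rewrite xe ?ex. Qed.

(** On the viable part this is the homomorphism x -> xe, the identity on H_e; elsewhere the unit
    serves as a default. *)
Definition retract (x : X) : H :=
  if pselect (viable_part x) is left Px then exist _ (x * e) Px.2 else H_unit.

Lemma retractE x : viable_part x -> proj1_sig (retract x) = x * e.
Proof. by rewrite /retract; case: pselect. Qed.

Lemma retractM x y : viable_part x -> viable_part y ->
  retract (x * y) = sg_op (retract x) (retract y).
Proof.
move=> Px Py; apply: sig_ext; rewrite /= !retractE //; last exact/viable_partM.
exact: viable_partMe.
Qed.

Lemma retract_id (u : H) : retract (proj1_sig u) = u.
Proof.
have Pu := viable_part_Hmax (proj2_sig u); apply: sig_ext; rewrite retractE //.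
exact: (Hmax_id (proj2_sig u)).2.
Qed.

Lemma H_mul1 (u : H) : sg_op H_unit u = u.
Proof. by apply: sig_ext; exact: (Hmax_id (proj2_sig u)).1. Qed.

Lemma H_mulr1 (u : H) : sg_op u H_unit = u.
Proof. by apply: sig_ext; exact: (Hmax_id (proj2_sig u)).2. Qed.

Lemma H_inv (u : H) : exists w : H, sg_op u w = H_unit /\ sg_op w u = H_unit.
Proof.
have [eu ue [y [ey ye uy yu]]] := Hmax_K ve.1 (proj2_sig u).
have Hy : Hmax e y.
  exists (Kset e); split; first exact: K_subgroup ve.1.
    by apply: (Hmax_K ve.1); exact: Hmax_unit.
  by split => //; exists (proj1_sig u).
by exists (exist _ y Hy); split; apply: sig_ext.
Qed.

Lemma H_center_subgroup : is_subgroup (sg_center H).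
Proof.
split; first by exists H_unit => u; rewrite H_mul1 H_mulr1.
split; first by move=> u w; exact: centerM.
exists H_unit; split; first by move=> u; rewrite H_mul1 H_mulr1.
  by move=> u _; rewrite H_mul1 H_mulr1.
move=> u Zu; have [w [uw wu]] := H_inv u; exists w; split => // x.
by rewrite -[LHS]H_mul1 -wu -sg_opA (sg_opA u) -Zu -(sg_opA x) uw H_mulr1.
Qed.

Lemma H_quotient_closed (i : sep_class) : ideal_C_closed i X -> proj_C_closed i H.
Proof.
move=> iX Rel HR Y mul h Y_class hom_h h_inj h_disc.
pose R := rees_quotient viable_ideal.
have cR : C_closed i R := iX _ viable_ideal.
pose I := ~` viable_part.
have crees := rees_congruence viable_ideal.
pose P : set R := [set q | viable_part (qrep q)].
pose f (q : R) : Y := h (qcls Rel (retract (qrep q))).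
have repP a : viable_part a -> qrep (qcls (rees_rel I) a) = a.
  by move=> Pa; case: (qrepR crees a) => [<- //|[/(_ Pa)]].
have repN a : ~ viable_part a -> ~ viable_part (qrep (qcls (rees_rel I) a)).
  by move=> nPa; case: (qrepR crees a) => [<- //|[_]].
have RM (a b : R) : sg_op a b = qcls (rees_rel I) (qrep a * qrep b) by [].
have fP : [set f q | q in P] = range h.
  apply/seteqP; split=> [_ [q Pq <-]|_ [u _ <-]].
    by exists (qcls Rel (retract (qrep q))).
  have Pu := viable_part_Hmax (proj2_sig (qrep u)).
  exists (qcls (rees_rel I) (proj1_sig (qrep u))); first by rewrite /P /= repP.
  by rewrite /f repP // retract_id qcls_rep.
have qM (u w : H) : sg_op (qcls Rel u : quotient_sg HR) (qcls Rel w) = qcls Rel (sg_op u w).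
  exact: (qop_cls HR).
(* Quotients of groups are cancellative, as the extension by limit points demands. *)
have cancelq (a b c : quotient_sg HR) :
    (sg_op a b = sg_op a c -> b = c) /\ (sg_op b a = sg_op c a -> b = c).
  rewrite -(qcls_rep a) -(qcls_rep b) -(qcls_rep c) !qM.
  move: (qrep a) (qrep b) (qrep c) => u v w; have [u' [uu' u'u]] := H_inv u.
  split=> [/(congr1 (sg_op (qcls Rel u' : quotient_sg HR)))|
           /(congr1 (fun z : quotient_sg HR => sg_op z (qcls Rel u' : quotient_sg HR)))].
    by rewrite !qM !sg_opA u'u !H_mul1.
  by rewrite !qM -!sg_opA uu' !H_mulr1.
rewrite -fP; apply: (@discrete_extension_closed i R P Y mul f Y_class) => //.
- move=> a b Pa Pb; have Pab : viable_part (qrep a * qrep b) by apply/viable_partM.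
  rewrite RM /P /f /= repP //; split => //.
  by rewrite retractM // -qM hom_h.
- move=> a b nPa; rewrite -(qcls_rep a) -(qcls_rep b).
  have E u v : sg_op (qcls (rees_rel I) u : R) (qcls (rees_rel I) v) = qcls (rees_rel I) (u * v).
    exact: (qop_cls crees).
  rewrite !E; split; apply: (qcls_eq crees); right; split => //.
    by move=> /viable_partM [].
  by move=> /viable_partM [].
- by rewrite fP.
rewrite fP => _ _ _ [a _ <-] [b _ <-] [c _ <-]; rewrite -!hom_h.
by split=> /h_inj E; congr h; [exact: (cancelq a b c).1|exact: (cancelq a b c).2].
Qed.

Import GRing.Theory.

(** In a group every element is invertible, so all orbits are free. *)
Lemma H_center_bounded : C_closed Tzc H -> sg_bounded (sg_center H).
Proof.
move=> cH; have [V [io [ioD io_inj ioG]]] :=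
  central_subgroup_zmod H_center_subgroup (fun x h => h).
have ioZ v : sg_center H (io v) by rewrite -ioG; exists v.
rewrite -ioG; suff [n n0 Vn] : exists2 n, (0 < n)%N & forall v : V, (v *+ n = 0)%R.
  exact: zmod_sg_bounded Vn.
apply: (@central_group_bounded H V io (fun=> [set 0%R]) cH) => //.
move=> t; right; exists 0%N => _ v _ tv; apply: io_inj.
have [w [_ wt]] := H_inv t.
by rewrite -[LHS]H_mul1 -[RHS]H_mul1 -wt -!sg_opA tv.
Qed.

Lemma H_closed (i : sep_class) : abs_C_closed i X -> abs_C_closed i H.
Proof.
move=> aX Y mul h Y_class hom_h.
pose g x := if `[< viable_part x >] then Some (h (retract x)) else None.
have homg : is_hom (opt_mul mul) g.
  move=> a b; rewrite /g; case: (asboolP (viable_part (a * b))) => [/viable_partM [Pa Pb]|nP].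
    by rewrite !asboolT //= retractM // hom_h.
  case: asboolP => Pa; case: asboolP => Pb //.
  by case: nP; apply/viable_partM.
have -> : range h = [set y | exists x, g x = Some y].
  apply/seteqP; split=> [_ [u _ <-]|y [x]].
    exists (proj1_sig u); rewrite /g asboolT ?retract_id //.
    exact: viable_part_Hmax (proj2_sig u).
  by rewrite /g; case: asboolP => // _ [<-]; exists (retract x).
exact: (partial_hom_closed Y_class aX homg).
Qed.

Lemma H_center_finite (i : sep_class) : abs_C_closed i H -> finite_set (sg_center H).
Proof.
move=> aH; apply: (center_group_finite (X := H)) => //; last exact: H_center_subgroup.
by right=> Y mul h /(in_class_Tz i) Y_class hom_h _; exact: aH Y_class hom_h.
Qed.

End Viable.

(** * Roots of viable idempotents *)

Section UltrafilterSelection.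
Variables (T : Type) (U : set (set T)).
Hypothesis UU : UltraFilter U.
Hypothesis U_free : forall B, finite_set B -> U (~` B).

Lemma ultra_finite_fiber (T' : Type) (f : T -> T') (F : set T') : finite_set F ->
  U [set y | F (f y)] -> exists2 c, F c & U [set y | f y = c].
Proof.
move=> /(@finite_seqP {classic T'}) [s ->]; elim: s => [|c s IH] UF.
  by have [y] := filter_ex UF.
have [Uc|Unc] := in_ultra_setVsetC [set y | f y = c] UU.
  by exists c => //=; rewrite inE eqxx.
have [|d ds Ud] := IH.
  apply: filterS (filterI UF Unc) => y [/=]; rewrite inE => /predU1P[//|].
  by [].
by exists d => //=; rewrite inE ds orbT.
Qed.

(** Each new term is taken from the intersection of finitely many members of [U]; freeness keeps it
    different from the previous terms. *)
Lemma ultra_sequence (S : set T) (R : T -> T -> Prop) : U S ->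
  (forall x, S x -> U [set y | R x y]) ->
  exists s : nat -> T, (forall n, S (s n)) /\
    forall i j, (i < j)%N -> R (s i) (s j) /\ s i <> s j.
Proof.
move=> US SR.
have /choice [f fP] (l : seq T) : exists x, S x /\ List.Forall (fun y => S y -> R y x /\ y <> x) l.
  suff H : U [set x | S x /\ List.Forall (fun y => S y -> R y x /\ y <> x) l].
    by have [x] := filter_ex H; exists x.
  elim: l => [|y l IH]; first by apply: filterS US => x Sx; split => //; constructor.
  have Uy : U [set x | S y -> R y x /\ y <> x].
    have [Sy|nSy] := pselect (S y); last by apply: filterS US => x _ /nSy.
    by apply: filterS (filterI (SR y Sy) (U_free (finite_set1 y))) => x [Rx nx] _;
      split => // yx; apply: nx.
  by apply: filterS (filterI IH Uy) => x [[Sx lx] yx]; split => //; constructor.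
pose L := fix L n : seq T := if n is n'.+1 then f (L n') :: L n' else [::].
exists (fun n => f (L n)); split => [n|i j ij]; first by have [] := fP (L n).
have Lij : List.In (f (L i)) (L j).
  elim: j ij => // j IH; rewrite ltnS leq_eqVlt => /predU1P[->|/IH]; first by left.
  by right.
have [_ /List.Forall_forall /(_ _ Lij)] := fP (L j).
by apply; have [] := fP (L i).
Qed.

End UltrafilterSelection.

(** * Central nil elements modulo an ideal *)

Section NilElements.
Variable X : semigroup.
Local Notation "x * y" := (sg_op x y).
Hypothesis iX : ideal_C_closed Tzc X.
Implicit Types (J B : set X).

(** One-sided multiples suffice because [B] will be central. *)
Definition ideal_gen J B : set X :=
  [set x | J x \/ exists2 b, B b & exists w : adj1 X,
    (Some x : adj1 X) = sg_op (Some b : adj1 X) w].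

Lemma ideal_gen_ideal J B : is_ideal J -> B `<=` sg_center X -> is_ideal (ideal_gen J B).
Proof.
move=> HJ BZ x y [Jx|[b Bb [w xw]]].
  by have [? ?] := HJ x y Jx; split; left.
have Zb := adj1_center_Some (BZ b Bb).
split; right; exists b => //.
  by exists (sg_op w (Some y : adj1 X)); rewrite sg_opA -xw.
exists (sg_op (Some y : adj1 X) w).
by rewrite sg_opA -(Zb (Some y)) -sg_opA -xw.
Qed.

Lemma ideal_mul_adj1 J j z (w : adj1 X) : is_ideal J -> J j ->
  (Some z : adj1 X) = sg_op (Some j : adj1 X) w -> J z.
Proof.
by move=> HJ Jj; case: w => [w|] [->] //; have [] := HJ _ w Jj.
Qed.

(** In the Rees quotient by [J] all products of elements of [B] are zero, and [B] maps injectively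
    to it. *)
Lemma ideal_nonsingular J B : is_ideal J -> B `<=` sg_center X ->
  (forall x, B x -> ~ J x) -> (forall x y, B x -> B y -> J (x * y)) -> finite_set B.
Proof.
move=> HJ BZ nBJ BBJ; have [->|/set0P [b Bb]] := eqVneq B set0; first exact: finite_set0.
have crees := rees_congruence HJ.
have qM x y : sg_op (qcls (rees_rel J) x : rees_quotient HJ) (qcls (rees_rel J) y) =
    qcls (rees_rel J) (x * y) by exact: (qop_cls crees).
pose A : set (rees_quotient HJ) := [set qcls (rees_rel J) x | x in B].
have fA : finite_set A.
  apply: (@nonsingular (rees_quotient HJ) A (qcls (rees_rel J) (b * b)) (@iX J HJ)).
    by move=> _ [x Bx <-] q; rewrite -(qcls_rep q) !qM (BZ x Bx).
  move=> _ _ [x Bx <-] [y By <-]; rewrite qM; apply: (qcls_eq crees).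
  by right; split; exact: BBJ.
apply: sub_finite_set (finite_image (fun q : rees_quotient HJ => qrep q) fA) => x Bx.
exists (qcls (rees_rel J) x); first by exists x.
by case: (qrepR crees x) => [<- //|[/(nBJ x Bx)]].
Qed.

Definition square_zero J : set X := [set x | [/\ sg_center X x, ~ J x & J (x * x)]].

Lemma multiples_square J q x y (v w : adj1 X) : is_ideal J -> sg_center X q -> J (q * q) ->
  (Some x : adj1 X) = sg_op (Some q : adj1 X) v ->
  (Some y : adj1 X) = sg_op (Some q : adj1 X) w -> J (x * y).
Proof.
move=> HJ Zq Jqq xv yw; apply: (@ideal_mul_adj1 J (q * q) (x * y) (sg_op v w) HJ Jqq).
have Zq' := adj1_center_Some Zq.
rewrite -sg_op_Some xv yw -sg_op_Some -!sg_opA; congr (sg_op _ _).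
by rewrite !sg_opA; congr (sg_op _ _); exact: Zq'.
Qed.

Lemma finite_multiples J q : is_ideal J -> sg_center X q -> J (q * q) ->
  finite_set [set x | [/\ sg_center X x, ~ J x &
    exists w : adj1 X, (Some x : adj1 X) = sg_op (Some q : adj1 X) w]].
Proof.
move=> HJ Zq Jqq; apply: (ideal_nonsingular HJ).
- by move=> x [].
- by move=> x [].
by move=> x y [_ _ [v xv]] [_ _ [w yw]]; exact: multiples_square xv yw.
Qed.

Lemma injective_range_infinite (T : Type) (s : nat -> T) (F : set T) :
  (forall i j, (i < j)%N -> s i <> s j) -> finite_set F -> (forall n, F (s n)) -> False.
Proof.
move=> s_inj /pigeonhole [B HB] Fs; have [i [j [ij _ sij]]] := HB s Fs.
exact: s_inj ij sij.
Qed.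

(* Otherwise take a free ultrafilter U containing the set. For almost all y, the product x * y
   is either in J or equal to a constant c x outside of J; the c x have products in J, so there
   are finitely many of them, and adding one of them to J puts x * y in J for almost all y. A
   sequence with all pairwise products in J then contradicts [ideal_nonsingular]. *)
Lemma finite_square_zero J : is_ideal J -> finite_set (square_zero J).
Proof.
move=> HJ; apply: contrapT => iQ.
have [U [UU UQ U_free]] := free_ultrafilter iQ.
have pairwise J1 (S : set X) : is_ideal J1 -> J `<=` J1 -> S `<=` square_zero J -> U S ->
    (forall x, S x -> ~ J1 x) -> (forall x, S x -> U [set y | J1 (x * y)]) -> False.
  move=> HJ1 JJ1 SQ US nSJ1 SJ1.
  have [s [Ss sP]] := ultra_sequence UU U_free US SJ1.
  have fB : finite_set (range s).
    apply: (ideal_nonsingular HJ1).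
    - by move=> _ [n _ <-]; have [] := SQ _ (Ss n).
    - by move=> _ [n _ <-]; exact: nSJ1.
    move=> _ _ [n _ <-] [m _ <-]; have [nm|mn|->] := ltngtP n m.
    - by have [] := sP _ _ nm.
    - have [Zn _ _] := SQ _ (Ss n); rewrite -Zn; by have [] := sP _ _ mn.
    - by apply: JJ1; have [] := SQ _ (Ss m).
  apply: (injective_range_infinite (s := s) _ fB) => [i j ij|n]; last by exists n.
  by have [] := sP _ _ ij.
have [UJ|UnJ] := in_ultra_setVsetC [set x | U [set y | J (x * y)]] UU.
  apply: (pairwise J (square_zero J `&` [set x | U [set y | J (x * y)]])) => //.
  - exact: filterI UQ UJ.
  - by move=> x [[]].
  - by move=> x [].
pose T := square_zero J `&` ~` [set x | U [set y | J (x * y)]].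
have UT : U T by exact: filterI UQ UnJ.
have /choice [c cP] x : exists c, T x -> U [set y | x * y = c] /\ ~ J c.
  have [[Qx nx]|nTx] := pselect (T x); last by exists x.
  have [Zx _ Jxx] := Qx.
  suff Ux : U [set y | [/\ sg_center X (x * y), ~ J (x * y) &
      exists w : adj1 X, (Some (x * y) : adj1 X) = sg_op (Some x : adj1 X) w]].
    have [c [_ nJc _] Uc] := ultra_finite_fiber UU (f := fun y => x * y)
      (finite_multiples HJ Zx Jxx) Ux.
    by exists c.
  have [//|Un] := in_ultra_setVsetC [set y | J (x * y)] UU.
  apply: filterS (filterI UQ Un) => y [[Zy _ _] nJ]; split => //; first exact: centerM.
  by exists (Some y).
have cprod x y : T x -> T y -> J (c x * c y).
  move=> Tx Ty; have [Ux _] := cP x Tx; have [Uy _] := cP y Ty.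
  (* A common [z] realizes both constants, so their product contains the factor z z, which is in
     J. *)
  have [z [[xz yz] Qz]] := proper_meets _ (filterI Ux Uy) UQ.
  rewrite /= in xz yz; rewrite -xz -yz.
  have [[[Zx _ _] _] [Zz _ Jzz]] := (Tx, Qz).
  have -> : x * z * (y * z) = (z * z) * (x * y).
    by rewrite (Zz x) (Zz y) -!sg_opA; congr (_ * _); rewrite sg_opA (Zz x) -sg_opA.
  by have [] := HJ _ (x * y) Jzz.
have cZ x : T x -> sg_center X (c x).
  move=> Tx; have [Ux _] := cP x Tx; have [z [xz [Zz _ _]]] := proper_meets _ Ux UQ.
  by rewrite /= in xz; rewrite -xz; apply: centerM => //; case: Tx => -[].
have fG : finite_set [set c x | x in T].
  apply: (ideal_nonsingular HJ).
  - by move=> _ [x Tx <-]; exact: cZ.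
  - by move=> _ [x Tx <-]; have [] := cP x Tx.
  - by move=> _ _ [x Tx <-] [y Ty <-]; exact: cprod.
have [c0 [x0 Tx0 cx0] Uc0] : exists2 c0, [set c x | x in T] c0 & U [set x | c x = c0].
  by apply: ultra_finite_fiber => //; apply: filterS UT => x Tx; exists x.
have Zc0 : sg_center X c0 by rewrite -cx0; exact: cZ.
have Jc0 : J (c0 * c0) by rewrite -cx0; exact: cprod.
have HJ1 : is_ideal (ideal_gen J [set c0]) by apply: ideal_gen_ideal => // _ ->.
have fD := finite_multiples HJ Zc0 Jc0.
(* Removing the finitely many multiples of [c0] keeps the selected elements outside the enlarged
   ideal. *)
apply: (pairwise (ideal_gen J [set c0]) (T `&` ([set x | c x = c0] `&`
  ~` [set x | [/\ sg_center X x, ~ J x & exists w : adj1 X,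
       (Some x : adj1 X) = sg_op (Some c0 : adj1 X) w]]))) => //.
- by move=> x; left.
- by move=> x [[]].
- by apply: filterI => //; apply: filterI => //; exact: U_free.
- move=> x [[[Zx nJx _] _] [_ nD]] [//|[_ -> xw]]; apply: nD; split => //.
move=> x [Tx [cx _]]; have [Ux _] := cP x Tx; apply: filterS Ux => y /= xy.
by right; exists c0 => //; exists None; rewrite sg_opx1 xy cx.
Qed.

(* Replacing J by the ideal generated by J and [square_zero J] decreases the degree. *)
Lemma finite_nil_bounded J d : is_ideal J ->
  finite_set [set x | [/\ sg_center X x, ~ J x & J (xpow x d.+1)]].
Proof.
elim: d J => [|d IH] J HJ.
  by apply: (sub_finite_set _ (finite_set0 X)) => x [_ nJ]; exact: nJ.
have QZ : square_zero J `<=` sg_center X by move=> x [].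
have HJ' := ideal_gen_ideal HJ QZ.
have fQ := finite_square_zero HJ.
apply: (@sub_finite_set _ _ ([set x | [/\ sg_center X x, ~ ideal_gen J (square_zero J) x &
    ideal_gen J (square_zero J) (xpow x d.+1)]] `|` square_zero J)); last first.
  by rewrite finite_setU; split => //; exact: IH.
move=> x [Zx nJx Jxd].
have [[//|[q [Zq nq Jqq] [w xw]]]|nJ'x] := pselect (ideal_gen J (square_zero J) x).
  by right; split => //; exact: (multiples_square HJ Zq Jqq xw xw).
left; split => //; have [Jd|nJd] := pselect (J (xpow x d.+1)); first by left.
right; exists (xpow x d.+1); last by exists None; rewrite sg_opx1.
split => //; first exact: xpow_center.
(* The exponent 2d + 2 is at least d + 2; equality holds for d = 0, treated apart as there is no
   power with exponent 0. *)
rewrite -xpowD // -(subnKC (_ : d.+2 <= d.+1 + d.+1)%N); last by lia.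
have [d0|d0] := posnP d; first by move: Jxd; rewrite d0.
by rewrite xpowD ?subn_gt0; [have [] := HJ _ (xpow x (d.+1 + d.+1 - d.+2)%N) Jxd| |lia].
Qed.

(* If x^n is the first power of x in J, then the powers x^j with n/2 <= j < n are
   distinct elements of the finite set [square_zero J]. *)
Lemma finite_nil J : is_ideal J ->
  finite_set [set x | [/\ sg_center X x, ~ J x & exists2 n, (0 < n)%N & J (xpow x n)]].
Proof.
move=> HJ; have [B HB] := pigeonhole (finite_square_zero HJ).
apply: sub_finite_set (finite_nil_bounded (B + B).+1 HJ) => x [Zx nJx [m m0 Jm]].
split => //.
have exn : exists n, (0 < n)%N && `[< J (xpow x n) >] by exists m; rewrite m0 asboolT.
case: (ex_minnP exn) => n /andP[n0 /asboolP Jn] nmin.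
have Jup k : (n <= k)%N -> J (xpow x k).
  move=> nk; rewrite -(subnKC nk); have [->|kn] := posnP (k - n); first by rewrite addn0.
  by rewrite xpowD //; have [] := HJ _ (xpow x (k - n)) Jn.
have nJlt k : (0 < k < n)%N -> ~ J (xpow x k).
  move=> /andP[k0 kn] Jk; have := nmin k; rewrite k0 asboolT // => /(_ isT).
  by rewrite leqNgt kn.
have [nB|Bn] := leqP n (B + B).+2; first exact: Jup.
pose h := (n - B.+1)%N.
(* Here h + B = n - 1 and 2h >= n, so these powers are outside J with squares in J. Cutting [i] off
   at [B] keeps the whole sequence in this range. *)
pose f i := xpow x (h + minn i B)%N.
have fQ i : square_zero J (f i).
  split; first exact: xpow_center.
    by apply: nJlt; rewrite /h; lia.
  by rewrite /f -xpowD ?addn_gt0; [apply: Jup; rewrite /h| |]; rewrite /h; lia.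
have [i [j [ij jB fij]]] := HB f fQ.
(* Multiplying x^(h+i) = x^(h+j) by x^(n-h-j) gives x^(n-j+i) = x^n in J, below the minimal
   exponent. *)
exfalso; apply: (nJlt (n - j + i)%N); first by lia.
have -> : (n - j + i = (h + minn i B) + (n - (h + j)))%N by rewrite /h; lia.
rewrite xpowD; [|by rewrite /h; lia|by rewrite /h; lia].
rewrite -/(f i) fij /f -xpowD; [|by rewrite /h; lia|by rewrite /h; lia].
by have -> : (h + minn j B + (n - (h + j)) = n)%N by rewrite /h; lia.
Qed.

End NilElements.

(** * Roots of viable idempotents outside the maximal subgroups *)

Section ViableRoots.
Variable X : semigroup.
Local Notation "x * y" := (sg_op x y).
Hypothesis iX : ideal_C_closed Tzc X.

Lemma root_viable_part e x n : viable e -> sg_center X x -> (0 < n)%N -> xpow x n = e ->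
  viable_part e x.
Proof.
move=> ve Zx n0 xn; have ee : idempotent_el e := ve.1.
have Ze : sg_center X e by rewrite -xn; exact: xpow_center.
split; first by rewrite (Zx e).
exists (Kset e); split; first exact: K_subgroup ee.
  by apply: (Hmax_K ee); exact: Hmax_unit.
(* The inverse of x e in H_e is x^(2n-1) e; the exponent n - 1 would not be positive for n = 1. *)
have n2 : (0 < n + n - 1)%N by lia.
have inv : x * xpow x (n + n - 1) = e.
  rewrite -{1}(xpow1 x) -xpowD // (_ : 1 + (n + n - 1) = n + n)%N; last by lia.
  by rewrite xpowD // xn.
move: (xpow x (n + n - 1)) inv => k inv.
have exe : e * (x * e) = x * e by rewrite sg_opA (Zx e) -sg_opA ee.
have eke : e * (k * e) = k * e by rewrite sg_opA -(Ze k) -sg_opA ee.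
split => //; first by rewrite -sg_opA ee.
exists (k * e); split => //; first by rewrite -sg_opA ee.
  by rewrite -sg_opA eke sg_opA inv.
by rewrite -sg_opA exe sg_opA (Zx k) inv.
Qed.

Definition viable_roots : set X := (sg_center X `&` nroot (VE_set X)) `\` H_set X.

Variable pi : X -> X.
Hypothesis piP : forall x, viable_roots x -> viable (pi x) /\ exists2 n, (0 < n)%N & xpow x n = pi x.

Let pi_center x : viable_roots x -> sg_center X (pi x).
Proof.
move=> Rx; have [_ [n _ <-]] := piP Rx; case: Rx => -[Zx _] _; exact: xpow_center.
Qed.

Let pi_part x : viable_roots x -> viable_part (pi x) x.
Proof.
move=> Rx; have [ve [n n0 xn]] := piP Rx; case: Rx => -[Zx _] _.
exact: root_viable_part xn.
Qed.

Let pi_mul e x : idempotent_el e -> sg_center X e -> viable_roots x -> e * x = x -> e * pi x = pi x.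
Proof.
move=> ee Ze Rx ex; have [_ [n n0 <-]] := piP Rx.
by rewrite -[in RHS]ex (xpow_mul _ _ Ze) (xpow_idem n0 ee).
Qed.

(** A root fixed by its idempotent e would be an element of H_e. *)
Let pi_not_multiple x : viable_roots x -> pi x * x <> x.
Proof.
move=> Rx ex; have [xe Hx] := pi_part Rx; have [ve _] := piP Rx.
case: Rx => _; apply; exists (pi x); split; first exact: ve.1.
by rewrite xe ex in Hx.
Qed.

Let multiple_fix e x (w : adj1 X) : idempotent_el e ->
  (Some x : adj1 X) = sg_op (Some e : adj1 X) w -> e * x = x.
Proof. by move=> ee; case: w => [w|] [->]; rewrite ?sg_opA ee. Qed.

(** Modulo the ideal generated by e and the complement of its viable part, the roots of e are nil;
    they stay outside this ideal by [pi_not_multiple]. *)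
Lemma finite_viable_fiber e : finite_set [set x | viable_roots x /\ pi x = e].
Proof.
have [[x0 [R0 pi0]]|nx] := EM (exists x, viable_roots x /\ pi x = e); last first.
  by apply: (sub_finite_set _ (finite_set0 X)) => x Rx; apply: nx; exists x.
have ve : viable e by rewrite -pi0; case: (piP R0).
have Ze : sg_center X e by rewrite -pi0; exact: pi_center.
have HJ : is_ideal (ideal_gen (~` viable_part e) [set e]).
  by apply: ideal_gen_ideal => [|_ ->]; first exact: viable_ideal.
apply: sub_finite_set (finite_nil iX HJ) => x [Rx pix]; split.
- by case: Rx => -[].
- move=> [nP|[_ -> [w xw]]]; first by apply: nP; rewrite -pix; exact: pi_part.
  by apply: (pi_not_multiple Rx); rewrite pix; exact: multiple_fix ve.1 xw.
have [_ [n n0 xn]] := piP Rx; exists n => //; rewrite xn pix.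
by right; exists e => //; exists None.
Qed.

(* For an antichain of viable idempotents, the roots are nil modulo the ideal generated by
   the idempotents and the elements outside of every [viable_part]. *)
Lemma no_viable_antichain (s : nat -> X) :
  (forall n, [set pi x | x in viable_roots] (s n)) ->
  (forall i j, i <> j -> s i * s j <> s j) -> False.
Proof.
move=> sR anti.
have /choice [x xP] n : exists x, viable_roots x /\ pi x = s n.
  by have [x Rx pix] := sR n; exists x.
have Rx n : viable_roots (x n) by have [] := xP n.
have pix n : pi (x n) = s n by have [] := xP n.
have vs n : viable (s n) by rewrite -pix; have [] := piP (Rx n).
have Zs n : sg_center X (s n) by rewrite -pix; exact: pi_center.
pose J1 : set X := [set y | forall n, ~ viable_part (s n) y].
have HJ1 : is_ideal J1.
  by move=> y z Jy; split=> n /(viable_partM (vs n)) [] ? ?; exact: (Jy n).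
have HJ : is_ideal (ideal_gen J1 (range s)) by apply: ideal_gen_ideal => // _ [n _ <-].
apply: (injective_range_infinite (s := x) _ (finite_nil iX HJ)) => [i j ij xij|n].
  apply: (anti i j); first by move=> e; rewrite e ltnn in ij.
  by rewrite -!pix xij pix (vs j).1.
split; first by have [[]] := Rx n.
  move=> [/(_ n)|[_ [j _ <-] [w xw]]]; first by apply; rewrite -pix; exact: pi_part.
  have sx := multiple_fix (vs j).1 xw.
  have [jn|jn] := eqVneq j n; first by apply: (pi_not_multiple (Rx n)); rewrite pix -{1}jn.
  apply: (anti j n); first exact/eqP.
  by rewrite -(pix n); apply: pi_mul => //; exact: (vs j).1.
have [_ [m m0 xm]] := piP (Rx n); exists m => //; rewrite xm pix.
by right; exists (s n); [exists n|exists None].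
Qed.

(* By Ramsey's argument, an infinite set of commuting idempotents contains a monotone sequence or
   an antichain. *)
Lemma finite_viable_idempotents : finite_set [set pi x | x in viable_roots].
Proof.
apply: contrapT => iE.
have cX := ideal_C_closed_C_closed iX.
have [U [UU UE U_free]] := free_ultrafilter iE.
pose E := [set pi x | x in viable_roots].
have EZ e : E e -> sg_center X e by move=> [x Rx <-]; exact: pi_center.
have Eid e : E e -> idempotent_el e by move=> [x Rx <-]; have [[]] := piP Rx.
have nochain (s : nat -> X) : (forall n, E (s n)) -> (forall i j, (i < j)%N -> s i <> s j) ->
    ~ exists m, forall n, (m <= n)%N -> s n = s m.
  by move=> Es s_inj [m Hm]; apply: (s_inj m m.+1) => //; rewrite (Hm m.+1).
have [Uasc|Unasc] := in_ultra_setVsetC [set e | U [set f | e * f = e]] UU.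
  have [s [Ss sP]] := ultra_sequence UU U_free (filterI UE Uasc) (fun x => @proj2 (E x) _).
  apply: (nochain s) => [n|i j ij|]; [by have [] := Ss n|by have [] := sP _ _ ij|].
  apply: (ascending_chain cX) => [n|n m]; first by apply: EZ; have [] := Ss n.
  rewrite leq_eqVlt => /predU1P[->|nm]; first by apply: Eid; have [] := Ss m.
  by have [] := sP _ _ nm.
have [Udesc|Undesc] := in_ultra_setVsetC [set e | U [set f | e * f = f]] UU.
  have [s [Ss sP]] := ultra_sequence UU U_free (filterI UE Udesc) (fun x => @proj2 (E x) _).
  apply: (nochain s) => [n|i j ij|]; [by have [] := Ss n|by have [] := sP _ _ ij|].
  apply: (descending_chain cX) => [n|n m]; first by apply: EZ; have [] := Ss n.
  rewrite leq_eqVlt => /predU1P[->|nm]; first by apply: Eid; have [] := Ss m.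
  by have [] := sP _ _ nm.
have [|s [Ss sP]] := ultra_sequence UU U_free (R := fun e f => e * f <> e /\ e * f <> f)
    (filterI UE (filterI Unasc Undesc)).
  move=> e [_ [nasc ndesc]].
  have [//|Ue] := in_ultra_setVsetC [set f | e * f = e] UU.
  have [//|Ue'] := in_ultra_setVsetC [set f | e * f = f] UU.
  exact: filterI Ue Ue'.
have Es n : E (s n) by have [] := Ss n.
apply: (no_viable_antichain (s := s)) => [n|i j ij]; first exact: Es.
have [lij|lji|//] := ltngtP i j; first by have [[]] := sP _ _ lij.
by rewrite (EZ _ (Es j)); have [[]] := sP _ _ lji.
Qed.

End ViableRoots.

Arguments viable_roots X : clear implicits.

Lemma finite_viable_roots (X : semigroup) : ideal_C_closed Tzc X -> finite_set (viable_roots X).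
Proof.
move=> iX.
have /choice [pi piP] (x : X) : exists e, viable_roots X x ->
    viable e /\ exists2 n, (0 < n)%N & xpow x n = e.
  have [[[_ [n [n0 vn]]] _]|nR] := pselect (viable_roots X x); last by exists x.
  by exists (xpow x n) => _; split => //; exists n.
apply: (@sub_finite_set _ _ (\bigcup_(e in [set pi x | x in viable_roots X])
  [set x | viable_roots X x /\ pi x = e])).
  by move=> x Rx; exists (pi x) => //; exists x.
apply: bigcup_finite; first exact: finite_viable_idempotents piP.
by move=> e _; exact: finite_viable_fiber piP e.
Qed.

Theorem theorem1p7 (X : semigroup) (i : sep_class) :
  (* (1) *) (C_discrete Tzc X -> group_finite (sg_center X)) /\
  (* (2) *) (inj_C_closed Tzc X -> group_finite (sg_center X)) /\
  (* (3) *) (ideal_C_closed Tzc X -> group_bounded (sg_center X)) /\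
  (* (4) *) (C_closed Tzc X -> group_bounded (sg_ideal_center X)) /\
  (* (5) *) (ideal_C_closed i X -> forall (e : X) (ve : viable e),
               proj_C_closed i (Hsg (proj1 ve)) /\
               sg_bounded (sg_center (Hsg (proj1 ve)))) /\
  (* (6) *) (abs_C_closed i X -> forall (e : X) (ve : viable e),
               abs_C_closed i (Hsg (proj1 ve)) /\
               finite_set (sg_center (Hsg (proj1 ve)))) /\
  (* (7) *) (ideal_C_closed Tzc X ->
               finite_set ((sg_center X `&` nroot (VE_set X)) `\` H_set X)).
Proof.
split; first by move=> dX; apply: center_group_finite; left.
split; first by move=> cX; apply: center_group_finite; right.
split; first exact: ideal_closed_group_bounded.
split; first exact: ideal_center_group_bounded.
split.
  move=> iX e ve; have pH := @H_quotient_closed X e ve i iX; split => //.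
  exact: H_center_bounded (C_closed_Tz (proj_C_closed_C_closed pH)).
split; last exact: finite_viable_roots.
by move=> aX e ve; have aH := @H_closed X e ve i aX; split => //; exact: H_center_finite aH.
Qed.
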